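(* Let $M$ be a non-compact simply connected Riemannian surface and let $\tau\in\mathcal{C}^\infty(M)$ be such that $\inf_M|\tau|>\frac12\mathrm{Ch}(M)$. Then the spacetime $\mathbb{L}^3(M,\tau)$ is not distinguishing.
   Context: Cheeger constant: for a non-compact Riemannian surface $M$ without boundary, $$\mathrm{Ch}(M)=\inf\left\{\frac{\mathrm{Length}(\partial D)}{\mathrm{Area}(D)}: D\subset M\text{ open and regular}\right\}\ge 0,$$ where an open subset $D\subset M$ is regular if it is relatively compact and its boundary is a smooth curve. Space: $M$ is conformally parametrized as $M=(\Omega,\delta^{-2}(dx^2+dy^2))$, where $\Omega\subseteq\mathbb{R}^2$ is open and star-shaped with respect to the origin (e.g. a disk or the whole plane) and $\delta\in\mathcal{C}^\infty(\Omega)$ is positive. For $\tau\in\mathcal{C}^\infty(M)$, the Calabi potential is $$\mathbf{C}_{\delta,\tau}(x,y)=2\int_0^1 t\,\frac{\tau(tx,ty)}{\delta(tx,ty)^2}\,dt ,$$ and $\mathbb{L}^3(M,\tau)$ denotes $\Omega\times\mathbb{R}$, with coordinates $(x,y,z)$, endowed with the Lorentzian metric $$\frac{1}{\delta^2}(dx^2+dy^2)-\left(dz-\mathbf{C}_{\delta,\tau}(y\,dx-x\,dy)\right)^2 .$$ The unit vector field $\partial_z$ is Killing and timelike, and defines the time orientation. Distinguishing: a spacetime $\mathcal{L}$ is distinguishing if any two different points $p,q\in\mathcal{L}$ have different (chronological) futures and different (chronological) pasts. Equivalently: for any $p\in\mathcal{L}$ and any neighborhood $U$ of $p$, there exists a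 neighborhood $V\subset U$ of $p$ such that causal (i.e., non-spacelike, future- or past-directed) curves starting at $p$ and leaving $V$ never enter $V$ again. *)

(* Defs.v *)
From Stdlib Require Import Relation_Operators.
From HB Require Import structures.
From mathcomp Require Import all_boot all_order all_algebra.
From mathcomp Require Import all_classical all_reals all_analysis.

Set Implicit Arguments.
Unset Strict Implicit.
Unset Printing Implicit Defensive.

Import Order.TTheory GRing.Theory Num.Theory.
Import numFieldNormedType.Exports.

Local Open Scope classical_set_scope.
Local Open Scope ring_scope.

Section Smoothness.
Context {R : realType}.

(* Meaningful for U open; derivatives of f at points of U then depend only on
   the restriction of f to U. *)
Fixpoint Ck {V W : normedModType R} (n : nat) (U : set V) (f : V -> W) : Prop :=
  {in U, continuous f} /\
  if n is m.+1 then
    forall v, (forall p, U p -> derivable f p v) /\ Ck m U ('D_v f)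
  else True.

Definition smooth {V W : normedModType R} (U : set V) (f : V -> W) : Prop :=
  forall n, Ck n U f.

Definition star_shaped (U : set (R * R)) : Prop :=
  U 0 /\ forall (p : R * R) (t : R), U p -> 0 <= t <= 1 -> U (t *: p).

End Smoothness.

(* M = (Omega, delta^-2 (dx^2 + dy^2)); functions on M are total functions on
   the plane whose values outside Omega are irrelevant. *)
Section Surface.
Context {R : realType}.
Variables (Omega : set (R * R)) (delta : R * R -> R).

Definition metricM (p u v : R * R) : R :=
  (delta p) ^- 2 * (u.1 * v.1 + u.2 * v.2).

Definition normM (p u : R * R) : R := Num.sqrt (metricM p u u).

(* A smooth simple closed curve, parametrized as a 1-periodic immersion. *)
Definition smooth_closed_curve (c : R -> R * R) : Prop :=
  [/\ smooth [set: R^o] (c : R^o -> R * R),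
      forall t, c (t + 1) = c t,
      forall t, derive1 c t != 0 &
      {in `[0, 1[%classic &, injective c}].

Definition curve_length (c : R -> R * R) : R :=
  (\int[lebesgue_measure]_(t in `[0, 1]) normM (c t) (derive1 c t))%R.

(* delta^-2 is the density of the Riemannian area with respect to dx dy. *)
Definition area (D : set (R * R)) : R :=
  (\int[(lebesgue_measure \x lebesgue_measure)%E]_(p in D) (delta p) ^- 2)%R.

(* The boundary of a relatively compact set is compact, so that it is a smooth
   curve when it is a finite disjoint union of smooth simple closed curves.
   The empty set, for which the quotient of length by area is undefined,
   is excluded. *)
Definition regular_domain (D : set (R * R)) (n : nat) (c : 'I_n -> R -> R * R)
    : Prop :=
  [/\ open D, D !=set0, compact (closure D) /\ closure D `<=` Omega,
      (forall i, smooth_closed_curve (c i)) /\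
      trivIset [set: 'I_n] (fun i => range (c i)) &
      closure D `\` D° = \bigcup_(i in [set: 'I_n]) range (c i)].

Definition cheeger : R :=
  inf [set r | exists (D : set (R * R)) (n : nat) (c : 'I_n -> R -> R * R),
         regular_domain D c /\ r = (\sum_(i < n) curve_length (c i)) / area D].

End Surface.

Section Spacetime.
Context {R : realType}.
Variables (Omega : set (R * R)) (delta tau : R * R -> R).

Definition calabi_potential (p : R * R) : R :=
  2 * (\int[lebesgue_measure]_(t in `[0, 1])
         (t * (tau (t *: p) / (delta (t *: p)) ^+ 2)))%R.

(* Points and tangent vectors are written ((x, y), z). *)
Local Notation point := ((R * R) * R)%type.

(* The one-form dz - C (y dx - x dy) at P, evaluated on V. *)
Definition vertical_form (P V : point) : R :=
  V.2 - calabi_potential P.1 * (P.1.2 * V.1.1 - P.1.1 * V.1.2).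

Definition metricL (P U V : point) : R :=
  metricM delta P.1 U.1 V.1 - vertical_form P U * vertical_form P V.

Definition timelike (P V : point) : Prop := metricL P V V < 0.

Definition partial_z : point := ((0, 0), 1).

(* With signature (+, +, -), a timelike vector lies in the time cone of
   the time-orienting field exactly when its product with it is negative. *)
Definition future_directed (P V : point) : Prop := metricL P V partial_z < 0.

(* A smooth curve on [0, 1] is one that extends smoothly to the line; only
   its restriction to [0, 1] is constrained. *)
Definition timelike_segment (P Q : point) : Prop :=
  exists c : R -> point,
    [/\ smooth [set: R^o] (c : R^o -> point), c 0 = P, c 1 = Q &
        forall t : R, 0 <= t <= 1 ->
          [/\ Omega (c t).1, timelike (c t) (derive1 c t) &
              future_directed (c t) (derive1 c t)]].

(* Q is reached from P by a piecewise smooth future-directed timelike curve. *)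
Definition chronological : point -> point -> Prop :=
  clos_trans point timelike_segment.

Definition chron_future (P : point) : set point := [set Q | chronological P Q].

Definition chron_past (P : point) : set point := [set Q | chronological Q P].

Definition distinguishing : Prop :=
  forall P Q : point, Omega P.1 -> Omega Q.1 -> P <> Q ->
    chron_future P <> chron_future Q /\ chron_past P <> chron_past Q.

End Spacetime.

(* Main.v *)
Require Import Defs.
From Stdlib Require Import Relation_Operators.
From HB Require Import structures.
From mathcomp Require Import all_boot all_order all_algebra.
From mathcomp Require Import all_classical all_reals all_analysis.
From mathcomp Require Import measurable_realfun.
From mathcomp Require Import ring lra.

Import Order.TTheory GRing.Theory Num.Theory.
Import numFieldNormedType.Exports.

Local Open Scope classical_set_scope.
Local Open Scope ring_scope.

Set Implicit Arguments.
Unset Strict Implicit.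
Unset Printing Implicit Defensive.

(** If the spacetime is distinguishing, no two distinct points lie in each
other's chronological future.  Timelike segments over rays from 0 then show
that u(p) = inf {z | (0,0) << (p,z)} is finite on Omega, and short timelike
segments give |u(q') - u(q) - omega(q' - q)| <= ds(q, q') up to a locally
uniform relative error, where omega = C (y dx - x dy).

Let f = 2 tau / delta^2, so that div (C p) = f, i.e. omega is a primitive of
the area form - f dx dy.  Take a cutoff phi of a regular domain D, namely the
signed distance to the boundary clamped over a width 2 eps.  Since
(u_x, u_y).(phi_y, - phi_x) integrates to zero, the integral of f phi equals
that of (du - omega)(phi_y, - phi_x).  Here |grad phi| <= 1 / (2 eps) on an
eps-tube of the boundary, whose area is bounded by that of thin strips along
tangent segments.  Letting eps tend to 0, |int_D 2 tau dA| <= Length(dD).  For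
D with Length(dD) / Area(D) < 2 inf |tau| this is absurd, because tau has
constant sign.  As D is only ever seen through its cutoff, neither Green's
theorem nor the Jordan curve theorem is needed. *)

(** * Integrals and derivatives *)

(** The obstacle is regularity. The height potential u is known only to be locally Lipschitz, and
    [C], an integral along rays, enters through its continuity and its radial derivative alone, so
    neither du nor d omega is taken classically. The two terms are treated separately. Both u and
    the cutoff are averaged over small squares: Lipschitz bounds survive, and the term with du
    becomes a difference of exact partial derivatives, killed by Fubini. The term with omega is
    tested by dilations: the integral of s^2 g(s p) does not depend on s, and its derivative in s
    involves radial derivatives only.

    The factor 1 in front of the length is sharp: a tube of half-width eps has area about 2 eps
    times the length, and the cutoff has slope 1 / (2 eps). Crude covers of the tube would lose this
    factor, hence thin strips whose overlaps are negligible. The parameters are chosen in the order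
    error lam, number N of arcs with eps = lam / N, averaging width m. *)

Section Prelim.
Context {R : realType}.
Local Notation mu := (@lebesgue_measure R).

(** Only the first point is confined to [K]: continuity at the points of [K] within the ambient
    space gives a radius that also controls points just off [K], such as those of a tube around a
    curve. *)
Lemma unif_cont_compact (T : pseudoMetricType R) (K : set T) (f : T -> R) :
  compact K -> (forall x, K x -> {for x, continuous f}) ->
  forall e : R, 0 < e -> exists2 r : R, 0 < r &
    forall x y, K x -> ball x r y -> `|f x - f y| < e.
Proof.
move=> /compact_near_coveringP cK cf e e0.
have := cK R (0^'+) (fun r x => forall y, ball x r y -> `|f x - f y| < e) _.
have e20 : 0 < e / 2 by rewrite divr_gt0.
case=> [x Kx|r /= r0 rP].
  have /cvgrPdist_lt/(_ _ e20) := cf x Kx.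
  rewrite -nbhs_ballE => -[d /= d0 dP].
  exists (ball x (d / 2), [set r : R | 0 < r < d / 2]) => /=.
    split; first by apply: nbhsx_ballx; rewrite divr_gt0.
    near=> r; apply/andP; split; near: r; first exact: nbhs_right_gt.
    by apply: nbhs_right_lt; rewrite divr_gt0.
  move=> [x' r] /= [xx' /andP[r0 rd]] y x'y.
  have fx' : `|f x - f x'| < e / 2.
    by apply: dP; apply: le_ball xx'; rewrite ler_pdivrMr// ler_peMr ?ler1n// ltW.
  have fy : `|f x - f y| < e / 2.
    apply: dP; rewrite (splitr d); apply: ball_triangle xx' _.
    by apply: le_ball x'y; rewrite ltW.
  rewrite (splitr e) -(subrKA (f x)); apply: le_lt_trans (ler_normD _ _) _.
  by rewrite ltrD// distrC.
exists (r / 2) => /=; first by rewrite divr_gt0.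
move=> x y Kx xy; apply: (rP (r / 2)) xy => //=; rewrite ?divr_gt0//.
rewrite sub0r normrN gtr0_norm ?divr_gt0// ltr_pdivrMr// ltr_pMr// ltr1n//.
Unshelve. all: by end_near. Qed.

Lemma compact_open_ball (K U : set (R * R)) : compact K -> open U -> K `<=` U ->
  exists2 r : R, 0 < r & forall x y, K x -> ball x r y -> U y.
Proof.
move=> /compact_near_coveringP cK oU KU.
have [|r /= r0 rP] := cK R (0^'+) (fun r x => forall y, ball x r y -> U y) _.
  move=> x /KU Ux; have : nbhs x U by exact: open_nbhs_nbhs.
  rewrite -nbhs_ballE => -[d /= d0 dP].
  have d20 : 0 < d / 2 by rewrite divr_gt0.
  exists (ball x (d / 2), [set r : R | 0 < r < d / 2]) => /=.
    split; first exact: nbhsx_ballx.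
    near=> r; apply/andP; split; near: r; first exact: nbhs_right_gt.
    exact: nbhs_right_lt.
  move=> [x' r] /= [xx' /andP[r0 rd]] y x'y; apply: dP.
  rewrite (splitr d); apply: ball_triangle xx' _.
  by apply: le_ball x'y; rewrite ltW.
exists (r / 2) => [|x y Kx]; first by rewrite divr_gt0.
apply: (rP (r / 2)) => //=; rewrite ?divr_gt0//.
by rewrite sub0r normrN gtr0_norm ?divr_gt0// ltr_pdivrMr// ltr_pMr// ltr1n.
Unshelve. all: by end_near. Qed.

Lemma within_continuous_integrable (f : R -> R) (a b : R) : {within `[a, b], continuous f} ->
  mu.-integrable `[a, b] (EFin \o f).
Proof. by move=> cf; apply: continuous_compact_integrable => //; exact: segment_compact. Qed.

Lemma continuous_integrable (f : R -> R) (a b : R) : continuous f ->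
  mu.-integrable `[a, b] (EFin \o f).
Proof. by move=> cf; apply: within_continuous_integrable; apply: continuous_subspaceT. Qed.

Lemma itv_length (a b : R) : a <= b -> fine (mu `[a, b]) = b - a.
Proof.
move=> ab; rewrite lebesgue_measure_itv/= lte_fin.
by case: ltgtP ab => //= -> _; rewrite subrr.
Qed.

Lemma Rintegral_norm_le (f : R -> R) (a b M : R) : a <= b -> {within `[a, b], continuous f} ->
  (forall x, a <= x <= b -> `|f x| <= M) -> `|\int[mu]_(x in `[a, b]) f x| <= M * (b - a).
Proof.
move=> ab cf fM; have If := within_continuous_integrable cf.
apply: le_trans (le_normr_Rintegral _ If) _ => //.
rewrite -itv_length// -Rintegral_cst//; apply: le_Rintegral => //.
- have := integrable_norm If. by apply: eq_integrable.
- by apply: continuous_integrable => ?; exact: cvg_cst.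
Qed.

(** Joint continuity along the compact slice over [t0] gives closeness uniform in s, by the tube
    lemma. Everything is asked at or near [t0], since the integrand of the Calabi potential is
    controlled only over [Omega]. *)
Lemma Rintegral_continuous_param (T : topologicalType) (G : R -> T -> R) (a b : R) (t0 : T) : a <= b ->
  (forall s, a <= s <= b -> {for (s, t0), continuous (fun p : R * T => G p.1 p.2)}) ->
  (\forall t \near t0, {within `[a, b], continuous (G ^~ t)}) ->
  {for t0, continuous (fun t => \int[mu]_(s in `[a, b]) G s t)}.
Proof.
move=> ab cG wG; apply/cvgrPdist_le => e e0.
have ba : 0 < b - a + 1 by rewrite ltr_wpDl ?subr_ge0.
have e20 : 0 < (e / (b - a + 1)) / 2 by rewrite !divr_gt0.
have NP : \forall t \near t0, (`[a, b] `<=` (fun s => `|G s t0 - G s t| <= e / (b - a + 1)))%classic.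
  have /compact_near_coveringP cmp := @segment_compact R a b.
  apply: (cmp T (nbhs t0) (fun t s => `|G s t0 - G s t| <= e / (b - a + 1))) => s.
  rewrite /= in_itv/= => /cG /cvgrPdist_lt/(_ _ e20) [[U V] /= [Us Vt] UV].
  exists (U, V) => // -[s' t] /= [Us' Vt'].
  rewrite (splitr (e / _)) -(subrKA (G s t0)); apply: le_trans (ler_normD _ _) _.
  apply: lerD; apply: ltW; last by apply: (UV (s', t)).
  by rewrite distrC; apply: (UV (s', t0)); split => //=; exact: nbhs_singleton.
have wG0 := nbhs_singleton wG.
near=> t.
have wt : {within `[a, b], continuous (G ^~ t)} by near: t.
rewrite -RintegralB//; [|exact: within_continuous_integrable..].
have : `|\int[mu]_(x in `[a, b]) (G x t0 - G x t)| <= (e / (b - a + 1)) * (b - a).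
  apply: Rintegral_norm_le => //.
    by move=> x; apply: cvgB; [exact: wG0|exact: wt].
  move=> x xab; have : (`[a, b] `<=` (fun s => `|G s t0 - G s t| <= e / (b - a + 1)))%classic.
    near: t. exact: NP.
  by apply; rewrite /= in_itv.
move=> /le_trans; apply; rewrite mulrAC ler_pdivrMr//.
by rewrite ler_pM2l// lerDl.
Unshelve. all: by end_near. Qed.

Lemma is_derive_ext (f g : R -> R) (x d : R) : f =1 g -> is_derive x 1 f d -> is_derive x 1 g d.
Proof. by move=> /funext ->. Qed.

Lemma derive_within_cont (F f : R -> R) (a b : R) :
  (forall x, a <= x <= b -> is_derive x 1 F (f x)) -> {within `[a, b], continuous F}.
Proof.
move=> dF; apply: derivable_within_continuous => x; rewrite in_itv/= => xab.
by have [] := dF _ xab.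
Qed.

Lemma mean_value (F f : R -> R) (a b : R) : a <= b ->
  (forall x, a <= x <= b -> is_derive x 1 F (f x)) ->
  exists2 c, a <= c <= b & F b - F a = f c * (b - a).
Proof.
move=> ab dF; have [|c] := @MVT_segment R F f a b ab _ (derive_within_cont dF).
  by move=> x; rewrite in_itv/= => /andP[ax xb]; apply: dF; rewrite !ltW.
by rewrite in_itv/= => cab ->; exists c.
Qed.

Lemma Rintegral_derive (F f : R -> R) (a b : R) : a <= b -> {within `[a, b], continuous f} ->
  (forall x, a <= x <= b -> is_derive x 1 F (f x)) ->
  \int[mu]_(x in `[a, b]) f x = F b - F a.
Proof.
rewrite le_eqVlt => /predU1P[<- _ _|ab cf dF].
  by rewrite subrr /Rintegral set_itv1 integral_set1.
have cF := derive_within_cont dF.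
rewrite /Rintegral (@continuous_FTC2 _ f F a b)//.
- have /(continuous_within_itvP F ab)[_ Fa Fb] := cF.
  split=> // x; rewrite in_itv/= => /andP[ax xb].
  by have [] := dF x; rewrite ?ltW//.
- move=> x; rewrite in_itv/= => /andP[ax xb].
  rewrite derive1E; by have [|_ ->] := dF x; rewrite ?ltW.
Qed.

(** The primitive starts at [A] and the fundamental theorem applies strictly to the right of it;
    each use picks [A] below the interval it works on. *)
Lemma exists_primitive (h : R -> R) (A : R) : continuous h ->
  exists H : R -> R, forall z, A < z -> is_derive z 1 H (h z).
Proof.
move=> ch; exists (fun z => \int[mu]_(t in `[A, z]) h t) => z Az.
have zz : z < z + 1 by rewrite ltrDl.
have ci : mu.-integrable `[A, z + 1] (EFin \o h) by exact: continuous_integrable.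
have FTC := @continuous_FTC1_closed R h A z (z + 1) zz.
have cz : {for z, continuous h} := ch z.
have {FTC} := FTC ci; cbv zeta.
move=> /(_ Az cz) /= [d e].
by apply: DeriveDef; [exact: d|rewrite -e derive1E].
Qed.

Lemma is_derive_addr (H : R -> R) (x s d : R) :
  is_derive (x + s) 1 H d -> is_derive x 1 (fun x => H (x + s)) d.
Proof.
move=> dH; rewrite -[d]mulr1; apply: (@is_derive1_comp _ H (fun x => x + s)).
have := @is_deriveD _ _ _ id (cst s) x 1 1 0 (is_derive_id _ _) (is_derive_cst _ _ _).
by rewrite addr0.
Qed.

Lemma is_derive_scale (H : R -> R) (x s d : R) :
  is_derive (s * x) 1 H d -> is_derive x 1 (fun x => H (s * x)) (s * d).
Proof.
move=> dH; rewrite [s * d]mulrC; apply: (@is_derive1_comp _ H (fun x => s * x)).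
have : is_derive x 1 (s *: (@id R)) (s *: 1) by apply: is_deriveZ.
by rewrite /GRing.scale/= mulr1.
Qed.

(** Near [x] the integral equals [H (y + m) - H y] for a primitive [H] of [h], so a moving average
    of a merely continuous function is differentiable. *)
Lemma avg_derive (h : R -> R) (m x : R) : 0 < m -> continuous h ->
  is_derive x 1 (fun x => \int[mu]_(s in `[0, m]) h (x + s)) (h (x + m) - h x).
Proof.
move=> m0 ch; have [H dH] := exists_primitive (x - 1) ch.
have e1 : \forall y \near x, (H (y + m) - H y) = \int[mu]_(s in `[0, m]) h (y + s).
  near=> y; have yx : x - 1 < y.
    near: y; apply: lt_nbhsr. by rewrite ltrBlDr ltrDl.
  have -> : \int[mu]_(s in `[0, m]) h (y + s) = H (y + m) - H (y + 0); last by rewrite addr0.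
  apply: (@Rintegral_derive (fun s => H (y + s))); first by rewrite ltW.
    apply: continuous_subspaceT => z; apply: continuous_comp => //; last exact: ch.
    by apply: cvgD; [exact: cvg_cst|exact: cvg_id].
  move=> z /andP[z0 _].
  have dz : is_derive (z + y) 1 H (h (y + z)).
    by rewrite addrC; apply: dH; rewrite (lt_le_trans yx)// lerDl.
  by have := is_derive_addr dz; apply: is_derive_ext => t; rewrite addrC.
apply: near_eq_is_derive e1 _.
apply: is_deriveB; [apply: is_derive_addr|]; apply: dH.
  by rewrite ltrBlDr -addrA ltrDl addr_gt0.
by rewrite ltrBlDr ltrDl.
Unshelve. all: by end_near. Qed.

(** The substitution turns [-a, a] into [-s a, s a]. The excess carries no mass because [h] vanishes
    there, so the interval can stay fixed; in terms of a primitive, [H] is constant on the two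
    excess intervals. *)
Lemma Rintegral_scale (h : R -> R) (a s : R) : 0 < a -> 1 <= s -> continuous h ->
  (forall x, a <= `|x| -> h x = 0) ->
  \int[mu]_(x in `[- a, a]) (s * h (s * x)) = \int[mu]_(x in `[- a, a]) h x.
Proof.
move=> a0 s1 ch h0; have s0 : 0 < s by exact: lt_le_trans s1.
have [H dH] := exists_primitive (- (s * a) - 1) ch.
have aa : - a <= a by lra.
have asa : a <= s * a by rewrite ler_peMl// ltW.
have lo z : - (s * a) <= z -> - (s * a) - 1 < z.
  by apply: lt_le_trans; rewrite ltrBlDr ltrDl.
have cs : continuous (fun x => h (s * x)).
  move=> x; apply: continuous_comp; last exact: ch.
  exact: mulrl_continuous.
have -> : \int[mu]_(x in `[- a, a]) (s * h (s * x)) = H (s * a) - H (s * - a).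
  apply: (@Rintegral_derive (fun x => H (s * x))) => //.
    by apply: continuous_subspaceT => x; apply: cvgM; [exact: cvg_cst|exact: cs].
  move=> x /andP[ax xa]; apply: is_derive_scale; apply/dH/lo.
  by rewrite -mulrN ler_pM2l.
have -> : \int[mu]_(x in `[- a, a]) h x = H a - H (- a).
  apply: Rintegral_derive => //; first exact: continuous_subspaceT.
  by move=> x /andP[ax xa]; apply/dH/lo; apply: le_trans ax; rewrite lerN2.
rewrite mulrN.
have e1 : H (s * a) - H a = 0.
  have [|c /andP[ac _] ->] := @mean_value H h a (s * a) asa.
    move=> x /andP[ax _]; apply/dH/lo; apply: le_trans ax.
    by rewrite (@le_trans _ _ 0)// ?ltW// oppr_lt0 mulr_gt0.
  by rewrite h0 ?mul0r// ger0_norm// (le_trans _ ac)// ltW.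
have e2 : H (- a) - H (- (s * a)) = 0.
  have [||c /andP[_ ac] ->] := @mean_value H h (- (s * a)) (- a).
  - by rewrite lerN2.
  - by move=> x /andP[ax _]; apply/dH/lo.
  rewrite h0 ?mul0r// ler0_norm 1?lerNr//.
  by rewrite (le_trans ac)// oppr_le0 ltW.
move: e1 e2 => /subr0_eq -> /subr0_eq ->. by [].
Qed.

Lemma ball2P (p q : R * R) (e : R) :
  ball p e q <-> `|p.1 - q.1| < e /\ `|p.2 - q.2| < e.
Proof. by []. Qed.

Lemma rat_near (x r : R) : 0 < r -> exists q : rat, x - r < ratr q < x + r.
Proof.
move=> r0; have [|q] := @rat_in_itvoo R (x - r) (x + r); first by lra.
by rewrite in_itv; exists q.
Qed.

(** Measurability refers to the product sigma-algebra, so the open set is written as a countable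
    union of boxes with rational centre and half-side 1 / (n + 1). *)
Lemma open_measurable2 (U : set (R * R)) : open U -> measurable U.
Proof.
move=> oU.
pose B (i : rat * rat * nat) : set (R * R) :=
  `](ratr i.1.1 - i.2.+1%:R^-1)%R, (ratr i.1.1 + i.2.+1%:R^-1)%R[%classic `*`
  `](ratr i.1.2 - i.2.+1%:R^-1)%R, (ratr i.1.2 + i.2.+1%:R^-1)%R[%classic.
have -> : U = \bigcup_i (if `[< B i `<=` U >] then B i else set0).
  apply/seteqP; split => [[x y] Up|p [i _]]; last first.
    by case: asboolP => //= BU /BU.
  have : nbhs (x, y) U by move: oU; rewrite openE; apply.
  rewrite -nbhs_ballE => -[e /= e0 eU].
  have [n n0] : exists n : nat, n.+1%:R^-1 < e / 2.
    have := near_infty_natSinv_lt (PosNum (divr_gt0 e0 (ltr0n _ 2)))=> -[n _ /(_ n)] /= h.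
    by exists n; apply: h => /=.
  have r0 : 0 < n.+1%:R^-1 :> R by rewrite invr_gt0.
  have [[q1 q1P] [q2 q2P]] := (rat_near x r0, rat_near y r0).
  have BU : B (q1, q2, n) `<=` U.
    move=> [x' y']; rewrite /B/= !in_itv/= => -[b1 b2]; apply: eU.
    move: (n.+1%:R^-1) n0 r0 q1P q2P b1 b2 => r n0 r0 q1P q2P b1 b2.
    by apply/ball2P; rewrite /= !ltr_norml; split; apply/andP; split; lra.
  exists (q1, q2, n) => //; rewrite asboolT//.
  rewrite /B/= !in_itv/=.
  by move: (n.+1%:R^-1) q1P q2P => r q1P q2P; split; lra.
apply: countable_bigcupT_measurable => // i.
case: asboolP => // _; exact: measurableX.
Qed.

Lemma cont_measurable2 (g : R * R -> R) (D : set (R * R)) : measurable D ->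
  continuous g -> measurable_fun D g.
Proof.
move=> mD cg; apply: measurable_funTS.
apply: (measurability _ (@RGenOInfty.measurableE R)) => _ [_ [a ->] <-].
rewrite setTI; apply: open_measurable2; apply: open_comp; last exact: interval_open.
by move=> x _; exact: cg.
Qed.

Local Notation mu2 := (mu \x mu)%E.

Lemma cont_pair (T U V : topologicalType) (f : T -> U) (g : T -> V) (x : T) :
  {for x, continuous f} -> {for x, continuous g} -> {for x, continuous (fun t => (f t, g t))}.
Proof. by move=> cf cg; exact: (cvg_pair cf cg). Qed.

Lemma cont_comp2 (g : R * R -> R) (a b : R -> R) : continuous g -> continuous a -> continuous b ->
  continuous (fun x => g (a x, b x)).
Proof.
move=> cg ca cb x; apply: (@continuous_comp _ _ _ (fun x => (a x, b x)) g); last exact: cg.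
by apply: cont_pair; [exact: ca|exact: cb].
Qed.

Lemma compact_bound (T : topologicalType) (K : set T) (g : T -> R) : compact K ->
  (forall x, K x -> {for x, continuous g}) -> exists2 M : R, 0 <= M & forall x, K x -> `|g x| <= M.
Proof.
move=> cK cg.
have /compact_bounded[M [_ Mb]] : compact (g @` K).
  apply: continuous_compact => //; apply: continuous_in_subspaceT => x.
  by rewrite inE; exact: cg.
exists (`|M| + 1) => [|x Kx]; first by rewrite addr_ge0.
apply: (Mb (`|M| + 1)); last by exists x.
by rewrite ltr_pwDr// ler_norm.
Qed.

Lemma rect_compact (a b c d : R) : compact (`[a, b] `*` `[c, d] : set (R * R)).
Proof. apply: compact_setX; exact: segment_compact. Qed.

Lemma rect_measurable (a b c d : R) : measurable (`[a, b] `*` `[c, d] : set (R * R)).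
Proof. exact: measurableX. Qed.

Lemma rect_finite (a b c d : R) : (mu2 (`[a, b] `*` `[c, d]) < +oo)%E.
Proof.
rewrite product_measure1E; [|exact: measurable_itv..].
have fin (x y : R) : mu `[x, y] \is a fin_num.
  by rewrite lebesgue_measure_itv/=; case: ifP.
by rewrite ltey_eq; apply/orP; left; apply: fin_numM; exact: fin.
Qed.

Lemma rect_integrable (g : R * R -> R) (a b c d : R) : continuous g ->
  mu2.-integrable (`[a, b] `*` `[c, d]) (EFin \o g).
Proof.
move=> cg; apply: measurable_bounded_integrable.
- exact: rect_measurable.
- exact: rect_finite.
- exact: (cont_measurable2 (rect_measurable _ _ _ _)).
have [M M0 gM] := compact_bound (@rect_compact a b c d) (fun x _ => cg x).
exists M; split; first exact: num_real.
by move=> x Mx p /gM /le_trans; apply; apply: ltW.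
Qed.

Let frect (g : R * R -> R) a b c d : R * R -> \bar R := (EFin \o g) \_ (`[a, b] `*` `[c, d]).

Lemma rect_fubini1 (g : R * R -> R) (a b c d : R) : continuous g ->
  \int[mu2]_(p in `[a, b] `*` `[c, d]) g p =
  \int[mu]_(x in `[a, b]) \int[mu]_(y in `[c, d]) g (x, y).
Proof.
move=> cg.
have If : mu2.-integrable setT (frect g a b c d).
  by apply/integrable_restrict; rewrite ?setTI//; [exact: rect_measurable|exact: rect_integrable].
rewrite {1}/Rintegral integral_mkcond -(integral12_prod_meas1 If).
rewrite /Rintegral; congr fine; rewrite [RHS]integral_mkcond.
apply: eq_integral => x _; rewrite /fubini_F patchE.
case: ifPn => [xab|xab]; last first.
  rewrite integral0_eq// => y _; rewrite /frect patchE ifF//.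
  apply/negbTE; apply: contra xab; rewrite !inE/=; by case.
transitivity (\int[mu]_(y in `[c, d]) (g (x, y))%:E)%E.
  rewrite [RHS]integral_mkcond; apply: eq_integral => y _.
  rewrite /frect !patchE; congr (if _ then _ else _).
  by move: xab; rewrite inE => xab; apply/idP/idP; rewrite !inE/=; [case|split].
rewrite -[RHS]/(fine _)%:E fineK//.
apply: integrable_fin_num => //.
by apply: continuous_integrable; apply: cont_comp2 => // y; [exact: cvg_cst|exact: cvg_id].
Qed.

Lemma rect_fubini2 (g : R * R -> R) (a b c d : R) : continuous g ->
  \int[mu2]_(p in `[a, b] `*` `[c, d]) g p =
  \int[mu]_(y in `[c, d]) \int[mu]_(x in `[a, b]) g (x, y).
Proof.
move=> cg.
have If : mu2.-integrable setT (frect g a b c d).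
  by apply/integrable_restrict; rewrite ?setTI//; [exact: rect_measurable|exact: rect_integrable].
rewrite {1}/Rintegral integral_mkcond -(integral21_prod_meas1 If).
rewrite /Rintegral; congr fine; rewrite [RHS]integral_mkcond.
apply: eq_integral => y _; rewrite /fubini_G patchE.
case: ifPn => [xab|xab]; last first.
  rewrite integral0_eq// => x _; rewrite /frect patchE ifF//.
  apply/negbTE; apply: contra xab; rewrite !inE/=; by case.
transitivity (\int[mu]_(x in `[a, b]) (g (x, y))%:E)%E.
  rewrite [RHS]integral_mkcond; apply: eq_integral => x _.
  rewrite /frect !patchE; congr (if _ then _ else _).
  by move: xab; rewrite inE => xab; apply/idP/idP; rewrite !inE/=; [case|split].
rewrite -[RHS]/(fine _)%:E fineK//.
apply: integrable_fin_num => //.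
by apply: continuous_integrable; apply: cont_comp2 => // x; [exact: cvg_id|exact: cvg_cst].
Qed.

Lemma is_derive_eps (f : R -> R) (x a : R) :
  (forall e : R, 0 < e -> exists2 d : R, 0 < d & forall h, `|h| < d ->
    `|f (x + h) - f x - h * a| <= e * `|h|) ->
  is_derive x 1 f a.
Proof.
move=> H.
have C : h^-1 *: (f (h *: 1 + x) - f x) @[h --> 0^'] --> a.
  apply/cvgrPdist_le => e e0; have [d d0 dP] := H e e0.
  near=> h.
  have h0 : h != 0 by near: h; exact: nbhs_dnbhs_neq.
  have hd : `|h| < d by near: h; apply: dnbhs0_lt.
  have := dP h hd.
  have -> : f (x + h) - f x - h * a = - h * (a - h^-1 *: (f (h *: 1 + x) - f x)).
    have -> : h *: 1 + x = x + h :> R by rewrite addrC /GRing.scale/= mulr1.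
    by rewrite mulrBr /GRing.scale/= !mulNr opprK mulrA divff// mul1r addrC.
  by rewrite normrM normrN mulrC ler_pM2r// normr_gt0.
split.
  by apply/cvg_ex; exists a.
by apply: cvg_lim.
Unshelve. all: by end_near. Qed.

Lemma mean_value2 (F f : R -> R) (a b : R) :
  (forall x : R, is_derive x 1 F (f x)) ->
  exists2 c, `|c - a| <= `|b - a| & F b - F a = f c * (b - a).
Proof.
move=> dF; have [ab|/ltW ab] := leP a b.
  have [c /andP[ac cb] ->] := @mean_value F f a b ab; exists c => //.
  by rewrite !ger0_norm ?subr_ge0// lerB.
have [c /andP[ac cb] E] := @mean_value F f b a ab; exists c.
  by rewrite !ler0_norm ?subr_le0//; lra.
by rewrite -opprB E -mulrN opprB.
Qed.

Definition partials (g gx gy : R * R -> R) := forall x y : R,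
  is_derive x 1 (fun x => g (x, y)) (gx (x, y)) /\ is_derive y 1 (fun y => g (x, y)) (gy (x, y)).

Lemma cont_box (g : R * R -> R) (p : R * R) (e : R) : {for p, continuous g} -> 0 < e ->
  exists2 d, 0 < d & forall x y, `|x - p.1| < d -> `|y - p.2| < d -> `|g (x, y) - g p| < e.
Proof.
move=> /cvgrPdist_lt/[apply]; rewrite -nbhs_ballE => -[d /= d0 dP].
exists d => // x y xd yd; rewrite distrC; apply: dP; apply/ball2P => /=.
by rewrite distrC xd distrC yd.
Qed.

(** The increment is split into a horizontal step at the displaced height and a vertical step; the
    mean value theorem is applied to each, and continuity of the partials controls the errors. *)
Lemma line_derive (g gx gy : R * R -> R) (p v : R * R) (t : R) : partials g gx gy ->
  continuous gx -> continuous gy ->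
  is_derive t 1 (fun t => g (p + t *: v)) (v.1 * gx (p + t *: v) + v.2 * gy (p + t *: v)).
Proof.
move=> dg cx cy; apply: is_derive_eps => e e0.
set q := p + t *: v.
have M0 : 0 < `|v.1| + `|v.2| + 1 by rewrite ltr_wpDl// addr_ge0.
have e1 : 0 < e / (`|v.1| + `|v.2| + 1) by rewrite divr_gt0.
have [d1 d10 d1P] := cont_box (cx q) e1.
have [d2 d20 d2P] := cont_box (cy q) e1.
exists (Num.min d1 d2 / (`|v.1| + `|v.2| + 1)); first by rewrite divr_gt0// lt_min d10.
move=> h; rewrite ltr_pdivlMr// lt_min => /andP[h1 h2].
have hv1 : `|h * v.1| <= `|h| * (`|v.1| + `|v.2| + 1).
  by rewrite normrM ler_wpM2l// -addrA lerDl addr_ge0.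
have hv2 : `|h * v.2| <= `|h| * (`|v.1| + `|v.2| + 1).
  by rewrite normrM ler_wpM2l// addrAC lerDr addr_ge0.
have -> : p + (t + h) *: v = (q.1 + h * v.1, q.2 + h * v.2).
  by rewrite /q scalerDl addrA; case: (p + t *: v) => ? ?; case: (v).
have [c1 c1P E1] := @mean_value2 _ _ q.1 (q.1 + h * v.1) (fun x => (dg x (q.2 + h * v.2)).1).
have [c2 c2P E2] := @mean_value2 _ _ q.2 (q.2 + h * v.2) (fun y => (dg q.1 y).2).
have Eq : g q = g (q.1, q.2) by case: (q).
rewrite [q.1 + _]addrC addrK in c1P; rewrite [q.2 + _]addrC addrK in c2P.
have -> : g (q.1 + h * v.1, q.2 + h * v.2) - g q - h * (v.1 * gx q + v.2 * gy q) =
  h * v.1 * (gx (c1, q.2 + h * v.2) - gx q) + h * v.2 * (gy (q.1, c2) - gy q).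
  rewrite Eq; move: E1 E2; rewrite ![q.1 + _]addrC ![q.2 + _]addrC !addrK => E1 E2.
  set A := g (h * v.1 + q.1, h * v.2 + q.2); set B := g _.
  have -> : A = gx (c1, h * v.2 + q.2) * (h * v.1) + gy (q.1, c2) * (h * v.2) + B.
    rewrite -E1 -E2 /A /B; ring.
  ring.
have b1 : `|gx (c1, q.2 + h * v.2) - gx q| <= e / (`|v.1| + `|v.2| + 1).
  apply/ltW/d1P.
    by rewrite (le_lt_trans c1P)// (le_lt_trans hv1).
  by rewrite [q.2 + _]addrC addrK (le_lt_trans hv2).
have b2 : `|gy (q.1, c2) - gy q| <= e / (`|v.1| + `|v.2| + 1).
  apply/ltW/d2P; first by rewrite subrr normr0.
  by rewrite (le_lt_trans c2P)// (le_lt_trans hv2).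
apply: le_trans (ler_normD _ _) _; rewrite !normrM.
apply: (@le_trans _ _ (`|h| * `|v.1| * (e / (`|v.1| + `|v.2| + 1)) + `|h| * `|v.2| * (e / (`|v.1| +
  `|v.2| + 1)))).
  by rewrite lerD// ler_wpM2l// mulr_ge0.
rewrite -subr_ge0.
set E := e / _; have EE : e = E * (`|v.1| + `|v.2| + 1) by rewrite divfK// gt_eqF.
have -> : e * `|h| - (`|h| * `|v.1| * E + `|h| * `|v.2| * E) = `|h| * E by rewrite EE; ring.
by rewrite mulr_ge0// ltW.
Qed.

Lemma deriv_bound (f : R -> R) (x a d M : R) : 0 < d ->
  (forall h, 0 < h < d -> `|f (x + h) - f x| <= h * M) -> is_derive x 1 f a -> `|a| <= M.
Proof.
move=> d0 fM df; apply/ler_addgt0Pr => e e0.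
have [D E] := df.
have C : h^-1 *: (f (h *: 1 + x) - f x) @[h --> 0^'] --> a.
  by rewrite -E; exact: D.
have /cvgrPdist_lt/(_ _ e0) near0 := cvg_dnbhs_at_right C.
near (0 : R)^'+ => h.
have h0 : 0 < h by near: h; exact: nbhs_right_gt.
have hd : h < d by near: h; exact: nbhs_right_lt.
have : `|a - h^-1 *: (f (h *: 1 + x) - f x)| < e by near: h.
rewrite -[a in leLHS](subrK (h^-1 *: (f (h *: 1 + x) - f x))) => ae.
apply: le_trans (ler_normD _ _) _; rewrite addrC lerD ?(ltW ae)//.
rewrite /GRing.scale/= mulr1 normrM gtr0_norm ?invr_gt0// mulrC ler_pdivrMr// mulrC.
by rewrite [h + x]addrC; apply: fM; rewrite h0.
Unshelve. all: by end_near. Qed.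

(** * Mollification *)

(** Steklov averages over the one-sided window [0, m], one coordinate at a time. The difference
    quotients [diffx] and [diffy] are their derivatives in the same coordinate. *)
Definition avgx (m : R) (g : R * R -> R) (p : R * R) : R :=
  m^-1 * \int[mu]_(s in `[0, m]) g (p.1 + s, p.2).

Definition avgy (m : R) (g : R * R -> R) (p : R * R) : R :=
  m^-1 * \int[mu]_(s in `[0, m]) g (p.1, p.2 + s).

Definition diffx (m : R) (g : R * R -> R) (p : R * R) : R :=
  m^-1 * (g (p.1 + m, p.2) - g p).

Definition diffy (m : R) (g : R * R -> R) (p : R * R) : R :=
  m^-1 * (g (p.1, p.2 + m) - g p).

Section Average.
Variables (m : R) (m0 : 0 < m).

Lemma cont_fst : continuous (@fst R R).
Proof. by move=> p; exact: cvg_fst. Qed.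

Lemma cont_snd : continuous (@snd R R).
Proof. by move=> p; exact: cvg_snd. Qed.

Lemma cont_shift (w : R * R) (g : R * R -> R) : continuous g ->
  continuous (fun p => g (p.1 + w.1, p.2 + w.2)).
Proof.
move=> cg p; apply: (@continuous_comp _ _ _ (fun p : R * R => (p.1 + w.1, p.2 + w.2)) g); last exact: cg.
apply: cont_pair; (apply: cvgD; last exact: cvg_cst); [exact: cont_fst|exact: cont_snd].
Qed.

Lemma cont_shift_fst (m' : R) (g : R * R -> R) : continuous g -> continuous (fun p => g (p.1 + m', p.2)).
Proof.
by move=> cg; have := @cont_shift (m', 0) g cg; under eq_fun do rewrite /= addr0.
Qed.

Lemma cont_shift_snd (m' : R) (g : R * R -> R) : continuous g -> continuous (fun p => g (p.1, p.2 + m')).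
Proof.
by move=> cg; have := @cont_shift (0, m') g cg; under eq_fun do rewrite /= addr0.
Qed.

Lemma cont_slicex (g : R * R -> R) (x y : R) : continuous g -> continuous (fun s => g (x + s, y)).
Proof.
move=> cg; apply: cont_comp2 => // s; last exact: cvg_cst.
by apply: cvgD; [exact: cvg_cst|exact: cvg_id].
Qed.

Lemma cont_slicey (g : R * R -> R) (x y : R) : continuous g -> continuous (fun s => g (x, y + s)).
Proof.
move=> cg; apply: cont_comp2 => // s; first exact: cvg_cst.
by apply: cvgD; [exact: cvg_cst|exact: cvg_id].
Qed.

Lemma cont_snd_fst : continuous (fun q : R * (R * R) => q.2.1).
Proof.
move=> q; apply: (@continuous_comp _ _ _ (@snd R (R * R)) (@fst R R)).
  exact: cvg_snd.
exact: cvg_fst.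
Qed.

Lemma cont_snd_snd : continuous (fun q : R * (R * R) => q.2.2).
Proof.
move=> q; apply: (@continuous_comp _ _ _ (@snd R (R * R)) (@snd R R)).
  exact: cvg_snd.
exact: cvg_snd.
Qed.

Lemma cont_int_param (G : R -> R * R -> R) (a b : R) : a <= b ->
  continuous (fun q : R * (R * R) => G q.1 q.2) ->
  continuous (fun p => \int[mu]_(s in `[a, b]) G s p).
Proof.
move=> ab cG p; apply: Rintegral_continuous_param => // [s _|]; first exact: cG.
apply: filterE => q; apply: continuous_subspaceT => s.
apply: (@continuous_comp _ _ _ (fun s => (s, q)) (fun q => G q.1 q.2)); last exact: cG.
by apply: cont_pair; [exact: cvg_id|exact: cvg_cst].
Qed.

Lemma intx_cont (g : R * R -> R) : continuous g ->
  continuous (fun p : R * R => \int[mu]_(s in `[0, m]) g (p.1 + s, p.2)).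
Proof.
move=> cg; apply: (@cont_int_param (fun s p => g (p.1 + s, p.2))); first exact: ltW.
move=> q.
apply: (@continuous_comp _ _ _ (fun q : R * (R * R) => (q.2.1 + q.1, q.2.2)) g); last exact: cg.
apply: cont_pair; last exact: cont_snd_snd.
by apply: cvgD; [exact: cont_snd_fst|exact: cvg_fst].
Qed.

Lemma inty_cont (g : R * R -> R) : continuous g ->
  continuous (fun p : R * R => \int[mu]_(s in `[0, m]) g (p.1, p.2 + s)).
Proof.
move=> cg; apply: (@cont_int_param (fun s p => g (p.1, p.2 + s))); first exact: ltW.
move=> q.
apply: (@continuous_comp _ _ _ (fun q : R * (R * R) => (q.2.1, q.2.2 + q.1)) g); last exact: cg.
apply: cont_pair; first exact: cont_snd_fst.
by apply: cvgD; [exact: cont_snd_snd|exact: cvg_fst].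
Qed.

Lemma avgx_cont (g : R * R -> R) : continuous g -> continuous (avgx m g).
Proof. by move=> cg p; apply: cvgM; [exact: cvg_cst|exact: intx_cont]. Qed.

Lemma avgy_cont (g : R * R -> R) : continuous g -> continuous (avgy m g).
Proof. by move=> cg p; apply: cvgM; [exact: cvg_cst|exact: inty_cont]. Qed.

Lemma diffx_cont (g : R * R -> R) : continuous g -> continuous (diffx m g).
Proof.
move=> cg p; apply: cvgM; first exact: cvg_cst.
by apply: cvgB; [exact: cont_shift_fst|exact: cg].
Qed.

Lemma diffy_cont (g : R * R -> R) : continuous g -> continuous (diffy m g).
Proof.
move=> cg p; apply: cvgM; first exact: cvg_cst.
by apply: cvgB; [exact: cont_shift_snd|exact: cg].
Qed.

Lemma is_derive_mull (f : R -> R) (c x d : R) : is_derive x 1 f d ->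
  is_derive x 1 (fun x => c * f x) (c * d).
Proof. by move=> df; have := is_deriveZ c df. Qed.

Lemma avgx_dx (g : R * R -> R) (x y : R) : continuous g ->
  is_derive x 1 (fun x => avgx m g (x, y)) (diffx m g (x, y)).
Proof.
move=> cg; apply: is_derive_mull => /=.
apply: (@avg_derive (fun x => g (x, y))) => //.
by apply: cont_comp2 => // s; [exact: cvg_id|exact: cvg_cst].
Qed.

Lemma avgy_dy (g : R * R -> R) (x y : R) : continuous g ->
  is_derive y 1 (fun y => avgy m g (x, y)) (diffy m g (x, y)).
Proof.
move=> cg; apply: is_derive_mull => /=.
apply: (@avg_derive (fun y => g (x, y))) => //.
by apply: cont_comp2 => // s; [exact: cvg_cst|exact: cvg_id].
Qed.

(** This is Fubini. Only the outer average is differentiated directly, so both orders serve to get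
    both partials of [mollify]. *)
Lemma avg_comm (g : R * R -> R) : continuous g -> avgx m (avgy m g) = avgy m (avgx m g).
Proof.
move=> cg; apply/funext => p; rewrite /avgx /avgy/=; congr (_ * _).
rewrite !RintegralZl//; last 2 first.
- by apply: continuous_integrable; apply: (@cont_slicey _ p.1 p.2 (intx_cont cg)).
- by apply: continuous_integrable; apply: (@cont_slicex _ p.1 p.2 (inty_cont cg)).
congr (_ * _).
have cg' : continuous (fun q : R * R => g (p.1 + q.1, p.2 + q.2)).
  have := @cont_shift p g cg.
  by under eq_fun do rewrite (addrC _ p.1) (addrC _ p.2).
by rewrite -(rect_fubini1 0 m 0 m cg') (rect_fubini2 0 m 0 m cg').
Qed.

Lemma avgx_bound (g : R * R -> R) p (M : R) : continuous g ->
  (forall s, 0 <= s <= m -> `|g (p.1 + s, p.2)| <= M) -> `|avgx m g p| <= M.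
Proof.
move=> cg gM; rewrite /avgx normrM gtr0_norm ?invr_gt0// mulrC ler_pdivrMr//.
rewrite -[X in _ <= _ * X]subr0; apply: Rintegral_norm_le => //; first exact: ltW.
by apply: continuous_subspaceT; exact: cont_slicex.
Qed.

Lemma avgy_bound (g : R * R -> R) p (M : R) : continuous g ->
  (forall s, 0 <= s <= m -> `|g (p.1, p.2 + s)| <= M) -> `|avgy m g p| <= M.
Proof.
move=> cg gM; rewrite /avgy normrM gtr0_norm ?invr_gt0// mulrC ler_pdivrMr//.
rewrite -[X in _ <= _ * X]subr0; apply: Rintegral_norm_le => //; first exact: ltW.
by apply: continuous_subspaceT; exact: cont_slicey.
Qed.

Lemma avgx_shift (g : R * R -> R) (w : R * R) (c : R) p : continuous g ->
  avgx m (fun q => g (q.1 + w.1, q.2 + w.2) - g q - c) p = avgx m g (p.1 + w.1, p.2 + w.2) - avgx m g p - c.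
Proof.
move=> cg; rewrite /avgx/= !RintegralB//; last first.
- by apply: continuous_integrable => ?; exact: cvg_cst.
- apply: continuous_integrable; apply: (@cont_slicex (fun q => g (q.1 + w.1, q.2 + w.2) - g q)) => q.
  by apply: cvgB; [exact: cont_shift|exact: cg].
- by apply: continuous_integrable; exact: cont_slicex.
- by apply: continuous_integrable; apply: (@cont_slicex (fun q => g (q.1 + w.1, q.2 + w.2)));
  exact: cont_shift.
rewrite Rintegral_cst// itv_length ?(ltW m0)// subr0 !mulrBr [_ * (c * m)]mulrCA mulVf ?gt_eqF// mulr1.
by congr (_ * _ - _ - _); apply: eq_Rintegral => s _; rewrite addrAC.
Qed.

Lemma avgy_shift (g : R * R -> R) (w : R * R) (c : R) p : continuous g ->
  avgy m (fun q => g (q.1 + w.1, q.2 + w.2) - g q - c) p = avgy m g (p.1 + w.1, p.2 + w.2) - avgy m g p - c.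
Proof.
move=> cg; rewrite /avgy/= !RintegralB//; last first.
- by apply: continuous_integrable => ?; exact: cvg_cst.
- apply: continuous_integrable; apply: (@cont_slicey (fun q => g (q.1 + w.1, q.2 + w.2) - g q)) => q.
  by apply: cvgB; [exact: cont_shift|exact: cg].
- by apply: continuous_integrable; exact: cont_slicey.
- by apply: continuous_integrable; apply: (@cont_slicey (fun q => g (q.1 + w.1, q.2 + w.2)));
  exact: cont_shift.
rewrite Rintegral_cst// itv_length ?(ltW m0)// subr0 !mulrBr [_ * (c * m)]mulrCA mulVf ?gt_eqF// mulr1.
by congr (_ * _ - _ - _); apply: eq_Rintegral => s _; rewrite addrAC.
Qed.

(* Averaging over a square already gives C^1 functions with a continuous mixed
   second derivative, which is all that the exactness argument needs. *)
Definition mollify g := avgx m (avgy m g).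
Definition mollify_x g := diffx m (avgy m g).
Definition mollify_y g := diffy m (avgx m g).
Definition mollify_xy g := diffx m (diffy m g).

Lemma mollify_cont (g : R * R -> R) : continuous g -> continuous (mollify g).
Proof. by move=> cg; apply: avgx_cont; exact: avgy_cont. Qed.

Lemma mollify_x_cont (g : R * R -> R) : continuous g -> continuous (mollify_x g).
Proof. by move=> cg; apply: diffx_cont; exact: avgy_cont. Qed.

Lemma mollify_y_cont (g : R * R -> R) : continuous g -> continuous (mollify_y g).
Proof. by move=> cg; apply: diffy_cont; exact: avgx_cont. Qed.

Lemma mollify_xy_cont (g : R * R -> R) : continuous g -> continuous (mollify_xy g).
Proof. by move=> cg; apply: diffx_cont; exact: diffy_cont. Qed.

Lemma mollify_partials (g : R * R -> R) : continuous g -> partials (mollify g) (mollify_x g) (mollify_y g).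
Proof.
move=> cg x y; split; first by apply: avgx_dx; exact: avgy_cont.
rewrite /mollify (avg_comm cg); apply: avgy_dy; exact: avgx_cont.
Qed.

Lemma mollify_x_dy (g : R * R -> R) (x y : R) : continuous g ->
  is_derive y 1 (fun y => mollify_x g (x, y)) (mollify_xy g (x, y)).
Proof. move=> cg; have d1 := @avgy_dy g (x + m) y cg; have d2 := @avgy_dy g x y cg.
exact: (is_derive_mull m^-1 (is_deriveB d1 d2)).
Qed.

Lemma mollify_y_dx (g : R * R -> R) (x y : R) : continuous g ->
  is_derive x 1 (fun x => mollify_y g (x, y)) (mollify_xy g (x, y)).
Proof.
move=> cg; have -> : mollify_xy g (x, y) = diffy m (diffx m g) (x, y).
  by rewrite /mollify_xy /diffx /diffy/=; ring.
have d1 := @avgx_dx g x (y + m) cg; have d2 := @avgx_dx g x y cg.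
exact: (is_derive_mull m^-1 (is_deriveB d1 d2)).
Qed.

(** An increment estimate valid at every point of the averaging square passes to the average; [w] is
    the displacement and [c] the expected increment. *)
Lemma mollify_close (g : R * R -> R) (p w : R * R) (c M : R) : continuous g ->
  (forall q, 0 <= q.1 - p.1 <= m -> 0 <= q.2 - p.2 <= m -> `|g (q.1 + w.1, q.2 + w.2) - g q - c| <= M) ->
  `|mollify g (p.1 + w.1, p.2 + w.2) - mollify g p - c| <= M.
Proof.
move=> cg gM.
have cs h : continuous h -> continuous (fun q : R * R => h (q.1 + w.1, q.2 + w.2) - h q - c).
  move=> ch q; apply: cvgB; last exact: cvg_cst.
  by apply: cvgB; [exact: cont_shift|exact: ch].
rewrite /mollify -avgx_shift; last exact: avgy_cont.
apply: avgx_bound; first by apply: cs; exact: avgy_cont.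
move=> s s0; rewrite -avgy_shift//; apply: avgy_bound; first exact: cs.
by move=> t t0; apply: gM; rewrite /= addrAC subrr add0r.
Qed.

(** If [g] minus the linear form [l] is [k]-Lipschitz near [p], so is the average of the difference,
    and dividing by a small step bounds the gradient. The slack [r - m] keeps the averaging square
    and its translate by [h *: v] inside the ball. *)
Lemma mollify_grad (g : R * R -> R) (p l : R * R) (k r : R) : continuous g -> 0 <= k -> m < r ->
  (forall q q', ball p r q -> ball p r q' ->
     `|g q' - g q - (l.1 * (q'.1 - q.1) + l.2 * (q'.2 - q.2))| <= k * Num.sqrt ((q'.1 - q.1) ^+ 2 +
       (q'.2 - q.2) ^+ 2)) ->
  forall v : R * R, `|mollify_x g p * v.1 + mollify_y g p * v.2 - (l.1 * v.1 +
    l.2 * v.2)| <= k * Num.sqrt (v.1 ^+ 2 + v.2 ^+ 2).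
Proof.
move=> cg k0 mr gk v.
have := @line_derive _ _ _ p v 0 (mollify_partials cg) (mollify_x_cont cg) (mollify_y_cont cg).
rewrite scale0r addr0 => dm.
have dl : is_derive (0 : R) 1 (fun t => t * (l.1 * v.1 + l.2 * v.2)) (l.1 * v.1 + l.2 * v.2).
  have := @is_derive_scale id 0 (l.1 * v.1 + l.2 * v.2) 1 (is_derive_id _ _).
  by rewrite mulr1; apply: is_derive_ext => t; rewrite mulrC.
have {dm dl} dd := is_deriveB dm dl.
have M0 : 0 < `|v.1| + `|v.2| + 1 by rewrite ltr_wpDl// addr_ge0.
have d0 : 0 < (r - m) / (`|v.1| + `|v.2| + 1) by rewrite divr_gt0// subr_gt0.
have := @deriv_bound _ 0 _ _ (k * Num.sqrt (v.1 ^+ 2 + v.2 ^+ 2)) d0 _ dd.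
rewrite [v.1 * mollify_x _ _]mulrC [v.2 * mollify_y _ _]mulrC; apply => h /andP[h0].
rewrite ltr_pdivlMr// => hr.
rewrite !fctE /= !add0r scale0r addr0 mul0r subr0 addrAC.
have := @mollify_close g p (h *: v) (h * (l.1 * v.1 + l.2 * v.2)) (h * (k * Num.sqrt (v.1 ^+ 2 +
  v.2 ^+ 2))) cg.
apply => q q1 q2.
have hv1 : h * `|v.1| < r - m.
  by apply: le_lt_trans hr; rewrite ler_wpM2l ?(ltW h0)// -addrA lerDl addr_ge0.
have hv2 : h * `|v.2| < r - m.
  by apply: le_lt_trans hr; rewrite ler_wpM2l ?(ltW h0)// addrAC lerDr addr_ge0.
have hn1 := ler_norm (h * v.1); have hn1' := ler_norm (- (h * v.1)).
have hn2 := ler_norm (h * v.2); have hn2' := ler_norm (- (h * v.2)).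
move: hn1 hn1' hn2 hn2'; rewrite !normrN !normrM (gtr0_norm h0) => hn1 hn1' hn2 hn2'.
have := gk q (q.1 + (h *: v).1, q.2 + (h *: v).2).
rewrite /= ![q.1 + _]addrC ![q.2 + _]addrC !addrK /GRing.scale/=.
have -> : l.1 * (h * v.1) + l.2 * (h * v.2) = h * (l.1 * v.1 + l.2 * v.2) by ring.
have -> : (h * v.1) ^+ 2 + (h * v.2) ^+ 2 = h ^+ 2 * (v.1 ^+ 2 + v.2 ^+ 2) by ring.
rewrite sqrtrM ?sqr_ge0// sqrtr_sqr (gtr0_norm h0) [k * (h * _)]mulrCA; apply.
  by apply/ball2P; rewrite !ltr_norml; split; apply/andP; split; lra.
by apply/ball2P; rewrite /= !ltr_norml; split; apply/andP; split; lra.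
Qed.

End Average.
End Prelim.

(** * The Euclidean norm of the plane *)

Section Enorm.
Context {R : realType}.

(** The normed structure of [R * R] is the sup norm, whose balls are squares; lengths need the
    Euclidean norm. *)
Definition enorm (v : R * R) : R := Num.sqrt (v.1 ^+ 2 + v.2 ^+ 2).

Lemma enorm_ge0 v : 0 <= enorm v.
Proof. exact: sqrtr_ge0. Qed.

Lemma enorm_sq v : enorm v ^+ 2 = v.1 ^+ 2 + v.2 ^+ 2.
Proof. by rewrite sqr_sqrtr// addr_ge0// sqr_ge0. Qed.

Lemma enorm_le v (M : R) : 0 <= M -> (enorm v <= M) = (v.1 ^+ 2 + v.2 ^+ 2 <= M ^+ 2).
Proof.
by move=> M0; rewrite -enorm_sq ler_pXn2r// nnegrE enorm_ge0.
Qed.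

Lemma enormN v : enorm (- v) = enorm v.
Proof. by rewrite /enorm/= !sqrrN. Qed.

Lemma enormB v w : enorm (v - w) = enorm (w - v).
Proof. by rewrite -enormN opprB. Qed.

Lemma enorm0 : enorm 0 = 0.
Proof. by rewrite /enorm/= expr0n/= addr0 sqrtr0. Qed.

Lemma enorm_gt0 v : (0 < enorm v) = (v != 0).
Proof.
rewrite sqrtr_gt0 lt_neqAle addr_ge0 ?sqr_ge0// andbT eq_sym paddr_eq0 ?sqr_ge0//.
by rewrite !sqrf_eq0; congr (~~ _); case: v.
Qed.

Lemma enorm_dot v w : `|v.1 * w.1 + v.2 * w.2| <= enorm v * enorm w.
Proof.
rewrite -(@ler_pXn2r _ 2)// ?nnegrE ?mulr_ge0 ?enorm_ge0//.
rewrite real_normK ?num_real// exprMn !enorm_sq -subr_ge0.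
have -> : (v.1 ^+ 2 + v.2 ^+ 2) * (w.1 ^+ 2 + w.2 ^+ 2) - (v.1 * w.1 + v.2 * w.2) ^+ 2
  = (v.1 * w.2 - v.2 * w.1) ^+ 2 by ring.
exact: sqr_ge0.
Qed.

Lemma enorm_cross v w : `|v.1 * w.2 - v.2 * w.1| <= enorm v * enorm w.
Proof.
have := enorm_dot v (w.2, - w.1); rewrite /= mulrN => /le_trans; apply.
by rewrite /enorm/= sqrrN [in leLHS](addrC (w.2 ^+ 2)).
Qed.

Lemma enormD v w : enorm (v + w) <= enorm v + enorm w.
Proof.
rewrite enorm_le ?addr_ge0 ?enorm_ge0//= !sqrrD !enorm_sq.
have := le_trans (ler_norm _) (enorm_dot v w); lra.
Qed.

Lemma enormZ (k : R) v : enorm (k *: v) = `|k| * enorm v.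
Proof.
rewrite /enorm/= /GRing.scale/= !exprMn -mulrDr sqrtrM ?sqr_ge0//.
by rewrite sqrtr_sqr.
Qed.

Lemma enorm1 v : `|v.1| <= enorm v.
Proof. by rewrite -sqrtr_sqr ler_wsqrtr// lerDl sqr_ge0. Qed.

Lemma enorm2 v : `|v.2| <= enorm v.
Proof. by rewrite -sqrtr_sqr ler_wsqrtr// lerDr sqr_ge0. Qed.

Lemma enorm_sum v : enorm v <= `|v.1| + `|v.2|.
Proof.
rewrite enorm_le ?addr_ge0// !sqrrD !real_normK ?num_real//.
by have : 0 <= `|v.1| * `|v.2|; [rewrite mulr_ge0|lra].
Qed.

Lemma enorm_cont : continuous enorm.
Proof.
move=> v; apply: (@continuous_comp _ _ _ (fun v : R * R => v.1 ^+ 2 + v.2 ^+ 2)); last first.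
  exact: sqrt_continuous.
apply: cvgD; rewrite expr2; apply: cvgM; [exact: cvg_fst..|exact: cvg_snd|exact: cvg_snd].
Qed.

Lemma enorm_grad_le (g : R * R) (M : R) : 0 <= M ->
  (forall v : R * R, `|g.1 * v.1 + g.2 * v.2| <= M * enorm v) -> enorm g <= M.
Proof.
move=> M0 /(_ g); rewrite -!expr2 -enorm_sq ger0_norm ?sqr_ge0// expr2.
have := enorm_ge0 g; rewrite le_eqVlt => /predU1P[<-//|g0].
by rewrite ler_pM2r.
Qed.

End Enorm.

(** * Smoothness of affine curves *)

Section Affine.
Context {R : realType}.

Lemma Ck_cst (V W : normedModType R) (n : nat) (U : set V) (a : W) : Ck n U (cst a : V -> W).
Proof.
elim: n a => [|n IH] a; first by split=> // x _; exact: cvg_cst.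
split=> [x _|v]; first exact: cvg_cst.
split=> [p _|]; first exact: derivable_cst.
rewrite (_ : 'D_v (cst a : V -> W) = cst 0); first exact: IH.
by apply/funext => x; rewrite derive_cst.
Qed.

Lemma affine_derive (W : normedModType R) (a v : W) (t w : R^o) :
  is_derive t w (fun t : R^o => a + t *: v) (w *: v).
Proof.
have C : h^-1 *: ((fun t : R^o => a + t *: v) (h *: w + t) - (fun t :
  R^o => a + t *: v) t) @[h --> 0^'] --> w *: v.
  apply: (@cvg_trans _ (w *: v @[h --> (0 : R)^'])); last exact: cvg_cst.
  apply: near_eq_cvg; near=> h.
  have h0 : h != 0 by near: h; exact: nbhs_dnbhs_neq.
  by rewrite opprD addrACA subrr add0r scalerDl addrK scalerA [h *: w]/(h * w) mulrA mulVf// mul1r.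
by split; [apply/cvg_ex; exists (w *: v)|exact: cvg_lim].
Unshelve. all: by end_near. Qed.

Lemma affine_cont (W : normedModType R) (a v : W) : continuous (fun t : R^o => a + t *: v).
Proof.
move=> t; apply: cvgD; first exact: cvg_cst.
by apply: cvgZr_tmp; exact: cvg_id.
Qed.

Lemma affine_smooth (W : normedModType R) (a v : W) : smooth [set: R^o] (fun t : R^o => a + t *: v).
Proof.
case=> [|n]; first by split=> // x _; exact: affine_cont.
split=> [x _|w]; first exact: affine_cont.
split=> [p _|]; first by have [] := affine_derive a v p w.
rewrite (_ : 'D_w _ = cst (w *: v)); first exact: Ck_cst.
by apply/funext => x; have [_ ->] := affine_derive a v x w.
Qed.

End Affine.

(** Convexity of sup-norm balls, read in one coordinate: [a] and [a - b] are the offsets of the ends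
    of a segment from the centre. *)
Lemma convex_bound (R : realType) (a b t r : R) : `|a| < r -> `|a - b| < r -> 0 <= t <= 1 ->
  `|a - t * b| < r.
Proof.
move=> ar br /andP[t0 t1].
have -> : a - t * b = (1 - t) * a + t * (a - b) by ring.
have mr : Num.max `|a| `|a - b| < r by rewrite gt_max ar.
apply: le_lt_trans mr; set m := Num.max _ _.
have -> : m = (1 - t) * m + t * m by ring.
apply: le_trans (ler_normD _ _) _; rewrite !normrM (ger0_norm t0) ger0_norm ?subr_ge0//.
by rewrite lerD// ler_wpM2l ?subr_ge0// le_max lexx ?orbT.
Qed.

(** * The height potential of a distinguishing spacetime *)

Section Chron.
Context {R : realType}.
Variables (Omega : set (R * R)) (delta tau : R * R -> R).
Hypothesis delta_gt0 : forall p, Omega p -> 0 < delta p.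

Local Notation C := (calabi_potential delta tau).

(* The one-form C (y dx - x dy) at p, applied to v. *)
Definition omega (p v : R * R) : R := C p * (p.2 * v.1 - p.1 * v.2).

(** The quantity [k - omega (p + t *: v) v] is [vertical_form] on the velocity [(v, k)]. Exceeding
    the Riemannian length of [v] makes the velocity timelike after squaring, and being positive
    makes it future-directed. *)
Lemma straight_timelike (p v : R * R) (z k : R) :
  (forall t : R, 0 <= t <= 1 -> Omega (p + t *: v) /\
     enorm v / delta (p + t *: v) < k - omega (p + t *: v) v) ->
  timelike_segment Omega delta tau (p, z) (p + v, z + k).
Proof.
move=> H; exists (fun t : R => (p, z) + t *: (v, k)); split.
- exact: affine_smooth.
- by rewrite scale0r addr0.
- by rewrite scale1r.
move=> t t01; have [Ot kt] := H t t01.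
have -> : derive1 (fun t : R => (p, z) + t *: (v, k)) t = (v, k).
  rewrite derive1E.
  by have [_ ->] := affine_derive (p, z) (v, k) t 1; rewrite scale1r.
have d0 := delta_gt0 Ot.
have e1 : ((p, z) + t *: (v, k)).1 = p + t *: v by [].
split => //; rewrite /timelike /future_directed /metricL /vertical_form /metricM e1 /=.
  rewrite subr_lt0 -!expr2 -[X in X < _]/(_ ^- 2 * (v.1 ^+ 2 + v.2 ^+ 2)) -enorm_sq -exprVn -exprMn.
  rewrite mulrC ltr_pXn2r// ?nnegrE.
  - by rewrite divr_ge0 ?enorm_ge0// ltW.
  - by apply: le_trans (ltW kt); rewrite divr_ge0 ?enorm_ge0// ltW.
rewrite !mulr0 subrr mulr0 addr0 mulr0 subr0 mulr1 sub0r oppr_lt0.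
by apply: le_lt_trans kt; rewrite divr_ge0 ?enorm_ge0// ltW.
Qed.

Hypothesis Omega_open : open Omega.
Hypothesis Omega_star : star_shaped Omega.
Hypothesis delta_cont : forall p, Omega p -> {for p, continuous delta}.
Hypothesis tau_cont : forall p, Omega p -> {for p, continuous tau}.

Lemma density_cont p : Omega p -> {for p, continuous (fun p => tau p / delta p ^+ 2)}.
Proof.
move=> Op; have d0 := delta_gt0 Op.
apply: cvgM; first exact: tau_cont.
apply: cvgV; first by rewrite sqrf_eq0 gt_eqF.
by rewrite expr2; apply: cvgM; exact: delta_cont.
Qed.

Lemma scale_cont (s : R) (p : R * R) : {for (s, p), continuous (fun q : R * (R * R) => q.1 *: q.2)}.
Proof.
apply: (@cont_pair _ _ _ (fun q : R * (R * R) => q.1 * q.2.1) (fun q : R * (R * R) => q.1 * q.2.2)).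
  by apply: cvgM; [exact: cvg_fst|exact: cont_snd_fst].
by apply: cvgM; [exact: cvg_fst|exact: cont_snd_snd].
Qed.

Lemma calabi_cont p : Omega p -> {for p, continuous C}.
Proof.
move=> Op; apply: cvgM; first exact: cvg_cst.
have cG (s : R) q : 0 <= s <= 1 -> Omega q -> {for (s, q), continuous
    (fun q : R * (R * R) => q.1 * (tau (q.1 *: q.2) / delta (q.1 *: q.2) ^+ 2))}.
  move=> s01 Oq; apply: cvgM; first exact: cvg_fst.
  apply: (@continuous_comp _ _ _ (fun q : R * (R * R) => q.1 *: q.2) (fun p => tau p / delta p ^+ 2)).
    exact: scale_cont.
  by apply: density_cont; exact: Omega_star.2.
have := @Rintegral_continuous_param R (R * R)%type
  (fun t p => t * (tau (t *: p) / delta (t *: p) ^+ 2)) 0 1 p ler01; apply.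
  by move=> s s01; exact: cG.
have /= := open_nbhs_nbhs (conj Omega_open Op); apply: filterS => q Oq.
apply: continuous_in_subspaceT => s; rewrite inE/= in_itv/= => s01.
apply: (@continuous_comp _ _ _ (fun s => (s, q)) (fun q :
  R * (R * R) => q.1 * (tau (q.1 *: q.2) / delta (q.1 *: q.2) ^+ 2))).
  by apply: cont_pair; [exact: cvg_id|exact: cvg_cst].
exact: cG.
Qed.

Lemma omega_radial (p : R * R) (t k : R) : omega (t *: p) (k *: p) = 0.
Proof. by rewrite /omega/= /GRing.scale/=; ring. Qed.

(** One rise [k] serves the segments over the ray in both directions: omega vanishes on radial
    vectors, so only the Riemannian speed has to be exceeded. *)
Lemma radial_bound p : Omega p -> exists2 k : R, 0 < k &
  forall t : R, 0 <= t <= 1 -> Omega (t *: p) /\ enorm p / delta (t *: p) < k.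
Proof.
move=> Op.
have Ot (t : R) : 0 <= t <= 1 -> Omega (t *: p) by exact: Omega_star.2.
have [|M M0 MP] := @compact_bound R R `[0, 1] (fun t => enorm p / delta (t *: p)) (@segment_compact _ _ _).
  move=> t; rewrite /= in_itv/= => t01; apply: cvgM; first exact: cvg_cst.
  apply: cvgV; first by rewrite gt_eqF//; apply: delta_gt0; exact: Ot.
  apply: (@continuous_comp _ _ _ (fun t : R => t *: p) delta); last by apply: delta_cont; exact: Ot.
  apply: (@continuous_comp _ _ _ (fun s => (s, p)) (fun q : R * (R * R) => q.1 *: q.2));
    last exact: scale_cont.
  by apply: cont_pair; [exact: cvg_id|exact: cvg_cst].
exists (M + 1) => [|t t01]; first by rewrite ltr_wpDl.
split; first exact: Ot.
have := MP t; rewrite /= in_itv/= => /(_ t01) /(le_trans (ler_norm _)) /le_lt_trans; apply.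
by rewrite ltrDl.
Qed.

Hypothesis dist : distinguishing Omega delta tau.
Local Notation chron := (chronological Omega delta tau).

Lemma chron_trans P Q S : chron P Q -> chron Q S -> chron P S.
Proof. by move=> PQ QS; exact: t_trans PQ QS. Qed.

(** If each of [P] and [Q] precedes the other, transitivity makes their futures equal. *)
Lemma acyclic P Q : Omega P.1 -> Omega Q.1 -> P <> Q -> chron P Q -> chron Q P -> False.
Proof.
move=> OP OQ PQ cPQ cQP; have [+ _] := dist OP OQ PQ; apply.
by apply/seteqP; split => S /= h; [exact: chron_trans cQP h|exact: chron_trans cPQ h].
Qed.

Definition origin : (R * R) * R := (0, 0).

Definition reach (p : R * R) : set R := [set z | chron origin (p, z)].

(** The lower envelope of the future of the origin. As [inf] takes a default value on sets that are
    empty or unbounded below, both cases are excluded next. *)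
Definition potential (p : R * R) : R := inf (reach p).

Lemma vertical_chron (p : R * R) (z k : R) : Omega p -> 0 < k -> chron (p, z) (p, z + k).
Proof.
move=> Op k0; apply: t_step; rewrite -[p in X in _ X]addr0.
apply: straight_timelike => t _; rewrite scaler0 addr0; split => //.
by rewrite enorm0 mul0r /omega/= !mulr0 subrr mulr0 subr0.
Qed.

Lemma reach_nonempty p : Omega p -> reach p !=set0.
Proof.
move=> Op; have [k k0 kP] := radial_bound Op.
exists (0 + k); apply: t_step; rewrite /origin -[p in X in _ X]add0r.
apply: straight_timelike => t /kP[Ot kt]; rewrite add0r; split => //.
by rewrite -[p in X in omega _ X]scale1r omega_radial subr0.
Qed.

(* From (p, z) with z very negative, a timelike segment over the ray reaches the
   origin below height 0, which would close a timelike loop. *)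
Lemma reach_lbound p : Omega p -> has_lbound (reach p).
Proof.
move=> Op; have [k k0 kP] := radial_bound Op.
exists (- k) => z zp; rewrite leNgt; apply/negP => zk.
have zk0 : 0 < - (z + k) by lra.
have back : chron (p, z) origin.
  apply: (@chron_trans _ (0, z + k)); last first.
    by have := vertical_chron (z + k) Omega_star.1 zk0; rewrite subrr.
  apply: t_step; rewrite -[X in timelike_segment _ _ _ _ (X, _)](subrr p).
  apply: straight_timelike => t t01.
  have -> : p + t *: - p = (1 - t) *: p by rewrite scalerN scalerBl scale1r.
  have [|Ot kt] := kP (1 - t); first by lra.
  by rewrite enormN -(scaleN1r p) omega_radial subr0.
apply: (@acyclic origin (p, z)) back => //; first exact: Omega_star.1.
by move=> -[_ z0]; move: zk; rewrite -z0; lra.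
Qed.

(** A triangle inequality: a timelike curve reaching [(p, z)] is prolonged by the segment to
    [(p + v, z + k)]. *)
Lemma potential_le (p v : R * R) (k : R) :
  (forall t : R, 0 <= t <= 1 -> Omega (p + t *: v) /\
     enorm v / delta (p + t *: v) < k - omega (p + t *: v) v) ->
  potential (p + v) <= potential p + k.
Proof.
move=> H.
have Op : Omega p by have [] := H 0; rewrite ?lexx ?ler01// scale0r addr0.
have Oq : Omega (p + v) by have [] := H 1; rewrite ?lexx ?ler01// scale1r.
rewrite -lerBlDr; apply: lb_le_inf; first exact: reach_nonempty.
move=> z zp; rewrite lerBlDr; apply: ge_inf; first exact: reach_lbound.
by apply: chron_trans zp _; apply: t_step; exact: straight_timelike.
Qed.

(** Coefficients are frozen at [p] so that u is compared with one linear form, as [mollify_grad]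
    requires. The one-sided bound for [(q, q')] and for [(q', q)] gives both signs, omega being odd
    in the vector. *)
Lemma potential_close (K : set (R * R)) (eta : R) : compact K -> K `<=` Omega -> 0 < eta ->
  exists2 r : R, 0 < r & forall p q q', K p -> ball p r q -> ball p r q' ->
    `|potential q' - potential q - omega p (q' - q)| <= ((delta p)^-1 + eta) * enorm (q' - q).
Proof.
(* One quarter of [eta] pays for each component of omega and one for 1 / delta; for a nonzero
   displacement the last quarter makes the inequality strict, as a timelike segment demands. *)
move=> cK KO eta0; have e40 : 0 < eta / 4 by rewrite divr_gt0.
have [r1 r10 r1P] := @unif_cont_compact R (R * R)%type K (fun p => C p * p.1) cK (fun p Kp =>
  cvgM (calabi_cont (KO _ Kp)) (@cont_fst R p)) _ e40.
have [r2 r20 r2P] := @unif_cont_compact R (R * R)%type K (fun p => C p * p.2) cK (fun p Kp =>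
  cvgM (calabi_cont (KO _ Kp)) (@cont_snd R p)) _ e40.
have [r3 r30 r3P] : exists2 r3 : R, 0 < r3 & forall x y, K x -> ball x r3 y ->
  `|(delta x)^-1 - (delta y)^-1| < eta / 4.
  apply: unif_cont_compact => // p Kp; apply: cvgV; first by rewrite gt_eqF//; apply: delta_gt0; exact: KO.
  exact/delta_cont/KO.
have [r4 r40 r4P] := compact_open_ball cK Omega_open KO.
pose r := Num.min (Num.min r1 r2) (Num.min r3 r4).
have r0 : 0 < r by rewrite !lt_min r10 r20 r30 r40.
have rr1 : r <= r1 by rewrite !ge_min lexx.
have rr2 : r <= r2 by rewrite !ge_min lexx orbT.
have rr3 : r <= r3 by rewrite !ge_min lexx !orbT.
have rr4 : r <= r4 by rewrite !ge_min lexx !orbT.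
exists r => // p.
have one q q' : K p -> ball p r q -> ball p r q' ->
    potential q' - potential q - omega p (q' - q) <= ((delta p)^-1 + eta) * enorm (q' - q).
  move=> Kp pq pq'; have [->|qq'] := eqVneq q' q.
    have -> : omega p (q - q) = 0 by rewrite subrr /omega/= !mulr0 subrr mulr0.
    by rewrite !subrr enorm0 mulr0.
  have [v vE] : exists v, q' = q + v by exists (q' - q); rewrite addrC subrK.
  rewrite vE in qq' pq' *; rewrite [q + v]addrC addrK.
  have v0 : 0 < enorm v by rewrite enorm_gt0; apply: contra qq' => /eqP->; rewrite addr0.
  have := @potential_le q v (omega p v + ((delta p)^-1 + eta) * enorm v).
  rewrite [v + q]addrC => H; suff : potential (q + v) <= potential q + (omega p v + ((delta p)^-1 +
    eta) * enorm v) by lra.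
  apply: H => t t01.
  have px : ball p r (q + t *: v).
    move: pq pq' => /ball2P[a1 a2] /ball2P[b1 b2]; apply/ball2P.
    by split; rewrite /= opprD addrA; apply: convex_bound => //; rewrite -addrA -opprD.
  split; first by apply: r4P Kp _; apply: le_ball px.
  have c1 := r1P p _ Kp (le_ball rr1 px); have c2 := r2P p _ Kp (le_ball rr2 px).
  have c3 := r3P p _ Kp (le_ball rr3 px).
  set x := q + t *: v in px c1 c2 c3 *.
  have -> : omega x v = omega p v + (C p * p.1 - C x * x.1) * v.2 - (C p * p.2 - C x * x.2) * v.1.
    by rewrite /omega; ring.
  have m1 : `|(C p * p.1 - C x * x.1) * v.2| <= eta / 4 * enorm v.
    by rewrite normrM ler_pM// ?enorm2// ltW.
  have m2 : `|(C p * p.2 - C x * x.2) * v.1| <= eta / 4 * enorm v.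
    by rewrite normrM ler_pM// ?enorm1// ltW.
  have m3 : enorm v / delta x <= ((delta p)^-1 + eta / 4) * enorm v.
    rewrite mulrC ler_wpM2r ?enorm_ge0//; move: c3; rewrite ltr_norml; lra.
  move: m1 m2; rewrite !ler_norml => m1 m2.
  have : 0 < eta / 4 * enorm v by rewrite mulr_gt0.
  move: m1 m2 m3; rewrite !mulrDl; lra.
move=> q q' Kp pq pq'; rewrite ler_norml one// andbT lerNl.
have := one q' q Kp pq' pq; rewrite enormB.
have -> : omega p (q - q') = - omega p (q' - q) by rewrite /omega/=; ring.
lra.
Qed.

End Chron.

(** * A weak Stokes formula *)

Section Stokes.
Context {R : realType}.
Local Notation mu := (@lebesgue_measure R).
Local Notation mu2 := (mu \x mu)%E.
Variables (a : R) (a0 : 0 < a).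
Local Notation Q := (`[- a, a] `*` `[- a, a]).

Let aa : - a <= a. Proof. by move: a0 => ?; lra. Qed.

Lemma integral_dx0 (g gx : R * R -> R) : continuous gx ->
  (forall x y : R, is_derive x 1 (fun x => g (x, y)) (gx (x, y))) ->
  (forall y, g (- a, y) = 0) -> (forall y, g (a, y) = 0) -> \int[mu2]_(p in Q) gx p = 0.
Proof.
move=> cg dg ga1 ga2; rewrite (rect_fubini2 _ _ _ _ cg).
have E y : \int[mu]_(x in `[- a, a]) gx (x, y) = 0.
  have -> : \int[mu]_(x in `[- a, a]) gx (x, y) = g (a, y) - g (- a, y).
    apply: (@Rintegral_derive _ (fun x => g (x, y))) => //.
    apply: continuous_subspaceT; apply: cont_comp2 => // x; [exact: cvg_id|exact: cvg_cst].
  by rewrite ga1 ga2 subrr.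
under eq_Rintegral do rewrite E.
by rewrite Rintegral_cst// mul0r.
Qed.

Lemma integral_dy0 (g gy : R * R -> R) : continuous gy ->
  (forall x y : R, is_derive y 1 (fun y => g (x, y)) (gy (x, y))) ->
  (forall x, g (x, - a) = 0) -> (forall x, g (x, a) = 0) -> \int[mu2]_(p in Q) gy p = 0.
Proof.
move=> cg dg ga1 ga2; rewrite (rect_fubini1 _ _ _ _ cg).
have E x : \int[mu]_(y in `[- a, a]) gy (x, y) = 0.
  have -> : \int[mu]_(y in `[- a, a]) gy (x, y) = g (x, a) - g (x, - a).
    apply: (@Rintegral_derive _ (fun y => g (x, y))) => //.
    apply: continuous_subspaceT; apply: cont_comp2 => // y; [exact: cvg_cst|exact: cvg_id].
  by rewrite ga1 ga2 subrr.
under eq_Rintegral do rewrite E.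
by rewrite Rintegral_cst// mul0r.
Qed.

Lemma rect_norm_le (h : R * R -> R) (M : R) : continuous h ->
  (forall p, Q p -> `|h p| <= M) -> `|\int[mu2]_(p in Q) h p| <= M * fine (mu2 Q).
Proof.
move=> ch hM.
have Ih := rect_integrable (- a) a (- a) a ch.
have mQ := @rect_measurable R (- a) a (- a) a.
have := le_normr_Rintegral _ Ih => /(_ mQ) /le_trans; apply.
rewrite -Rintegral_cst//; apply: le_Rintegral => //.
- by have := integrable_norm Ih; apply: eq_integrable.
- by apply: rect_integrable => ?; exact: cvg_cst.
Qed.

Lemma scale2_cont (s : R) (g : R * R -> R) : continuous g -> continuous (fun p : R * R => g (s *: p)).
Proof.
move=> cg p; apply: (@continuous_comp _ _ _ (fun p : R * R => (s * p.1, s * p.2)) g); last exact: cg.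
by apply: cont_pair; (apply: cvgM; first exact: cvg_cst); [exact: cont_fst|exact: cont_snd].
Qed.

(** The two coordinates are dilated in turn by [Rintegral_scale]; [s ^+ 2] is the Jacobian. *)
Lemma integral_scale2 (g : R * R -> R) (s : R) : continuous g -> 1 <= s ->
  (forall p : R * R, a <= `|p.1| \/ a <= `|p.2| -> g p = 0) ->
  \int[mu2]_(p in Q) (s ^+ 2 * g (s *: p)) = \int[mu2]_(p in Q) g p.
Proof.
move=> cg s1 g0.
have cgs : continuous (fun p : R * R => s ^+ 2 * g (s *: p)).
  by move=> p; apply: cvgM; [exact: cvg_cst|exact: scale2_cont].
rewrite (rect_fubini1 _ _ _ _ cgs) (rect_fubini1 _ _ _ _ cg).
pose G x := \int[mu]_(y in `[- a, a]) g (x, y).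
have cG : continuous G.
  move=> x; have := @cont_int_param R (fun s p => g (p.1, s)) (- a) a aa.
  have cg' : continuous (fun q : R * (R * R) => g (q.2.1, q.1)).
    move=> q; apply: (@continuous_comp _ _ _ (fun q : R * (R * R) => (q.2.1, q.1)) g); last exact: cg.
    by apply: cont_pair; [exact: cont_snd_fst|exact: cvg_fst].
  move=> /(_ cg') cG.
  apply: (@continuous_comp _ _ _ (fun x => (x, 0 : R)) (fun p :
    R * R => \int[mu]_(s in `[- a, a]) g (p.1, s))).
    by apply: cont_pair; [exact: cvg_id|exact: cvg_cst].
  exact: cG.
transitivity (\int[mu]_(x in `[- a, a]) (s * G (s * x))); last first.
  apply: Rintegral_scale => // x ax; rewrite /G.
  have E y : g (x, y) = 0 by apply: g0; left.
  under eq_Rintegral do rewrite E.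
  by rewrite Rintegral_cst// mul0r.
apply: eq_Rintegral => x _.
have cx : continuous (fun y => g (s * x, y)).
  by apply: cont_comp2 => // y; [exact: cvg_cst|exact: cvg_id].
rewrite /G -(@Rintegral_scale _ _ a s a0 s1 cx); last by move=> y ay; apply: g0; right.
rewrite -RintegralZl//; last first.
  apply: continuous_integrable => y; apply: cvgM; first exact: cvg_cst.
  by apply: (@continuous_comp _ _ _ (fun y => s * y) (fun y => g (s * x, y)));
    [exact: mulrl_continuous|exact: cx].
by apply: eq_Rintegral => y _; rewrite expr2 -mulrA.
Qed.

(* The integral of s^2 g(s p) does not depend on s, so its derivative at s = 1
   integrates to zero. *)
Lemma integral_scaling_derive (g F : R * R -> R) : continuous g -> continuous F ->
  (forall p : R * R, a <= `|p.1| \/ a <= `|p.2| -> g p = 0) ->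
  (forall (p : R * R) (s : R), 1 <= s <= 2 ->
     is_derive s 1 (fun s => s ^+ 2 * g (s *: p)) (s * F (s *: p))) ->
  \int[mu2]_(p in Q) F p = 0.
Proof.
move=> cg cF g0 dg; apply/eqP; rewrite -normr_le0; apply/ler_addgt0Pl => e e0; rewrite addr0.
set A := fine (mu2 Q); have A0 : 0 < A + 1 by rewrite ltr_wpDl// fine_ge0// measure_ge0.
have eA : 0 < e / (A + 1) by rewrite divr_gt0.
have cK : compact ([set (1 : R)] `*` Q).
  by apply: compact_setX; [exact: compact_set1|exact: rect_compact].
have cH : continuous (fun q : R * (R * R) => q.1 * F (q.1 *: q.2)).
  move=> q; apply: cvgM; first exact: cvg_fst.
  apply: (@continuous_comp _ _ _ (fun q : R * (R * R) => (q.1 * q.2.1, q.1 * q.2.2)) F); last exact: cF.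
  by apply: cont_pair; (apply: cvgM; first exact: cvg_fst); [exact: cont_snd_fst|exact: cont_snd_snd].
have [r r0 rP] := unif_cont_compact cK (fun q _ => cH q) eA.
(* [d < r] serves uniform continuity, and [d <= 1] keeps 1 + d in the interval [1, 2] on which [dg]
   holds. *)
pose d := Num.min r 1 / 2.
have d0 : 0 < d by rewrite divr_gt0// lt_min r0/=.
have dr : d < r.
  rewrite /d ltr_pdivrMr//; apply: (@le_lt_trans _ _ r); first by rewrite ge_min lexx.
  by rewrite ltr_pMr// ltr1n.
have d1 : d <= 1.
  rewrite /d ler_pdivrMr// mul1r; apply: (@le_trans _ _ 1); last by rewrite ler1n.
  by rewrite ge_min lexx orbT.
(* The difference quotient between 1 and 1 + d integrates to exactly zero, while the mean value
   theorem makes it uniformly close to [F]. *)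
pose h p := d^-1 * ((1 + d) ^+ 2 * g ((1 + d) *: p) - g p).
have cs : continuous (fun p : R * R => (1 + d) ^+ 2 * g ((1 + d) *: p)).
  by move=> p; apply: cvgM; [exact: cvg_cst|exact: scale2_cont].
have csg : continuous (fun p : R * R => (1 + d) ^+ 2 * g ((1 + d) *: p) - g p).
  by move=> p; apply: cvgB; [exact: cs|exact: cg].
have ch : continuous h by move=> p; apply: cvgM; [exact: cvg_cst|exact: csg].
have mQ := @rect_measurable R (- a) a (- a) a.
have ih : \int[mu2]_(p in Q) h p = 0.
  rewrite RintegralZl//; last exact: rect_integrable.
  rewrite RintegralB//; [|exact: rect_integrable..].
  by rewrite integral_scale2// ?subrr ?mulr0// lerDl ltW.
have -> : \int[mu2]_(p in Q) F p = \int[mu2]_(p in Q) (F p - h p).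
  by rewrite RintegralB//; [rewrite ih subr0|exact: rect_integrable..].
apply: (@le_trans _ _ (e / (A + 1) * A)); last first.
  by rewrite mulrAC ler_pdivrMr// ler_pM2l// lerDl.
apply: rect_norm_le => [p|p Qp]; first by apply: cvgB; [exact: cF|exact: ch].
have [c /andP[c1 c2] E] : exists2 c, 1 <= c <= 1 + d &
    (1 + d) ^+ 2 * g ((1 + d) *: p) - 1 ^+ 2 * g (1 *: p) = c * F (c *: p) * (1 + d - 1).
  apply: (@mean_value _ (fun s => s ^+ 2 * g (s *: p)) (fun s => s * F (s *: p)) 1 (1 + d)).
    by rewrite lerDl ltW.
  by move=> x /andP[x1 x2]; apply: dg; rewrite x1 (le_trans x2)// -[X in _ <= X]/(1 + 1) lerD2l.
move: E; rewrite expr1n mul1r scale1r [1 + d - 1]addrAC subrr add0r => E.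
rewrite /h E mulrCA mulVf ?gt_eqF// mulr1.
have := rP (1, p) (c, p); rewrite /= mul1r scale1r => H; apply/ltW/H => //.
split => /=; last exact: ballxx.
suff : `|1 - c| < r by [].
by rewrite distrC ger0_norm ?subr_ge0//; move: dr; lra.
Qed.

(** Where [B] and its derivative vanish, continuity of [A] is enough, by the criterion of
    Caratheodory. This serves the points outside [S], where nothing is assumed on the radial
    derivative of [C]. *)
Lemma is_derive_mul0 (A B : R -> R) (s : R) : {for s, continuous A} -> is_derive s 1 B 0 -> B s = 0 ->
  is_derive s 1 (fun s => A s * B s) 0.
Proof.
move=> cA /is_derive1_caratheodory[k [kE ck k0]] B0; apply/is_derive1_caratheodory.
exists (fun z => A z * k z); split.
- by move=> z; rewrite B0 mulr0 subr0 -mulrA -kE B0 subr0.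
- by apply: cvgM.
- by rewrite k0 mulr0.
Qed.

(* The hypothesis [radial] is div (C p) = f integrated along rays: it makes sense
   for functions C that are merely continuous. *)
Section WeakStokes.
Variables (m : R) (m0 : 0 < m) (ph u f C : R * R -> R) (S : set (R * R)).
Hypotheses (cph : continuous ph) (cu : continuous u) (cf : continuous f) (cC : continuous C).
Local Notation phi := (mollify m ph).
Local Notation phix := (mollify_x m ph).
Local Notation phiy := (mollify_y m ph).
Local Notation Ux := (mollify_x m u).
Local Notation Uy := (mollify_y m u).
Hypothesis Sa : forall p, S p -> `|p.1| < a /\ `|p.2| < a.
Hypothesis phi0 : forall p, ~ S p -> [/\ phi p = 0, phix p = 0 & phiy p = 0].
Hypothesis radial : forall (p : R * R) (s : R), 1 <= s <= 2 -> S (s *: p) ->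
  is_derive s 1 (fun s => s ^+ 2 * C (s *: p)) (s * f (s *: p)).

Let out (p : R * R) : a <= `|p.1| \/ a <= `|p.2| -> [/\ phi p = 0, phix p = 0 & phiy p = 0].
Proof.
by move=> h; apply: phi0 => /Sa[]; case: h => h1 h2 h3; move: h2 h3; rewrite !ltNge h1.
Qed.

Let cphi := mollify_cont m0 cph.
Let cphix := mollify_x_cont m0 cph.
Let cphiy := mollify_y_cont m0 cph.
Let cU := mollify_cont m0 cu.
Let cUx := mollify_x_cont m0 cu.
Let cUy := mollify_y_cont m0 cu.
Let cphixy := @mollify_xy_cont R m ph cph.

Let norma : `|a| = a. Proof. by rewrite gtr0_norm. Qed.

(* The integrand is d_x (U phi_y) - d_y (U phi_x), as the mixed derivatives of phi
   cancel. *)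
Lemma exact_part : \int[mu2]_(p in Q) (Ux p * phiy p - Uy p * phix p) = 0.
Proof.
pose P1 p := Ux p * phiy p + mollify m u p * mollify_xy m ph p.
pose P2 p := Uy p * phix p + mollify m u p * mollify_xy m ph p.
have cP1 : continuous P1.
  by move=> p; apply: cvgD; apply: cvgM; [exact: cUx|exact: cphiy|exact: cU|exact: cphixy].
have cP2 : continuous P2.
  by move=> p; apply: cvgD; apply: cvgM; [exact: cUy|exact: cphix|exact: cU|exact: cphixy].
have i1 : \int[mu2]_(p in Q) P1 p = 0.
  apply: (@integral_dx0 (fun p => mollify m u p * phiy p)) => // [x y|y|y].
  - have d1 := (mollify_partials m0 cu x y).1; have d2 := mollify_y_dx m0 x y cph.
    have := is_deriveM d1 d2; rewrite /GRing.scale/= [P1 _]addrC; rewrite [phiy _ * _]mulrC.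
    exact.
  - by have [|_ _ ->] := @out (- a, y); [left; rewrite /= normrN norma|rewrite mulr0].
  - by have [|_ _ ->] := @out (a, y); [left; rewrite /= norma|rewrite mulr0].
have i2 : \int[mu2]_(p in Q) P2 p = 0.
  apply: (@integral_dy0 (fun p => mollify m u p * phix p)) => // [x y|x|x].
  - have d1 := (mollify_partials m0 cu x y).2; have d2 := mollify_x_dy m0 x y cph.
    have := is_deriveM d1 d2; rewrite /GRing.scale/= [P2 _]addrC; rewrite [phix _ * _]mulrC.
    exact.
  - by have [|_ -> _] := @out (x, - a); [right; rewrite /= normrN norma|rewrite mulr0].
  - by have [|_ -> _] := @out (x, a); [right; rewrite /= norma|rewrite mulr0].
transitivity (\int[mu2]_(p in Q) (P1 p - P2 p)).
  by apply: eq_Rintegral => p _; rewrite /P1 /P2; ring.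
by rewrite RintegralB ?i1 ?i2 ?subrr//; [exact: rect_measurable|exact: rect_integrable..].
Qed.

(** The integrand is div (phi C p): the derivative of s^2 C(s p) phi(s p) in s is s times its value
    at s p, as [integral_scaling_derive] requires. *)
Lemma radial_part : \int[mu2]_(p in Q) (f p * phi p + C p * (p.1 * phix p + p.2 * phiy p)) = 0.
Proof.
have cF : continuous (fun p => f p * phi p + C p * (p.1 * phix p + p.2 * phiy p)).
  move=> p; apply: cvgD; first by apply: cvgM; [exact: cf|exact: cphi].
  apply: cvgM; first exact: cC.
  by apply: cvgD; apply: cvgM; [exact: cont_fst|exact: cphix|exact: cont_snd|exact: cphiy].
apply: (@integral_scaling_derive (fun p => C p * phi p)) => //.
- by move=> p; apply: cvgM; [exact: cC|exact: cphi].
- by move=> p /out[-> _ _]; rewrite mulr0.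
move=> p s s12.
have dphi := @line_derive _ _ _ _ 0 p s (mollify_partials m0 cph) cphix cphiy.
rewrite add0r in dphi.
have {}dphi : is_derive s 1 (fun s : R => phi (s *: p)) (p.1 * phix (s *: p) + p.2 * phiy (s *: p)).
  by move: dphi; apply: is_derive_ext => t; rewrite add0r.
have E : (fun s : R => s ^+ 2 * C (s *: p) * phi (s *: p)) =1 (fun s => s ^+ 2 * (C (s *: p) * phi (s
  *: p))).
  by move=> t; rewrite mulrA.
apply: is_derive_ext E _.
(* Inside [S] the product rule applies with [radial]; outside, phi vanishes to first order and
   [is_derive_mul0] takes over. *)
have [Ss|Ss] := pselect (S (s *: p)).
  have := is_deriveM (radial s12 Ss) dphi.
  set D1 := (X in is_derive _ _ _ X -> _); set D2 := (X in _ -> is_derive _ _ _ X).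
  have -> : D1 = D2; last exact.
  rewrite /D1 /D2 (_ : (s *: p).1 = s * p.1)// (_ : (s *: p).2 = s * p.2)//.
  by move: (s *: p) => q; rewrite /GRing.scale/=; ring.
have [z zx zy] := phi0 Ss.
rewrite z zx zy !mulr0 addr0 mulr0 addr0 mulr0.
move: dphi; rewrite zx zy !mulr0 addr0 => dphi.
apply: is_derive_mul0 => //.
apply: cvgM; first by rewrite expr2; apply: cvgM; exact: cvg_id.
apply: (@continuous_comp _ _ _ (fun s : R => (s * p.1, s * p.2)) C); last exact: cC.
by apply: cont_pair; apply: mulrr_continuous.
Qed.

(** This is du - omega evaluated on the rotated gradient (phi_y, - phi_x), with u averaged. *)
Definition stokes_integrand p := Ux p * phiy p - Uy p * phix p - C p * (p.1 * phix p + p.2 * phiy p).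

Lemma stokes_integrand_cont : continuous stokes_integrand.
Proof.
move=> p; apply: cvgB.
  by apply: cvgB; apply: cvgM; [exact: cUx|exact: cphiy|exact: cUy|exact: cphix].
apply: cvgM; first exact: cC.
by apply: cvgD; apply: cvgM; [exact: cont_fst|exact: cphix|exact: cont_snd|exact: cphiy].
Qed.

Lemma weak_stokes : \int[mu2]_(p in Q) (f p * phi p) = \int[mu2]_(p in Q) stokes_integrand p.
Proof.
have cfp : continuous (fun p => f p * phi p) by move=> p; apply: cvgM; [exact: cf|exact: cphi].
have cCp : continuous (fun p => C p * (p.1 * phix p + p.2 * phiy p)).
  move=> p; apply: cvgM; first exact: cC.
  by apply: cvgD; apply: cvgM; [exact: cont_fst|exact: cphix|exact: cont_snd|exact: cphiy].
have cex : continuous (fun p => Ux p * phiy p - Uy p * phix p).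
  by move=> p; apply: cvgB; apply: cvgM; [exact: cUx|exact: cphiy|exact: cUy|exact: cphix].
have mQ := @rect_measurable R (- a) a (- a) a.
rewrite /stokes_integrand RintegralB//; [|exact: rect_integrable..].
have := radial_part; rewrite RintegralD//; [|exact: rect_integrable..].
by rewrite exact_part => /eqP; rewrite addr_eq0 => /eqP ->; rewrite sub0r.
Qed.

End WeakStokes.
End Stokes.

(** * Cutoff functions of a domain *)

Section Distance.
Context {R : realType}.
Variables (B : set (R * R)) (B0 : B !=set0).

Definition bdist (p : R * R) : R := inf [set enorm (p - b) | b in B].

Let bdist_lb p : has_lbound [set enorm (p - b) | b in B].
Proof. by exists 0 => _ [b _ <-]; exact: enorm_ge0. Qed.

Let bdist_ne p : [set enorm (p - b) | b in B] !=set0.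
Proof. by case: B0 => b Bb; exists (enorm (p - b)), b. Qed.

Lemma bdist_le p b : B b -> bdist p <= enorm (p - b).
Proof. by move=> Bb; apply: ge_inf => //; exists b. Qed.

Lemma bdist_ge0 p : 0 <= bdist p.
Proof. by apply: lb_le_inf => // _ [b _ <-]; exact: enorm_ge0. Qed.

Lemma bdist_lip p q : bdist p <= bdist q + enorm (p - q).
Proof.
rewrite -lerBlDr; apply: lb_le_inf => // _ [b Bb <-].
rewrite lerBlDr; apply: le_trans (bdist_le p Bb) _.
by rewrite [leRHS]addrC -(subrKA q p); exact: enormD.
Qed.

Lemma bdist_lt p e : bdist p < e -> exists2 b, B b & enorm (p - b) < e.
Proof.
move=> /inf_lt-/(_ (bdist_ne p))[_ [b Bb <-] be].
by exists b.
Qed.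

End Distance.

Section Cutoff.
Context {R : realType}.
Variables (D B : set (R * R)).
Hypotheses (oD : open D) (DB : closure D `\` D `<=` B) (B0 : B !=set0).

(** At the supremum of the parameters whose point is in [D], the point belongs to the closure of
    [D], and not to [D] since [D] is open. *)
Lemma segment_crossing (p q : R * R) : D p -> ~ D q ->
  exists2 b, B b & enorm (p - b) + enorm (b - q) <= enorm (p - q).
Proof.
move=> Dp Dq.
pose g (s : R) := p + s *: (q - p).
pose A := [set s : R | 0 <= s <= 1 /\ D (g s)].
have A0 : A 0 by split; rewrite ?lexx ?ler01// /g scale0r addr0.
have Aub : ubound A 1 by move=> s [/andP[]].
have hA : has_sup A by split; [exists 0|exists 1].
set t := sup A.
have t1 : t <= 1 by apply: ge_sup => //; exists 0.
have t0 : 0 <= t by apply: ub_le_sup => //; exists 1.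
have cg : continuous g.
  move=> s; apply: (@affine_cont R (R * R)%type p (q - p)).
have ncl : closure D (g t).
  move=> U /(cg t) gU.
  have [e /= e0 eU] : exists2 e : R, 0 < e & ball t e `<=` g @^-1` U.
    by move: gU; rewrite -nbhs_ballE.
  have [s [s01 Ds] ts] := sup_adherent e0 hA.
  exists (g s); split => //; apply: eU.
  suff : `|t - s| < e by [].
  have st : s <= t by apply: ub_le_sup => //; exists 1.
  by rewrite ger0_norm ?subr_ge0// ltrBlDr -ltrBlDl.
have nD : ~ D (g t).
  move=> Dt; have [tE|tn] := eqVneq t 1.
    by apply: Dq; move: Dt; rewrite /g tE scale1r addrC subrK.
  have t1' : t < 1 by rewrite lt_neqAle tn.
  have : nbhs (g t) D by exact: open_nbhs_nbhs.
  move=> /(cg t); rewrite -nbhs_ballE => -[e /= e0 eD].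
  pose s := t + Num.min (e / 2) (1 - t).
  have m0 : 0 < Num.min (e / 2) (1 - t) by rewrite lt_min divr_gt0//= subr_gt0.
  have : s <= t.
    apply: ub_le_sup; first by exists 1.
    split.
      rewrite /s addr_ge0 ?(ltW m0)//=.
      by rewrite -lerBrDl ge_min lexx orbT.
    apply: eD; suff : `|t - s| < e by [].
    rewrite /s opprD addrA subrr add0r normrN gtr0_norm//.
    by rewrite gt_min ltr_pdivrMr// ltr_pMr// ltr1n.
  by rewrite /s gerDl leNgt m0.
exists (g t); first by apply: DB.
have -> : p - g t = t *: (p - q) by rewrite /g opprD addrA subrr add0r -scalerN opprB.
have -> : g t - q = (1 - t) *: (p - q).
  by rewrite /g scalerBl scale1r -scalerN opprB addrAC.
by rewrite !enormZ -mulrDl !ger0_norm ?subr_ge0// addrC subrK mul1r.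
Qed.

Definition sdist (p : R * R) : R := if `[< D p >] then bdist B p else - bdist B p.

(** Between points on opposite sides the segment meets [B], so their two distances to [B] add up to
    at most its length. *)
Lemma sdist_lip p q : `|sdist p - sdist q| <= enorm (p - q).
Proof.
have one p' q' : D p' -> ~ D q' -> bdist B p' + bdist B q' <= enorm (p' - q').
  move=> Dp Dq; have [b Bb /(le_trans _)] := segment_crossing Dp Dq; apply.
  by rewrite lerD// ?bdist_le// enormB bdist_le.
have l1 := bdist_lip B0 p q; have l2 := bdist_lip B0 q p; rewrite enormB in l2.
have p0 := bdist_ge0 B0 p; have q0 := bdist_ge0 B0 q.
rewrite /sdist; case: asboolP => Dp; case: asboolP => Dq; rewrite ler_norml; apply/andP; split; try lra.
- have := one _ _ Dp Dq; lra.
- have := one _ _ Dq Dp; rewrite enormB; lra.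
Qed.

Variables (e : R) (e0 : 0 < e).

Definition clamp (x : R) : R := Num.max 0 (Num.min 1 x).

Lemma clamp_lip x y : `|clamp x - clamp y| <= `|x - y|.
Proof.
have hx := ler_norm (x - y); have := ler_norm (- (x - y)); rewrite normrN => hy.
rewrite /clamp ler_norml; case: (leP 1 x) => x1; case: (leP 1 y) => y1;
  case: (leP 0 x) => x0; case: (leP 0 y) => y0; rewrite ?(max_r (@ler01 R)); apply/andP; split; lra.
Qed.

(** It rises from 0 at signed distance - e to 1 at e; its slope is the inverse of the width 2 e of
    the tube. *)
Definition cutoff (p : R * R) : R := clamp (2^-1 + sdist p / (2 * e)).

Lemma cutoff_lip p q : `|cutoff p - cutoff q| <= (2 * e)^-1 * enorm (p - q).
Proof.
apply: le_trans (clamp_lip _ _) _.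
have -> : 2^-1 + sdist p / (2 * e) - (2^-1 + sdist q / (2 * e)) = (2 * e)^-1 * (sdist p - sdist q) by ring.
by rewrite normrM gtr0_norm ?invr_gt0 ?mulr_gt0// ler_wpM2l ?sdist_lip// invr_ge0 ltW// mulr_gt0.
Qed.

Lemma cutoff_far p : e <= bdist B p -> cutoff p = if `[< D p >] then 1 else 0.
Proof.
move=> ep; have e20 : 0 < 2 * e by rewrite mulr_gt0.
have h : 2^-1 <= bdist B p / (2 * e).
  by rewrite ler_pdivlMr// mulrA mulVf ?mul1r// pnatr_eq0.
rewrite /cutoff /clamp /sdist; case: asboolP => Dp.
  rewrite min_l; first by rewrite max_r.
  move: h; lra.
rewrite mulNr max_l// ge_min; apply/orP; right; move: h; lra.
Qed.

(** The two points lie on the same side of [B]: otherwise their signed distances would differ by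
    more than [enorm (p - q)]. *)
Lemma cutoff_near p q : e + enorm (p - q) <= bdist B p -> cutoff p = cutoff q.
Proof.
move=> h; have pq0 := enorm_ge0 (p - q).
have l2 := bdist_lip B0 p q.
have ep : e <= bdist B p by lra.
have eq : e <= bdist B q by lra.
have := sdist_lip p q.
rewrite !cutoff_far// /sdist; case: asboolP => Dp; case: asboolP => Dq //;
  rewrite ler_norml; move: e0 => ?; lra.
Qed.

Lemma cutoff_bound p : `|cutoff p| <= 1.
Proof.
rewrite ger0_norm /cutoff /clamp; first by rewrite ge_max ler01/= ge_min lexx.
by rewrite le_max lexx.
Qed.

Lemma lip_cont (g : R * R -> R) (k : R) : (forall p q, `|g p - g q| <= k * enorm (p - q)) -> continuous g.
Proof.
move=> gk p; apply/cvgrPdist_lt => d d0.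
have k0 : 0 < `|k| + 1 by rewrite ltr_wpDl.
have dk : 0 < d / (`|k| + 1) / 2 by rewrite !divr_gt0.
near=> q.
have /ball2P[q1 q2] : ball (p : R * R) (d / (`|k| + 1) / 2) q.
  by near: q; exact: (@nbhsx_ballx _ (R * R)%type).
apply: le_lt_trans (gk p q) _.
have n := enorm_sum (p - q).
have n0 := enorm_ge0 (p - q).
apply: (@le_lt_trans _ _ ((`|k| + 1) * enorm (p - q))).
  by rewrite ler_wpM2r// (le_trans (ler_norm k))// lerDl.
rewrite mulrC -ltr_pdivlMr//; apply: le_lt_trans n _.
by rewrite (splitr (d / _)) ltrD.
Unshelve. all: by end_near. Qed.

Lemma cutoff_cont : continuous cutoff.
Proof. exact: lip_cont cutoff_lip. Qed.

Variables (m : R) (m0 : 0 < m).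

Lemma mollify_grad_norm (g : R * R -> R) (p : R * R) (k r : R) : continuous g -> 0 <= k -> m < r ->
  (forall q q', ball p r q -> ball p r q' -> `|g q' - g q| <= k * enorm (q' - q)) ->
  enorm (mollify_x m g p, mollify_y m g p) <= k.
Proof.
move=> cg k0 mr gk; apply: enorm_grad_le => // v.
have := @mollify_grad R m m0 g p (0, 0) k r cg k0 mr _ v; rewrite /= !mul0r addr0 subr0; apply.
by move=> q q' pq pq'; rewrite !mul0r addr0 subr0; exact: gk.
Qed.

Lemma enorm_zero (v : R * R) : enorm v <= 0 -> v.1 = 0 /\ v.2 = 0.
Proof.
move=> v0; have := le_trans (enorm1 v) v0; have := le_trans (enorm2 v) v0.
by rewrite !normr_le0 => /eqP-> /eqP->.
Qed.

Lemma avgx_const (g : R * R -> R) (p : R * R) (c : R) :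
  (forall s, 0 <= s <= m -> g (p.1 + s, p.2) = c) -> avgx m g p = c.
Proof.
move=> gc; rewrite /avgx (@eq_Rintegral _ _ _ _ _ (cst c)).
  by rewrite Rintegral_cst// itv_length ?(ltW m0)// subr0 mulrCA mulVf ?mulr1// gt_eqF.
by move=> s; rewrite inE/= in_itv/= => /gc.
Qed.

Lemma avgy_const (g : R * R -> R) (p : R * R) (c : R) :
  (forall s, 0 <= s <= m -> g (p.1, p.2 + s) = c) -> avgy m g p = c.
Proof.
move=> gc; rewrite /avgy (@eq_Rintegral _ _ _ _ _ (cst c)).
  by rewrite Rintegral_cst// itv_length ?(ltW m0)// subr0 mulrCA mulVf ?mulr1// gt_eqF.
by move=> s; rewrite inE/= in_itv/= => /gc.
Qed.

Lemma cutoff_grad p : enorm (mollify_x m cutoff p, mollify_y m cutoff p) <= (2 * e)^-1.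
Proof.
apply: (@mollify_grad_norm _ _ _ (m + 1)); first exact: cutoff_cont.
- by rewrite invr_ge0 mulr_ge0// ltW.
- by rewrite ltrDl.
- by move=> q q' _ _; exact: cutoff_lip.
Qed.

Lemma ball_enorm (p q : R * R) (r : R) : ball p r q -> enorm (p - q) <= 2 * r.
Proof.
move=> /ball2P[h1 h2]; apply: le_trans (enorm_sum _) _.
by rewrite mulr_natl mulr2n lerD// ltW.
Qed.

(** Origin of the 12: a sup-norm ball of radius 2 m has Euclidean radius at most 4 m, so moving from
    [p] to [q] costs 4 m and from [q] to [q'] another 8 m. *)
Lemma cutoff_grad_far p : e + 12 * m <= bdist B p ->
  mollify_x m cutoff p = 0 /\ mollify_y m cutoff p = 0.
Proof.
move=> far; apply: (@enorm_zero (_, _)).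
apply: (@mollify_grad_norm _ _ _ (2 * m)) => //; first exact: cutoff_cont.
  by move: m0 => ?; lra.
move=> q q' /ball_enorm pq /ball_enorm pq'.
rewrite mul0r normr_le0 subr_eq0; apply/eqP/esym/cutoff_near.
have := bdist_lip B0 p q.
have : enorm (q - q') <= enorm (q - p) + enorm (p - q').
  by rewrite -(subrKA p q); exact: enormD.
rewrite (enormB q p); lra.
Qed.

Lemma cutoff_mollify_far p : e + 12 * m <= bdist B p ->
  mollify m cutoff p = if `[< D p >] then 1 else 0.
Proof.
move=> far; have m0' := m0; rewrite -cutoff_far; last lra.
apply: avgx_const => s s0; apply: avgy_const => t t0; apply/esym/cutoff_near.
have : enorm (p - (p.1 + s, p.2 + t)) <= 2 * m.
  apply: le_trans (enorm_sum _) _; rewrite /= !opprD !addrA !subrr !add0r !normrN.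
  rewrite !ger0_norm; lra.
move: far; rewrite /=; lra.
Qed.

Lemma cutoff_mollify_bound p : `|mollify m cutoff p| <= 1.
Proof.
apply: avgx_bound => //; first by apply: avgy_cont => //; exact: cutoff_cont.
move=> s _; apply: avgy_bound => //; first exact: cutoff_cont.
by move=> t _; exact: cutoff_bound.
Qed.

End Cutoff.

(** * Area of a tube around a curve *)

Section Strips.
Context {R : realType}.
Local Notation mu := (@lebesgue_measure R).
Local Notation mu2 := (mu \x mu)%E.

(* Strips around the line through (x0, y0) with direction (a, b), cut off in the
   coordinate in which the line is a graph. *)
Definition stripx (lo hi x0 y0 a b e : R) : set (R * R) :=
  [set p | lo <= p.1 <= hi /\ `|(p.1 - x0) * b - (p.2 - y0) * a| <= e].

Definition stripy (lo hi x0 y0 a b e : R) : set (R * R) :=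
  [set p | lo <= p.2 <= hi /\ `|(p.1 - x0) * b - (p.2 - y0) * a| <= e].

Lemma cross_cont (x0 y0 a b : R) : continuous (fun p : R * R => (p.1 - x0) * b - (p.2 - y0) * a).
Proof.
move=> p; apply: cvgB; (apply: cvgM; last exact: cvg_cst); (apply: cvgB; last exact: cvg_cst).
- exact: cont_fst.
- exact: cont_snd.
Qed.

Lemma preimage_measurable (g : R * R -> R) (lo hi : R) : continuous g ->
  measurable [set p | lo <= g p <= hi].
Proof.
move=> cg; have := cont_measurable2 measurableT cg => mg.
have := mg measurableT _ (measurable_itv `[lo, hi]); rewrite setTI.
by congr measurable; apply/seteqP; split => p; rewrite /= in_itv.
Qed.

Lemma stripx_measurable lo hi x0 y0 a b e : measurable (stripx lo hi x0 y0 a b e).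
Proof.
apply: measurableI; first exact: preimage_measurable (@cont_fst R).
have := @preimage_measurable _ (- e) e (@cross_cont x0 y0 a b).
by congr measurable; apply/seteqP; split => p; rewrite /= ler_norml.
Qed.

Lemma stripy_measurable lo hi x0 y0 a b e : measurable (stripy lo hi x0 y0 a b e).
Proof.
apply: measurableI; first exact: preimage_measurable (@cont_snd R).
have := @preimage_measurable _ (- e) e (@cross_cont x0 y0 a b).
by congr measurable; apply/seteqP; split => p; rewrite /= ler_norml.
Qed.

Lemma slice_length (c d a e : R) : a != 0 -> 0 <= e ->
  (mu [set y | (`|c - (y - d) * a| <= e)%R] <= (2 * e / `|a|)%:E)%E.
Proof.
move=> a0 e0; have na : 0 < `|a| by rewrite normr_gt0.
set m := d + c / a.
have -> : [set y | `|c - (y - d) * a| <= e] = `[m - e / `|a|, m + e / `|a|]%classic.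
  have E y : `|c - (y - d) * a| = `|y - m| * `|a|.
    by rewrite [`|y - m|]distrC -normrM; congr (`|_|); rewrite /m; field.
  by apply/seteqP; split => y /=; rewrite in_itv/= -ler_distl ler_pdivlMr// E.
rewrite lebesgue_measure_itv/= lte_fin; case: ifP => _.
  rewrite -EFinD lee_fin (_ : 2 * e / `|a| = e / `|a| + e / `|a|); last ring.
  by move: (e / `|a|) => w; lra.
by rewrite lee_fin divr_ge0// ?mulr_ge0// ltW.
Qed.

(** Here [phi] stands for the length of the sections of a strip, whose integral is the area. *)
Lemma slab_bound (phi : R -> \bar R) (lo hi k : R) : lo <= hi -> 0 <= k ->
  measurable_fun setT phi -> (forall x, 0 <= phi x)%E ->
  (forall x : R, lo <= x <= hi -> (phi x <= k%:E)%E) -> (forall x : R, ~~ (lo <= x <= hi) -> phi x = 0%E) ->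
  (\int[mu]_x phi x <= ((hi - lo) * k)%:E)%E.
Proof.
move=> lh k0 mphi phi0 phik phiz.
rewrite (_ : (\int[mu]_x phi x)%E = (\int[mu]_(x in `[lo, hi]) phi x)%E); last first.
  rewrite [RHS]integral_mkcond; apply: eq_integral => x _; rewrite patchE.
  case: ifPn => //; rewrite notin_setE/= in_itv/= => /negP xn; exact: phiz.
apply: (@le_trans _ _ (\int[mu]_(x in `[lo, hi]) k%:E)%E).
  apply: ge0_le_integral => //; exact: measurable_funTS.
rewrite integral_cst//= lebesgue_measure_itv/= lte_fin; case: ifP => _.
  by rewrite -EFinD -EFinM lee_fin mulrC.
by rewrite mule0 lee_fin mulr_ge0// subr_ge0.
Qed.

Lemma stripx_area lo hi x0 y0 a b e : lo <= hi -> a != 0 -> 0 <= e ->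
  (mu2 (stripx lo hi x0 y0 a b e) <= ((hi - lo) * (2 * e / `|a|))%:E)%E.
Proof.
move=> lh a0 e0; apply: slab_bound => //.
- by rewrite divr_ge0// mulr_ge0.
- by apply: measurable_fun_xsection; exact: stripx_measurable.
- move=> x xx; apply: le_trans (@slice_length ((x - x0) * b) y0 a e a0 e0).
  rewrite /= (_ : xsection _ _ = [set y | `|(x - x0) * b - (y - y0) * a| <= e])//.
  by apply/seteqP; split => y; rewrite /xsection/= inE /stripx/=; [case|].
- move=> x xx; rewrite /= (_ : xsection _ _ = set0) ?measure0//.
  by apply/seteqP; split => y //; rewrite /xsection/= inE /stripx/= => -[h]; rewrite h in xx.
Qed.

Lemma stripy_area lo hi x0 y0 a b e : lo <= hi -> b != 0 -> 0 <= e ->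
  (mu2 (stripy lo hi x0 y0 a b e) <= ((hi - lo) * (2 * e / `|b|))%:E)%E.
Proof.
move=> lh b0 e0.
(* [mu2] integrates vertical sections; uniqueness of the product measure allows horizontal ones. *)
have -> : mu2 (stripy lo hi x0 y0 a b e) = (mu \x^ mu)%E (stripy lo hi x0 y0 a b e).
  apply: product_measure_unique; last exact: stripy_measurable.
  by move=> X Y mX mY; exact: product_measure2E.
apply: slab_bound => //.
- by rewrite divr_ge0// mulr_ge0.
- by apply: measurable_fun_ysection; exact: stripy_measurable.
- move=> y yy; apply: le_trans (@slice_length ((y - y0) * a) x0 b e b0 e0).
  rewrite /= (_ : ysection _ _ = [set x | `|(y - y0) * a - (x - x0) * b| <= e])//.
  by apply/seteqP; split => x; rewrite /ysection/= inE /stripy/= distrC; [case|].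
- move=> y yy; rewrite /= (_ : ysection _ _ = set0) ?measure0//.
  by apply/seteqP; split => x //; rewrite /ysection/= inE /stripy/= => -[h]; rewrite h in yy.
Qed.

(** By the mean value theorem the arc stays within [kap * h] of its tangent segment in each
    coordinate, hence the half-width e + 2 kap h. The term in [T * h] is the area along the segment,
    and 8 e'^2 pays for the two ends. *)
Lemma arc_strip (x y x' y' : R -> R) (t0 h kap e : R) : 0 < h -> 0 <= kap -> 0 < e ->
  (forall t : R, is_derive t 1 x (x' t)) -> (forall t : R, is_derive t 1 y (y' t)) ->
  (x' t0, y' t0) != 0 ->
  (forall t, t0 <= t <= t0 + h -> `|x' t - x' t0| <= kap /\ `|y' t - y' t0| <= kap) ->
  let e' := e + 2 * kap * h in
  exists B : set (R * R), [/\ measurable B,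
    (mu2 B <= (2 * e' * (enorm (x' t0, y' t0) * h) + 8 * e' ^+ 2)%:E)%E &
    forall t p, t0 <= t <= t0 + h -> enorm (p - (x t, y t)) < e -> B p].
Proof.
move=> h0 kap0 e0 dx dy T0 hk e'.
have e'0 : 0 <= e' by rewrite /e' addr_ge0 ?(ltW e0)// !mulr_ge0// ltW.
set a := x' t0; set b := y' t0; set T := enorm (a, b).
have Tp : 0 < T by rewrite enorm_gt0.
have key t p : t0 <= t <= t0 + h -> enorm (p - (x t, y t)) < e ->
    enorm (p - (x t0, y t0) - (t - t0) *: (a, b)) <= e'.
  move=> /andP[t1 t2] pe; set w := _ - _ *: _.
  have tt : `|t - t0| <= h by rewrite ger0_norm ?subr_ge0// lerBlDl.
  have dev (z z' : R -> R) : (forall t : R, is_derive t 1 z (z' t)) ->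
     (forall t, t0 <= t <= t0 + h -> `|z' t - z' t0| <= kap) ->
     `|z t - z t0 - (t - t0) * z' t0| <= kap * h.
    move=> dz zk; have [c /andP[c1 c2] ->] := @mean_value _ z z' t0 t t1.
    rewrite mulrC -mulrBr normrM mulrC ler_pM// ; apply: zk.
    by rewrite c1 (le_trans c2).
  have d1 := dev x x' dx (fun t ht => (hk t ht).1).
  have d2 := dev y y' dy (fun t ht => (hk t ht).2).
  have -> : w = (p - (x t, y t)) + (x t - x t0 - (t - t0) * a, y t - y t0 - (t - t0) * b).
    by rewrite /w; case: (p) => p1 p2; congr pair; rewrite /= /GRing.scale/=; ring.
  apply: le_trans (enormD _ _) _; rewrite /e' lerD ?(ltW pe)//.
  by apply: le_trans (enorm_sum _) _ => /=; lra.
have cross p t : (p.1 - x t0) * b - (p.2 - y t0) * a =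
    (p - (x t0, y t0) - (t - t0) *: (a, b)).1 * b - (p - (x t0, y t0) - (t - t0) *: (a, b)).2 * a.
  by rewrite /= /GRing.scale/=; ring.
(* The tangent is not normalised, so a distance e' from its line reads as e' T in the cross
   product. *)
have crossb t p : t0 <= t <= t0 + h -> enorm (p - (x t, y t)) < e ->
    `|(p.1 - x t0) * b - (p.2 - y t0) * a| <= e' * T.
  move=> ht pe; rewrite (cross p t).
  apply: le_trans (enorm_cross _ (a, b)) _.
  by rewrite ler_wpM2r// ?(ltW Tp)//; exact: key.
have Tab : T <= `|a| + `|b| by exact: enorm_sum.
(* Extent of the strip in one coordinate: the tangent segment runs over [min 0 (h c), max 0 (h c)],
   and e' is added at each end. *)
have rng (t c s : R) : t0 <= t <= t0 + h -> `|s - (t - t0) * c| <= e' ->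
    Num.min 0 (h * c) - e' <= s <= Num.max 0 (h * c) + e'.
  move=> /andP[t1 t2]; rewrite ler_norml => /andP[s1 s2].
  have [c0|c0] := leP 0 c.
    rewrite min_l ?max_r ?mulr_ge0 ?(ltW h0)//; apply/andP; split; nra.
  rewrite min_r ?max_l; last 2 first.
  - by rewrite mulr_ge0_le0// ltW.
  - by rewrite mulr_ge0_le0// ltW.
  apply/andP; split; nra.
have wid (c : R) : Num.max 0 (h * c) + e' - (Num.min 0 (h * c) - e') = h * `|c| + 2 * e'.
  have [c0|c0] := leP 0 c.
    rewrite min_l ?max_r ?mulr_ge0 ?(ltW h0)// ger0_norm//; ring.
  rewrite min_r ?max_l ?ltr0_norm//; last 2 first.
  - by rewrite mulr_ge0_le0// ltW.
  - by rewrite mulr_ge0_le0// ltW.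
  ring.
have widp (c : R) : 0 <= h * `|c| + 2 * e' by rewrite addr_ge0// mulr_ge0// ltW.
have arith (c : R) : c != 0 -> T <= 2 * `|c| ->
    (h * `|c| + 2 * e') * (2 * (e' * T) / `|c|) <= 2 * e' * (T * h) + 8 * e' ^+ 2.
  move=> c0 Tc; have nc : 0 < `|c| by rewrite normr_gt0.
  have -> : (h * `|c| + 2 * e') * (2 * (e' * T) / `|c|) = 2 * e' * (T * h) + 4 * e' ^+ 2 * (T / `|c|).
    field; exact: lt0r_neq0.
  rewrite lerD2l; have -> : 8 * e' ^+ 2 = 4 * e' ^+ 2 * 2 by ring.
  by rewrite ler_wpM2l ?mulr_ge0 ?sqr_ge0// ler_pdivrMr.
have eT : 0 <= e' * T by rewrite mulr_ge0// ltW.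
(* The strip is cut off in the coordinate of the larger tangent component, which is at least half of
   T, so that T / |a| is at most 2. *)
have [ab|ab] := leP `|b| `|a|.
  have T2 : T <= 2 * `|a| by lra.
  have a0 : a != 0 by rewrite -normr_gt0; lra.
  exists (stripx (x t0 + (Num.min 0 (h * a) - e')) (x t0 + (Num.max 0 (h * a) +
    e')) (x t0) (y t0) a b (e' * T)); split.
  - exact: stripx_measurable.
  - apply: le_trans (stripx_area _ _ _ _ _ _) _ => //.
      by rewrite lerD2l -subr_ge0 wid.
    by rewrite lee_fin opprD addrACA subrr add0r wid; exact: arith.
  - move=> t p ht pe; split; last exact: crossb ht pe.
    rewrite -lerBrDl -[X in _ && X]lerBlDl; apply: (rng t) => //.
    have := le_trans (enorm1 _) (key t p ht pe); rewrite /=.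
    by [].
have T2 : T <= 2 * `|b| by lra.
have b0 : b != 0 by rewrite -normr_gt0; lra.
exists (stripy (y t0 + (Num.min 0 (h * b) - e')) (y t0 + (Num.max 0 (h * b) +
  e')) (x t0) (y t0) a b (e' * T)); split.
- exact: stripy_measurable.
- apply: le_trans (stripy_area _ _ _ _ _ _) _ => //.
    by rewrite lerD2l -subr_ge0 wid.
  by rewrite lee_fin opprD addrACA subrr add0r wid; exact: arith.
- move=> t p ht pe; split; last exact: crossb ht pe.
  rewrite -lerBrDl -[X in _ && X]lerBlDl; apply: (rng t) => //.
  have := le_trans (enorm2 _) (key t p ht pe); rewrite /=.
  by [].
Qed.

(** Through a primitive, the integral over a cell is 1 / N times a value of [g] in that cell; the
    oscillation bound [e] does the rest after telescoping. *)
Lemma riemann_le (g : R -> R) (N : nat) (e : R) : (0 < N)%N -> continuous g ->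
  (forall s t, 0 <= s <= 1 -> 0 <= t <= 1 -> `|s - t| <= N%:R^-1 -> `|g s - g t| <= e) ->
  \sum_(k < N) g (k%:R / N%:R) * N%:R^-1 <= \int[mu]_(t in `[0, 1]) g t + e.
Proof.
move=> N0 cg ge; have [H dH] := exists_primitive (- 1) cg.
have n0 : 0 < N%:R :> R by rewrite ltr0n.
have -> : \int[mu]_(t in `[0, 1]) g t = H 1 - H 0.
  apply: Rintegral_derive; [exact: ler01|exact: continuous_subspaceT|].
  by move=> t /andP[t0 _]; apply: dH; apply: lt_le_trans t0; rewrite oppr_lt0.
have step k : (k < N)%N -> g (k%:R / N%:R) * N%:R^-1 <= H (k.+1%:R / N%:R) - H (k%:R / N%:R) + e / N%:R.
  move=> kN.
  have k1 : k%:R / N%:R <= k.+1%:R / N%:R :> R by rewrite ler_pM2r ?invr_gt0// ler_nat.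
  have k0 : 0 <= k%:R / N%:R :> R by rewrite divr_ge0.
  have kk : k.+1%:R / N%:R <= 1 :> R by rewrite ler_pdivrMr// mul1r ler_nat.
  have dk : k.+1%:R / N%:R - k%:R / N%:R = N%:R^-1 :> R.
    by rewrite -mulrBl -natrB// subSnn mul1r.
  have [c /andP[c1 c2] E] : exists2 c, k%:R / N%:R <= c <= k.+1%:R / N%:R &
      H (k.+1%:R / N%:R) - H (k%:R / N%:R) = g c * (k.+1%:R / N%:R - k%:R / N%:R).
    apply: mean_value => // t /andP[t1 _]; apply: dH.
    by rewrite (lt_le_trans _ (le_trans k0 t1))// oppr_lt0.
  rewrite E dk -mulrDl ler_pM2r ?invr_gt0//.
  have : `|g (k%:R / N%:R) - g c| <= e.
    apply: ge.
    - by rewrite k0 (le_trans k1).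
    - by rewrite (le_trans k0)// (le_trans c2).
    - by rewrite distrC ger0_norm ?subr_ge0// -[leRHS]dk lerD2r.
  by move=> /(le_trans (ler_norm _)); rewrite lerBlDl.
apply: (@le_trans _ _ (\sum_(k < N) (H (k.+1%:R / N%:R) - H (k%:R / N%:R) + e / N%:R))).
  by apply: ler_sum => k _; apply: step.
rewrite big_split/= sumr_const card_ord.
have -> : e / N%:R *+ N = e by rewrite -mulr_natr divfK ?gt_eqF.
rewrite lerD2r -(big_mkord xpredT (fun k => H (k.+1%:R / N%:R) - H (k%:R / N%:R))).
by rewrite telescope_sumr// divff ?gt_eqF// mul0r.
Qed.

End Strips.

(** * Disks are regular domains *)

Section Circle.
Context {R : realType}.

Lemma pair_derive (f g : R^o -> R) (t v : R^o) (a b : R) :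
  is_derive t v (f : R^o -> R^o) a -> is_derive t v (g : R^o -> R^o) b ->
  is_derive t v (fun t => (f t, g t) : (R * R)%type) (a, b).
Proof.
move=> [df <-] [dg <-].
have C : h^-1 *: ((fun t => (f t, g t) : (R * R)%type) (h *: v + t) - (f t, g t)) @[h --> 0^']
    --> (('D_v (f : R^o -> R^o) t : R), ('D_v (g : R^o -> R^o) t : R)).
  exact: (cvg_pair df dg).
by split; [apply/cvg_ex; exists ('D_v (f : R^o -> R^o) t, 'D_v (g : R^o -> R^o) t)|exact: cvg_lim].
Qed.

(** With arbitrary coefficients the family is stable under differentiation in any direction, so
    smoothness follows by induction. *)
Definition ellipse (w A B A' B' : R) (t : R^o) : R * R :=
  (A * cos (w * t) + B * sin (w * t), A' * cos (w * t) + B' * sin (w * t)).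

Lemma is_derive_dir (f : R -> R) (t v d : R) :
  is_derive t 1 f d -> is_derive (t : R^o) (v : R^o) (f : R^o -> R^o) (v * d).
Proof.
move=> [df dE]; have Df : differentiable f t by exact/derivable1_diffP.
split; first exact: (@diff_derivable _ R^o R^o f t v).
rewrite (@deriveE _ R^o R^o f t v Df).
have lin : 'd (f : R^o -> R^o) t (v *: (1 : R^o)) = v *: 'd (f : R^o -> R^o) t 1 by rewrite linearZ.
have e1 : 'd (f : R^o -> R^o) t 1 = d by rewrite -dE -(@deriveE _ R^o R^o f t 1 Df).
move: lin; rewrite e1 /GRing.scale/= mulr1; exact.
Qed.

Lemma trig_derive (w A B t v : R) :
  is_derive (t : R^o) (v : R^o) (fun t : R^o => A * cos (w * t) + B * sin (w * t) : R^o)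
    (v * w * B * cos (w * t) + - (v * w * A) * sin (w * t)).
Proof.
have -> : v * w * B * cos (w * t) + - (v * w * A) * sin (w * t) =
    v * (A * (w * - sin (w * t)) + B * (w * cos (w * t))) by ring.
apply: is_derive_dir.
have dc := is_derive_mull A (is_derive_scale (is_derive_cos (w * t))).
have ds := is_derive_mull B (is_derive_scale (is_derive_sin (w * t))).
exact: (is_deriveD dc ds).
Qed.

Lemma ellipse_derive (w A B A' B' t v : R) :
  is_derive (t : R^o) (v : R^o) (ellipse w A B A' B')
    (ellipse w (v * w * B) (- (v * w * A)) (v * w * B') (- (v * w * A')) t).
Proof. by apply: pair_derive; exact: trig_derive. Qed.

Lemma ellipse_smooth (w A B A' B' : R) : smooth [set: R^o] (ellipse w A B A' B').
Proof.
move=> n; elim: n A B A' B' => [|n IH] A B A' B'.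
  split=> // x _; have [d _] := ellipse_derive w A B A' B' x 1.
  exact/differentiable_continuous/derivable1_diffP.
split=> [x _|v].
  have [d _] := ellipse_derive w A B A' B' x 1.
  exact/differentiable_continuous/derivable1_diffP.
split=> [t _|]; first by have [] := ellipse_derive w A B A' B' t v.
rewrite (_ : 'D_v _ = ellipse w (v * w * B) (- (v * w * A)) (v * w * B') (- (v * w * A'))); first exact: IH.
by apply/funext => t; have [_ ->] := ellipse_derive w A B A' B' t v.
Qed.

Definition circle (r : R) : R -> R * R := ellipse (2 * pi) r 0 0 r.

Lemma circleE (r t : R) : circle r t = (r * cos (2 * pi * t), r * sin (2 * pi * t)).
Proof. by rewrite /circle /ellipse !mul0r addr0 add0r. Qed.

Lemma enorm_circle (r t : R) : 0 <= r -> enorm (circle r t) = r.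
Proof.
move=> r0; rewrite circleE /enorm/= !exprMn -mulrDr cos2Dsin2 mulr1 sqrtr_sqr.
by rewrite ger0_norm.
Qed.

Lemma cos_eq1 (x : R) : `|x| < 2 * pi -> cos x = 1 -> x = 0.
Proof.
move=> xp cx; have : sin (x / 2) ^+ 2 = 0.
  have := cos2Dsin2 (x / 2); have : cos (x / 2 + x / 2) = 1 by rewrite -splitr.
  rewrite cosD -!expr2; lra.
move=> /eqP; rewrite sqrf_eq0 => /eqP s0.
have [x0|x0|//] := ltgtP x 0.
  have : 0 < sin (- (x / 2)).
    by apply: sin_gt0_pi; move: xp; rewrite ltr0_norm//; lra.
  by rewrite sinN s0 oppr0 ltxx.
have : 0 < sin (x / 2).
  by apply: sin_gt0_pi; move: xp; rewrite gtr0_norm//; lra.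
by rewrite s0 ltxx.
Qed.

Lemma circle_closed_curve (r : R) : 0 < r -> smooth_closed_curve (circle r).
Proof.
move=> r0; split.
- exact: ellipse_smooth.
- move=> t; rewrite !circleE mulrDr mulr1 [2 * pi in X in _ + X](_ : _ = pi + pi); last ring.
  by rewrite addrA !cosDpi !sinDpi !opprK.
- move=> t; rewrite derive1E; have [_ ->] := ellipse_derive (2 * pi) r 0 0 r t 1.
  rewrite /ellipse !mulr0 !mul0r add0r oppr0 mul0r addr0 mul1r; apply/eqP => -[].
  set w := 2 * pi * r; have w0 : w != 0 by rewrite /w !mulf_neq0 ?gt_eqF ?pi_gt0.
  move: w w0 (sin _) (cos _) (cos2Dsin2 (2 * pi * t)) => w w0 sn cs cs1.
  move=> /eqP; rewrite mulf_eq0 oppr_eq0 (negbTE w0)/= => /eqP s0.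
  move=> /eqP; rewrite mulf_eq0 (negbTE w0)/= => /eqP c0.
  by move: cs1; rewrite s0 c0 expr0n/= addr0 => /eqP; rewrite eq_sym oner_eq0.
- move=> s t; rewrite !inE/= !in_itv/= => /andP[s0 s1] /andP[t0 t1].
  rewrite !circleE => -[].
  move=> /(mulfI (lt0r_neq0 r0)) cE /(mulfI (lt0r_neq0 r0)) sE.
  apply/eqP; rewrite -subr_eq0; apply/eqP.
  have : 2 * pi * (s - t) = 0.
    apply: cos_eq1.
      have p0 := pi_gt0 R.
      rewrite normrM gtr0_norm ?mulr_gt0// gtr_pMr ?mulr_gt0// ltr_norml; apply/andP; split; lra.
    by rewrite mulrBr cosB cE sE -!expr2 cos2Dsin2.
  by move=> /eqP; rewrite !mulf_eq0 pnatr_eq0/= gt_eqF ?pi_gt0//= => /eqP.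
Qed.

Lemma circle_param (r : R) (p : R * R) : 0 < r -> enorm p = r -> exists t, circle r t = p.
Proof.
move=> r0 pr.
have sq : p.1 ^+ 2 + p.2 ^+ 2 = r ^+ 2 by rewrite -enorm_sq pr.
have x1 : -1 <= p.1 / r <= 1.
  by rewrite -ler_norml normrM normfV (gtr0_norm r0) ler_pdivrMr// mul1r -pr enorm1.
have p0 := pi_gt0 R.
have wE (th : R) : 2 * pi * (th / (2 * pi)) = th.
  by rewrite mulrC divfK// mulf_neq0 ?gt_eqF.
have sinE : r * sin (acos (p.1 / r)) = `|p.2|.
  rewrite sin_acos//.
  have -> : 1 - (p.1 / r) ^+ 2 = (p.2 / r) ^+ 2.
    rewrite !expr_div_n -(@divff _ (r ^+ 2)) ?sqrf_eq0 ?gt_eqF//.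
    by rewrite -mulrBl -{1}sq addrAC subrr add0r.
  by rewrite sqrtr_sqr normrM normfV (gtr0_norm r0) mulrC divfK// gt_eqF.
have cE : r * cos (acos (p.1 / r)) = p.1.
  by rewrite acosK// mulrC divfK// gt_eqF.
have [y0|y0] := leP 0 p.2.
  exists (acos (p.1 / r) / (2 * pi)); rewrite circleE wE cE sinE ger0_norm//.
  by case: (p).
exists (- acos (p.1 / r) / (2 * pi)); rewrite circleE wE cosN sinN mulrN cE sinE ltr0_norm// opprK.
by case: (p).
Qed.

Lemma enorm_lt_open (r : R) : open [set p : R * R | enorm p < r].
Proof.
rewrite (_ : mkset _ = enorm @^-1` [set x | x < r]); last by [].
by apply: open_comp; [move=> p _; exact: enorm_cont|exact: open_lt].
Qed.

Lemma enorm_le_closed (r : R) : closed [set p : R * R | enorm p <= r].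
Proof.
rewrite (_ : mkset _ = enorm @^-1` [set x | x <= r]); last by [].
by apply: preimage_closed; [move=> p _; exact: enorm_cont|exact: closed_le].
Qed.

(** The [inf] of an empty set is 0, so some domain must exist before a bound on [cheeger] yields
    one; a small disk about the origin is enough. *)
Lemma disk_regular (Omega : set (R * R)) : open Omega -> Omega 0 ->
  exists (D : set (R * R)) (n : nat) (c : 'I_n -> R -> R * R), regular_domain Omega D c.
Proof.
move=> oO O0; have : nbhs (0 : R * R) Omega by exact: open_nbhs_nbhs.
rewrite -nbhs_ballE => -[e /= e0 eO].
pose r := e / 2; have r0 : 0 < r by rewrite divr_gt0.
have re : r < e by rewrite /r ltr_pdivrMr// ltr_pMr// ltr1n.
pose D := [set p : R * R | enorm p < r].
have clD : closure D `<=` [set p | enorm p <= r].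
  have /closure_id -> := @enorm_le_closed r.
  by apply: closureS => p /ltW.
have DO : closure D `<=` Omega.
  move=> p /clD /= pr; apply: eO; apply/ball2P; rewrite /= !sub0r !normrN.
  by split; apply: le_lt_trans re; apply: le_trans pr; [exact: enorm1|exact: enorm2].
exists D, 1%N, (fun _ => circle r); split.
- exact: enorm_lt_open.
- by exists 0; rewrite /D/= enorm0.
- split => //; apply: (@subclosed_compact _ _ (`[- r, r] `*` `[- r, r])).
  + exact: closed_closure.
  + exact: rect_compact.
  + move=> p /clD /= pr; split; rewrite /= in_itv/= -ler_norml.
      exact: le_trans (enorm1 _) pr.
    exact: le_trans (enorm2 _) pr.
- split=> [_|]; first exact: circle_closed_curve.
  by move=> i j _ _ _; rewrite !ord1.
have Di : D° = D by have := @enorm_lt_open r; rewrite openE => h; apply/seteqP; split;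
  [exact: interior_subset|exact: h].
rewrite Di; apply/seteqP; split => [p [/clD /= pr /negP]|p [i _ [t _ <-]]].
  rewrite -leNgt => rp; have [|t tp] := @circle_param r p r0; first by apply/eqP; rewrite eq_le pr.
  by exists ord0 => //; exists t.
split; last by rewrite /D/= enorm_circle ?ltxx// ltW.
move=> U.
have : {for (1 : R), continuous (fun s : R => s *: circle r t)}.
  have := @affine_cont R (R * R)%type 0 (circle r t) 1.
  by under eq_fun do rewrite add0r.
move=> cs; rewrite -[X in nbhs X](scale1r (circle r t)) => /cs.
rewrite -nbhs_ballE => -[d /= d0 dU].
(* A boundary point is approached along its radius; the minimum with 1 keeps the factor [s]
   positive. *)
pose s := 1 - Num.min 1 d / 2.
have m0 : 0 < Num.min 1 d / 2 by rewrite divr_gt0// lt_min ltr01.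
have m1 : Num.min 1 d / 2 < 1.
  rewrite ltr_pdivrMr// mul1r; apply: (@le_lt_trans _ _ 1); last by rewrite ltr1n.
  by rewrite ge_min lexx.
have md : Num.min 1 d / 2 < d.
  rewrite ltr_pdivrMr//; apply: (@le_lt_trans _ _ d); last by rewrite ltr_pMr// ltr1n.
  by rewrite ge_min lexx orbT.
exists (s *: circle r t); split.
  rewrite /D/= enormZ enorm_circle ?(ltW r0)// gtr_pMl// ger0_norm /s; lra.
apply: dU; suff : `|1 - s| < d by [].
by rewrite /s opprB addrC subrK gtr0_norm.
Qed.

End Circle.

(** * Continuous extension, fine meshes and integral bounds by covers *)

Section Generic.
Context {R : realType}.
Local Notation mu := (@lebesgue_measure R).
Local Notation mu2 := (mu \x mu)%E.

(** The averaging and integration lemmas ask for continuity on the whole plane, whereas the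
    functions of the surface are controlled on [Omega] only. *)
Lemma tietze_compact (K : set (R * R)) (g : R * R -> R) : compact K ->
  (forall p, K p -> {for p, continuous g}) ->
  exists2 G : R * R -> R, continuous G & forall p, K p -> G p = g p.
Proof.
move=> cK cg; have [M M0 gM] := compact_bound cK cg.
have clK : closed K by apply: compact_closed => //; exact: norm_hausdorff.
have wg : {within K, continuous (g : R * R -> R^o)}.
  by apply: continuous_in_subspaceT => p; rewrite inE; exact: cg.
have M1 : 0 < M + 1 by rewrite ltr_wpDl.
have gM1 p : K p -> `|g p| <= M + 1 by move=> /gM /le_trans; apply; rewrite lerDl.
have [G [GE cG _]] := @continuous_bounded_extension (R * R)%type R (@pseudometric_normal R _) K clK g
  (M + 1) M1 wg gM1.
by exists G => // p Kp; rewrite GE// inE.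
Qed.

Lemma near_natSinv_lt (r : R) : 0 < r -> \forall N \near \oo, N.+1%:R^-1 < r.
Proof. by move=> r0; exact: (near_infty_natSinv_lt (PosNum r0)). Qed.

Lemma unif_cont_mesh (g : R -> R) (e : R) : continuous g -> 0 < e ->
  \forall N \near \oo, forall s t : R, 0 <= s <= 1 -> 0 <= t <= 1 ->
    `|s - t| <= N.+1%:R^-1 -> `|g s - g t| <= e.
Proof.
move=> cg e0.
have [r r0 rP] := @unif_cont_compact R R `[0, 1] g (@segment_compact R 0 1) (fun x _ => cg x) e e0.
have := near_natSinv_lt r0; apply: filterS => N Nr s t s01 t01 st.
apply/ltW/rP; first by rewrite /= in_itv.
suff : `|s - t| < r by [].
exact: le_lt_trans Nr.
Qed.

Lemma cover_integral_bound (I : finType) (Q : set (R * R)) (B : I -> set (R * R)) (c b : I ->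
  R) (h : R * R -> R) :
  measurable Q -> mu2.-integrable Q (EFin \o h) -> (forall i, measurable (B i)) ->
  (forall i, 0 <= c i) -> (forall i, (mu2 (B i) <= (b i)%:E)%E) ->
  (forall p, Q p -> `|h p| <= \sum_i c i * \1_(B i) p) ->
  `|\int[mu2]_(p in Q) h p| <= \sum_i c i * b i.
Proof.
move=> mQ Ih mB c0 bB hB; rewrite -lee_fin EFin_normr_Rintegral//.
have mh := measurable_int _ Ih.
have := le_abse_integral mu2 mQ mh => /le_trans; apply.
apply: (@le_trans _ _ (\int[mu2]_(p in Q) (\sum_i (c i * \1_(B i) p)%:E))%E).
  apply: ge0_le_integral => //.
  - exact: measurableT_comp.
  - apply: emeasurable_sum => i; apply/measurable_EFinP; apply: measurable_funM => //.
    by apply: measurable_indic; exact: mB.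
  - by move=> p Qp; rewrite /= sumEFin lee_fin; exact: hB.
rewrite ge0_integral_sum//; last 2 first.
- move=> i; apply/measurable_EFinP; apply: measurable_funM => //.
  by apply: measurable_indic; exact: mB.
- by move=> i p _; rewrite lee_fin mulr_ge0.
rewrite -sumEFin; apply: lee_sum => i _.
under eq_integral do rewrite EFinM.
rewrite ge0_integralZl//; last 2 first.
- apply/measurable_EFinP.
  by apply: measurable_indic; exact: mB.
- by rewrite lee_fin.
rewrite EFinM; apply: lee_wpmul2l; first by rewrite lee_fin.
rewrite integral_indic; [|exact: mQ|exact: mB].
move: (bB i); apply: le_trans.
apply: le_measure; rewrite ?inE.
- by apply: measurableI; [exact: mB|exact: mQ].
- exact: mB.
- exact: subIsetl.
Qed.

End Generic.

(** * Radial derivative of the Calabi potential *)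

Section Calabi.
Context {R : realType}.
Local Notation mu := (@lebesgue_measure R).
Variables (Omega : set (R * R)) (delta tau : R * R -> R).
Hypothesis delta_gt0 : forall p, Omega p -> 0 < delta p.
Hypothesis Omega_open : open Omega.
Hypothesis Omega_star : star_shaped Omega.
Hypothesis delta_cont : forall p, Omega p -> {for p, continuous delta}.
Hypothesis tau_cont : forall p, Omega p -> {for p, continuous tau}.
Local Notation C := (calabi_potential delta tau).

Lemma ray_cont (p : R * R) : continuous (fun s : R => s *: p).
Proof.
have := @affine_cont R (R * R)%type 0 p.
by under eq_fun do rewrite add0r.
Qed.

(** The substitution r = s t turns s^2 C(s p) into the integral of r f(r p) over [0, s], with f = 2
    tau / delta^2, and the fundamental theorem applies. *)
Lemma calabi_radial (p : R * R) (s : R) : 0 < s -> Omega (s *: p) ->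
  is_derive s 1 (fun s => s ^+ 2 * C (s *: p)) (s * (2 * (tau (s *: p) / delta (s *: p) ^+ 2))).
Proof.
move=> s0 Os.
(* A parameter beyond [s] for which the ray is still in [Omega], so that the derivative at [s] is
   two-sided. *)
have [s1 ss1 Os1] : exists2 s1, s < s1 & Omega (s1 *: p).
  have /(@ray_cont p s) : nbhs (s *: p) Omega by exact: open_nbhs_nbhs.
  rewrite -nbhs_ballE => -[d /= d0 dO]; exists (s + d / 2); first by rewrite ltrDl divr_gt0.
  apply: dO; suff : `|s - (s + d / 2)| < d by [].
  by rewrite opprD addrA subrr add0r normrN gtr0_norm ?divr_gt0// ltr_pdivrMr// ltr_pMr// ltr1n.
have s10 : 0 < s1 by exact: lt_trans ss1.
have Or r : 0 <= r <= s1 -> Omega (r *: p).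
  move=> /andP[r0 r1]; have -> : r *: p = (r / s1) *: (s1 *: p).
    by rewrite scalerA divfK// gt_eqF.
  by apply: Omega_star.2 => //; rewrite divr_ge0 ?(ltW s10)//= ler_pdivrMr// mul1r.
pose h (r : R) := r * (2 * (tau (r *: p) / delta (r *: p) ^+ 2)).
(* Clamping to [0, s1] makes the integrand continuous on the whole line, as [exists_primitive]
   requires. *)
pose k (r : R) := Num.max 0 (Num.min s1 r).
have k01 r : 0 <= k r <= s1.
  rewrite /k le_max lexx/= ge_max ge_min lexx/= (ltW s10)//.
have kid r : 0 <= r <= s1 -> k r = r by move=> /andP[r0 r1]; rewrite /k min_r// max_r.
have ck : continuous k.
  by move=> r; apply: continuous_max; [exact: cvg_cst|apply: continuous_min;
    [exact: cvg_cst|exact: cvg_id]].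
have ch r : Omega (r *: p) -> {for r, continuous h}.
  move=> Orp; apply: cvgM; first exact: cvg_id.
  apply: cvgM; first exact: cvg_cst.
  apply: (@continuous_comp _ _ _ (fun s : R => s *: p) (fun p => tau p / delta p ^+ 2));
    first exact: ray_cont.
  exact: (density_cont delta_gt0 delta_cont tau_cont).
have chk : continuous (h \o k).
  by move=> r; apply: continuous_comp; [exact: ck|apply: ch; exact: Or].
have [H dH] := exists_primitive (- 1) chk.
have n1 z : 0 <= z -> -1 < z by apply: lt_le_trans; rewrite oppr_lt0.
have E : \forall x \near s, H x - H 0 = x ^+ 2 * C (x *: p).
  near=> x; have x0 : 0 < x by near: x; exact: lt_nbhsr.
  have xs1 : x < s1 by near: x; exact: lt_nbhsl.
  have <- : \int[mu]_(t in `[0, 1]) (x * (h \o k) (x * t)) = H x - H 0.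
    rewrite -[in X in _ = X - _](mulr1 x) -[in X in _ = _ - X](mulr0 x).
    apply: (@Rintegral_derive _ (fun t => H (x * t))) => //.
      apply: continuous_subspaceT => t; apply: cvgM; first exact: cvg_cst.
      by apply: (@continuous_comp _ _ _ (fun t => x * t) (h \o k)); [exact: mulrl_continuous|exact: chk].
    move=> t /andP[t0 _]; apply: is_derive_scale; apply/dH/n1.
    by rewrite mulr_ge0// ltW.
  rewrite /calabi_potential mulrA -RintegralZl//.
    apply: eq_Rintegral => t; rewrite inE/= in_itv/= => /andP[t0 t1].
    rewrite kid; last by rewrite mulr_ge0 ?(ltW x0)//= (le_trans _ (ltW xs1))// ler_piMr// ltW.
    by rewrite /h scalerA [t * x]mulrC; ring.
  apply: within_continuous_integrable; apply: continuous_in_subspaceT => t;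
    rewrite inE/= in_itv/= => /andP[t0 t1].
  apply: cvgM; first exact: cvg_id.
  apply: (@continuous_comp _ _ _ (fun t : R => t *: (x *: p)) (fun p => tau p / delta p ^+ 2));
    first exact: ray_cont.
  apply: (density_cont delta_gt0 delta_cont tau_cont).
  by apply: Omega_star.2; [apply: Or; rewrite !ltW|rewrite t0].
apply: near_eq_is_derive E _.
have -> : s * (2 * (tau (s *: p) / delta (s *: p) ^+ 2)) = (h \o k) s - 0.
  by rewrite /= kid ?(ltW s0) ?(ltW ss1)// subr0.
have d1 : is_derive s 1 H ((h \o k) s) by apply/dH/n1/ltW.
exact: (is_deriveB d1 (is_derive_cst _ _ _)).
Unshelve. all: by end_near. Qed.

End Calabi.

(** * Strips covering the tube around a closed curve *)

Section Curve.
Context {R : realType}.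
Local Notation mu := (@lebesgue_measure R).
Local Notation mu2 := (mu \x mu)%E.

Lemma curve_coords (c : R -> R * R) : smooth [set: R^o] (c : R^o -> R * R) ->
  [/\ continuous c, continuous (derive1 c),
     (forall t : R, is_derive t 1 (fun t => (c t).1) (derive1 c t).1) &
     (forall t : R, is_derive t 1 (fun t => (c t).2) (derive1 c t).2)].
Proof.
move=> /(_ 1%N) [cc /(_ 1) [dc [cd _]]].
have D (t : R) : h^-1 *: (c (h *: 1 + t) - c t) @[h --> 0^'] --> derive1 c t.
  by rewrite derive1E; exact: (dc t I).
split.
- by move=> t; apply: cc; rewrite inE.
- move=> t; rewrite (_ : derive1 c = 'D_1 (c : R^o -> R * R)); last by apply/funext => s; rewrite derive1E.
  by apply: cd; rewrite inE.
- move=> t; have C := cvg_comp _ _ (D t) (@cont_fst R (derive1 c t)).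
  by split; [apply/cvg_ex; exists (derive1 c t).1|exact: cvg_lim].
- move=> t; have C := cvg_comp _ _ (D t) (@cont_snd R (derive1 c t)).
  by split; [apply/cvg_ex; exists (derive1 c t).2|exact: cvg_lim].
Qed.

Lemma mesh_cell (N : nat) (t : R) : 0 <= t < 1 ->
  exists k : 'I_N.+1, k%:R / N.+1%:R <= t <= k%:R / N.+1%:R + N.+1%:R^-1.
Proof.
move=> /andP[t0 t1]; have n0 : 0 < N.+1%:R :> R by rewrite ltr0n.
have tN : 0 <= t * N.+1%:R by rewrite mulr_ge0.
have /andP[k1 k2] := Num.Theory.truncn_itv tN.
have kN : (Num.truncn (t * N.+1%:R) < N.+1)%N.
  by rewrite -(ltr_nat R) (le_lt_trans k1)// gtr_pMl.
exists (Ordinal kN) => /=; rewrite ler_pdivrMr// k1/=.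
by rewrite -[X in _ + X]mul1r -mulrDl ler_pdivlMr// natr1 ltW.
Qed.

(* The tube has radius eps = lam / N, up to the room lam^2 / N for the
   mollification.  On each of N cells the curve stays within O(lam^2 / N) of its
   tangent segment, so that a strip around the segment covers the tube.  The
   factor N / (2 lam) = 1 / (2 eps) is the slope of the cutoff. *)
Lemma curve_tube (c : R -> R * R) (w : R * R -> R) : smooth [set: R^o] (c : R^o -> R * R) ->
  (forall t, derive1 c t != 0) -> continuous w -> (forall t, 0 <= w (c t)) ->
  exists2 K : R, 0 <= K & forall lam : R, 0 < lam <= 1 -> \forall N \near \oo,
    exists (B : 'I_N.+1 -> set (R * R)) (b a : 'I_N.+1 -> R),
    [/\ forall k, measurable (B k) /\ (mu2 (B k) <= (b k)%:E)%E, forall k, 0 <= a k,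
      forall p t, 0 <= t < 1 -> enorm (p - c t) < (lam + lam ^+ 2) / N.+1%:R ->
        exists2 k, B k p & w p + lam <= a k,
      \sum_k (N.+1%:R / (2 * lam) * a k) * b k <=
        \int[mu]_(t in `[0, 1]) (w (c t) * enorm (derive1 c t)) + lam * K &
      \sum_k b k <= lam * K].
Proof.
move=> sc c'0 cw w0; have [cc cd dx dy] := curve_coords sc.
have cwc : continuous (fun t => w (c t)).
  by move=> t; apply: continuous_comp; [exact: cc|exact: cw].
have cT : continuous (fun t => enorm (derive1 c t)).
  by move=> t; apply: continuous_comp; [exact: cd|exact: enorm_cont].
have c1 : continuous (fun t => (derive1 c t).1).
  by move=> t; apply: continuous_comp; [exact: cd|exact: cont_fst].
have c2 : continuous (fun t => (derive1 c t).2).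
  by move=> t; apply: continuous_comp; [exact: cd|exact: cont_snd].
have cwT : continuous (fun t => w (c t) * enorm (derive1 c t)).
  by move=> t; apply: cvgM; [exact: cwc|exact: cT].
have [W W0 WP] := compact_bound (@segment_compact R 0 1) (fun t _ => cwc t).
have [S S0 SP] := compact_bound (@segment_compact R 0 1) (fun t _ => cT t).
(* The constant adds up the errors below: 1 from the Riemann sum, 3 W S + 8 S + 64 (W + 2) from the
   weighted areas, while 8 S + 128 bounds the total area. *)
exists (1 + 3 * W * S + 8 * S + 64 * (W + 2) + 128).
  by rewrite !addr_ge0// !mulr_ge0// addr_ge0.
move=> lam /andP[lam0 lam1].
have lam20 : 0 < lam / 2 by rewrite divr_gt0.
have kap0 : 0 < lam ^+ 2 by rewrite exprn_gt0.
have cK : compact (c @` `[0, 1]).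
  apply: continuous_compact; last exact: segment_compact.
  exact: continuous_subspaceT.
have [r r0 rP] := unif_cont_compact cK (fun p _ => cw p) lam20.
have r20 : 0 < r / 2 by rewrite divr_gt0.
near=> N.
have nr : N.+1%:R^-1 < r / 2 by near: N; exact: near_natSinv_lt.
have u1 : forall s t : R, 0 <= s <= 1 -> 0 <= t <= 1 -> `|s - t| <= N.+1%:R^-1 ->
  `|(derive1 c s).1 - (derive1 c t).1| <= lam ^+ 2 by near: N; exact: unif_cont_mesh c1 _.
have u2 : forall s t : R, 0 <= s <= 1 -> 0 <= t <= 1 -> `|s - t| <= N.+1%:R^-1 ->
  `|(derive1 c s).2 - (derive1 c t).2| <= lam ^+ 2 by near: N; exact: unif_cont_mesh c2 _.
have u3 : forall s t : R, 0 <= s <= 1 -> 0 <= t <= 1 -> `|s - t| <= N.+1%:R^-1 ->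
  `|w (c s) - w (c t)| <= lam / 2 by near: N; exact: unif_cont_mesh cwc _.
have u4 : forall s t : R, 0 <= s <= 1 -> 0 <= t <= 1 -> `|s - t| <= N.+1%:R^-1 ->
  `|w (c s) * enorm (derive1 c s) - w (c t) * enorm (derive1 c t)| <= lam by near: N;
    exact: unif_cont_mesh cwT _.
set n : R := N.+1%:R in nr u1 u2 u3 u4 *; have n0 : 0 < n by rewrite ltr0n.
have nE : n = N.+1%:R by []; clearbody n.
have h0 : 0 < n^-1 by rewrite invr_gt0.
pose tk (k : 'I_N.+1) : R := k%:R / n.
have tk0 k : 0 <= tk k by rewrite divr_ge0// ltW.
have tk1 k : tk k + n^-1 <= 1.
  by rewrite /tk -[X in _ + X]mul1r -mulrDl ler_pdivrMr// mul1r natr1 nE ler_nat ltn_ord.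
have cell k (t : R) : tk k <= t <= tk k + n^-1 -> 0 <= t <= 1.
  by move=> /andP[t1 t2]; rewrite (le_trans (tk0 k) t1) (le_trans t2 (tk1 k)).
have cellk k : tk k <= tk k <= tk k + n^-1 by rewrite lexx lerDl ltW.
have celld k (t : R) : tk k <= t <= tk k + n^-1 -> `|t - tk k| <= n^-1.
  by move=> /andP[t1 t2]; rewrite ger0_norm ?subr_ge0// lerBlDl.
pose e := (lam + lam ^+ 2) / n.
have e0 : 0 < e by rewrite divr_gt0// addr_gt0.
have strip k := @arc_strip R (fun t => (c t).1) (fun t => (c t).2) (fun t => (derive1 c t).1)
  (fun t => (derive1 c t).2) (tk k) n^-1 (lam ^+ 2) e h0 (ltW kap0) e0 dx dy.
have pairE (v : R * R) : (v.1, v.2) = v by case: v.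
have {strip} /choice[B BP] k : exists B : set (R * R), [/\ measurable B,
    (mu2 B <= (2 * (e + 2 * lam ^+ 2 * n^-1) * (enorm (derive1 c (tk k)) * n^-1) + 8 * (e +
      2 * lam ^+ 2 * n^-1) ^+ 2)%:E)%E &
    forall t p, tk k <= t <= tk k + n^-1 -> enorm (p - c t) < e -> B p].
  have := strip k; rewrite pairE => /(_ (c'0 _)) [t tt|B [mB aB inB]].
    by split; [apply: u1|apply: u2]; rewrite ?celld ?(cell k)//.
  by exists B; split => // t p tt pt; apply: inB tt _; rewrite pairE.
(* In the weight, one of the two [lam] is demanded by the statement; the other pays half for passing
   from [p] to the curve and half for passing to the node of the cell. *)
exists B, (fun k => 2 * (e + 2 * lam ^+ 2 * n^-1) * (enorm (derive1 c (tk k)) * n^-1) + 8 * (e +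
  2 * lam ^+ 2 * n^-1) ^+ 2),
  (fun k => w (c (tk k)) + 2 * lam).
have Wk k : 0 <= w (c (tk k)) <= W.
  by rewrite w0/= (le_trans (ler_norm _))//; apply: WP; rewrite /= in_itv/= (cell k).
have Sk k : 0 <= enorm (derive1 c (tk k)) <= S.
  by rewrite enorm_ge0/= (le_trans (ler_norm _))//; apply: SP; rewrite /= in_itv/= (cell k).
have eE : e + 2 * lam ^+ 2 * n^-1 = (lam + 3 * lam ^+ 2) * n^-1 by rewrite /e; ring.
have sumh (z : R) : \sum_(k < N.+1) z * n^-1 = z.
  by rewrite sumr_const card_ord -mulr_natr -nE divfK// gt_eqF.
split.
- by move=> k; have [] := BP k.
- by move=> k; have /andP[W1 _] := Wk k; rewrite addr_ge0// mulr_ge0// ltW.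
- move=> p t t01 pt.
  have := @mesh_cell N t t01; rewrite -nE => -[k kt]; exists k; first by have [_ _] := BP k; apply;
    [exact: kt|exact: pt].
  have ct : ball (c t) r p.
    have er : e < r.
      have l2 : lam + lam ^+ 2 <= 2 by have : lam ^+ 2 <= 1; [rewrite exprn_ile1// ltW|lra].
      by apply: (@le_lt_trans _ _ (2 * n^-1)); [rewrite ler_pM2r|lra].
    rewrite enormB in pt.
    by apply/ball2P; split; apply: lt_trans er; apply: le_lt_trans pt;
      [exact: (enorm1 (c t - p))|exact: (enorm2 (c t - p))].
  have := rP (c t) p _ ct => /(_ _)/ltW; rewrite distrC => d1.
  have {}d1 : w p - w (c t) <= lam / 2.
    apply: le_trans (ler_norm _) _; apply: d1; exists t => //; rewrite /= in_itv/=; exact: cell kt.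
  have d2 : w (c t) - w (c (tk k)) <= lam / 2.
    by apply: le_trans (ler_norm _) _; apply: u3; rewrite ?celld ?(cell k).
  lra.
- apply: (@le_trans _ _ (\sum_(k < N.+1) (w (c (tk k)) * enorm (derive1 c (tk k)) * n^-1 +
      lam * (3 * W * S + 8 * S + 64 * (W + 2)) * n^-1))).
    apply: ler_sum => k _; rewrite eE.
    have /andP[w1 w2] := Wk k; have /andP[s1 s2] := Sk k.
    set w' := w _ in w1 w2 *; set s := enorm _ in s1 s2 *.
    (* The slope n / (2 lam) cancels the width 2 lam / n of the strip: what is left is the Riemann
       term w' s / n plus terms with a factor lam. *)
    have -> : n / (2 * lam) * (w' + 2 * lam) * (2 * ((lam + 3 * lam ^+ 2) / n) * (s / n) +
      8 * ((lam + 3 * lam ^+ 2) / n) ^+ 2) =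
      (w' + 2 * lam) * ((1 + 3 * lam) * s + 4 * lam * (1 + 3 * lam) ^+ 2) * n^-1.
      by field; rewrite !gt_eqF.
    rewrite -mulrDl ler_pM2r//.
    have ws : w' * s <= W * S by rewrite ler_pM.
    have q1 : (1 + 3 * lam) <= 4 by lra.
    have q2 : (1 + 3 * lam) ^+ 2 <= 16.
      by rewrite (_ : 16 = 4 ^+ 2) ?ler_pXn2r ?nnegrE//; [lra|ring].
    have -> : (w' + 2 * lam) * ((1 + 3 * lam) * s + 4 * lam * (1 + 3 * lam) ^+ 2) =
      w' * s + lam * (3 * (w' * s) + 2 * ((1 + 3 * lam) * s) + 4 * ((w' + 2 * lam) * (1 +
        3 * lam) ^+ 2)) by ring.
    rewrite lerD2l ler_pM2l//.
    have b1 : (1 + 3 * lam) * s <= 4 * S by rewrite ler_pM//; lra.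
    have b2 : (w' + 2 * lam) * (1 + 3 * lam) ^+ 2 <= (W + 2) * 16.
      by rewrite ler_pM ?sqr_ge0//; lra.
    lra.
  rewrite big_split/= sumh.
  have := @riemann_le R (fun t => w (c t) * enorm (derive1 c t)) N.+1 lam isT cwT.
  rewrite -nE => /(_ u4) rl; have : 0 <= lam * 128 by rewrite mulr_ge0// ltW.
  rewrite /tk; lra.
- rewrite eE.
  apply: (@le_trans _ _ (\sum_(k < N.+1) (lam * (8 * S + 128)) * n^-1)).
    apply: ler_sum => k _; have /andP[s1 s2] := Sk k; set s := enorm _ in s1 s2 *.
    have n1 : n^-1 <= 1 by rewrite invf_le1// nE ler1n.
    have -> : 2 * ((lam + 3 * lam ^+ 2) / n) * (s / n) + 8 * ((lam + 3 * lam ^+ 2) / n) ^+ 2 =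
      (lam * (n^-1 * ((1 + 3 * lam) * s * 2 + 8 * (lam * (1 + 3 * lam) ^+ 2)))) * n^-1 by ring.
    rewrite ler_pM2r// ler_pM2l//.
    have b1 : (1 + 3 * lam) * s <= 4 * S by rewrite ler_pM//; lra.
    have q2 : (1 + 3 * lam) ^+ 2 <= 16.
      by rewrite (_ : 16 = 4 ^+ 2) ?ler_pXn2r ?nnegrE//; [lra|lra|ring].
    have b2 : lam * (1 + 3 * lam) ^+ 2 <= 1 * 16 by rewrite ler_pM ?sqr_ge0// ltW.
    have b0 : 0 <= (1 + 3 * lam) * s * 2 + 8 * (lam * (1 + 3 * lam) ^+ 2).
      by rewrite addr_ge0// !mulr_ge0// ?sqr_ge0 ?addr_ge0 ?mulr_ge0// ltW.
    apply: (@le_trans _ _ (1 * ((1 + 3 * lam) * s * 2 + 8 * (lam * (1 + 3 * lam) ^+ 2)))).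
      by rewrite ler_wpM2r.
    lra.
  rewrite sumh ler_pM2l//.
  have : 0 <= W * S by rewrite mulr_ge0.
  lra.
Unshelve. all: by end_near. Qed.

End Curve.

(** * The flux of 2 tau through a regular domain *)

Section Main.
Context {R : realType}.
Local Notation mu := (@lebesgue_measure R).
Local Notation mu2 := (mu \x mu)%E.

Definition thicken (K : set (R * R)) (x : R) : set (R * R) :=
  [set p | exists2 d, K d & `|p.1 - d.1| <= x /\ `|p.2 - d.2| <= x].

(** It is the Minkowski sum of [K] and a closed square. *)
Lemma thicken_compact K x : compact K -> compact (thicken K x).
Proof.
move=> cK; have -> : thicken K x = (fun q : (R * R) * (R * R) => q.1 + q.2) @` (K `*` (`[- x,
  x] `*` `[- x, x])).
  apply/seteqP; split => [p [d Kd [d1 d2]]|_ [[d w] [/= Kd [+ +]] <-]].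
    exists (d, p - d); last by rewrite /= addrC subrK.
    by split => //; split; rewrite /= in_itv/= -ler_norml.
  rewrite /= !in_itv/= -!ler_norml => w1 w2; exists d => //=.
  by rewrite [d.1 + _]addrC addrK [d.2 + _]addrC addrK.
apply: continuous_compact.
  by apply: continuous_subspaceT => q; exact: add_continuous.
by apply: compact_setX => //; exact: rect_compact.
Qed.

Lemma normM_enorm (delta : R * R -> R) (p v : R * R) : 0 < delta p ->
  normM delta p v = (delta p)^-1 * enorm v.
Proof.
move=> d0; rewrite /normM /metricM -exprVn sqrtrM ?sqr_ge0// sqrtr_sqr.
by rewrite gtr0_norm ?invr_gt0// /enorm !expr2.
Qed.

Lemma enorm_rot (x y : R) : enorm (y, - x) = enorm (x, y).
Proof. by rewrite /enorm/= sqrrN addrC. Qed.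

Lemma integrable_patch (Q E : set (R * R)) (g : R * R -> R) : measurable Q -> measurable E ->
  mu2.-integrable Q (EFin \o g) -> mu2.-integrable Q (EFin \o (g \_ E)).
Proof.
move=> mQ mE Ig; rewrite -restrict_EFin; apply/integrable_restrict => //.
by apply: integrableS Ig => //; exact: measurableI.
Qed.

Lemma integrableB_fin (Q : set (R * R)) (g h : R * R -> R) : measurable Q ->
  mu2.-integrable Q (EFin \o g) -> mu2.-integrable Q (EFin \o h) ->
  mu2.-integrable Q (EFin \o (fun p => g p - h p)).
Proof.
move=> mQ Ig Ih.
have I := @integrableB _ _ R mu2 Q mQ _ _ Ig Ih.
exact: I.
Qed.

Lemma Rintegral_scalel (Q : set (R * R)) (g : R * R -> R) (s : R) : measurable Q ->
  mu2.-integrable Q (EFin \o g) ->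
  \int[mu2]_(p in Q) (s * g p) = s * \int[mu2]_(p in Q) g p.
Proof. by move=> mQ Ig; rewrite RintegralZl. Qed.

(** [curve_tube] covers parameters in [0, 1), whereas the boundary is a range over the whole
    line. *)
Lemma periodic_unit (c : R -> R * R) (t : R) : (forall t, c (t + 1) = c t) ->
  exists2 s, 0 <= s < 1 & c s = c t.
Proof.
move=> cp.
have cn (k : nat) s : c (s + k%:R) = c s.
  by elim: k s => [|k IH] s; rewrite ?addr0// -natr1 addrA cp.
have ci (z : int) s : c (s + z%:~R) = c s.
  case: z => k; first exact: cn.
  by rewrite NegzE mulrNz; have := cn k.+1 (s - k.+1%:R); rewrite subrK => ->.
exists (t - (Num.floor t)%:~R); last by rewrite -mulrNz ci.
have /andP[f1 f2] := floor_itv t.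
by rewrite subr_ge0 f1/= ltrBlDl; move: f2; rewrite intrD.
Qed.

Variables (Omega : set (R * R)) (delta tau : R * R -> R).
Hypothesis Omega_open : open Omega.
Hypothesis Omega_star : star_shaped Omega.
Hypothesis delta_gt0 : forall p, Omega p -> 0 < delta p.
Hypothesis delta_cont : forall p, Omega p -> {for p, continuous delta}.
Hypothesis tau_cont : forall p, Omega p -> {for p, continuous tau}.
Hypothesis dist : distinguishing Omega delta tau.

Local Notation C := (calabi_potential delta tau).
Local Notation u := (potential Omega delta tau).
Let close := @potential_close R Omega delta tau delta_gt0 Omega_open Omega_star delta_cont tau_cont dist.

Lemma potential_cont p : Omega p -> {for p, continuous u}.
Proof.
move=> Op; have cK : compact [set p] by exact: compact_set1.
have [r r0 rP] := @close [set p] 1 cK (fun q (qp : q = p) => eq_ind_r Omega Op qp) ltr01.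
apply/cvgrPdist_lt => e e0.
set L := `|C p| * (`|p.2| + `|p.1|) + (delta p)^-1 + 1.
have L0 : 0 < L by rewrite ltr_wpDl// addr_ge0 ?mulr_ge0 ?addr_ge0// invr_ge0 ltW// delta_gt0.
have s0 : 0 < Num.min r (e / L / 2) by rewrite lt_min r0 !divr_gt0.
near=> q.
have pq : ball (p : R * R) (Num.min r (e / L / 2)) q.
  by near: q; exact: (@nbhsx_ballx _ (R * R)%type).
have pqr : ball p r q by apply: le_ball pq; rewrite ge_min lexx.
have pqe : ball p (e / L / 2) q by apply: le_ball pq; rewrite ge_min lexx orbT.
have H := rP p q p erefl pqr (ballxx _ r0).
have en : enorm (p - q) < e / L.
  move/ball2P : pqe => [a1 a2]; apply: le_lt_trans (enorm_sum _) _.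
  by rewrite (splitr (e / L)) ltrD.
have om : `|omega delta tau p (p - q)| <= `|C p| * (`|p.2| + `|p.1|) * enorm (p - q).
  rewrite /omega normrM -mulrA ler_wpM2l//; apply: le_trans (ler_normB _ _) _.
  by rewrite !normrM mulrDl lerD// ler_wpM2l// ?enorm1 ?enorm2.
apply: (@le_lt_trans _ _ (L * enorm (p - q))); last by rewrite mulrC -ltr_pdivlMr.
rewrite -[u p - u q](subrK (omega delta tau p (p - q))).
apply: le_trans (ler_normD _ _) _.
have -> : L = (delta p)^-1 + 1 + `|C p| * (`|p.2| + `|p.1|) by rewrite /L -addrA addrC.
by rewrite mulrDl lerD.
Unshelve. all: by end_near. Qed.

Local Notation f := (fun p => 2 * (tau p / delta p ^+ 2)).

Lemma flux_density_cont p : Omega p -> {for p, continuous f}.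
Proof.
move=> Op; apply: cvgM; first exact: cvg_cst.
exact: (density_cont delta_gt0 delta_cont tau_cont).
Qed.

Variables (D : set (R * R)) (n : nat) (c : 'I_n -> R -> R * R).
Hypothesis regD : regular_domain Omega D c.

(** The error has two sources, both supported in the tube: the excess in the bound of the Stokes
    integrand, and the replacement of the indicator of [D] by its averaged cutoff. *)
Lemma flux_perturbed : exists2 K : R, 0 <= K & forall lam : R, 0 < lam <= 1 ->
  `|\int[mu2]_(p in D) f p| <= \sum_(i < n) curve_length delta (c i) + lam * K.
Proof.
have [oD D0 [cD DO] [cc _] bd] := regD.
have Di : D° = D by apply/seteqP; split; [exact: interior_subset|move: oD; rewrite openE].
rewrite {}Di in bd.
set B := closure D `\` D in bd.
have [r0 r00 r0P] := compact_open_ball cD Omega_open DO.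
(* [S1] will contain the tube and [S2] the balls of radius rho about points of [S1]; the third rho
   keeps [S2] inside [Omega]. *)
pose rho := r0 / 3; have rho0 : 0 < rho by rewrite divr_gt0.
have rho3 : r0 = 3 * rho by rewrite /rho mulrC divfK// pnatr_eq0.
pose S1 := thicken (closure D) rho; pose S2 := thicken (closure D) (2 * rho).
have S2O p : S2 p -> Omega p.
  move=> [d cd [d1 d2]]; apply: (r0P d) => //; apply/ball2P.
  by rewrite distrC (distrC d.2) rho3; split; lra.
have cS1 : compact S1 by exact: thicken_compact.
have cS2 : compact S2 by exact: thicken_compact.
have S12 p q : S1 p -> ball p rho q -> S2 q.
  move=> [d cd [d1 d2]] /ball2P[q1 q2]; exists d => //.
  move: d1 d2 q1 q2; rewrite !ler_norml !ltr_norml => d1 d2 q1 q2; split; apply/andP; split; lra.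
have S1S2 p : S1 p -> S2 p by move=> S1p; apply: S12 S1p _; exact: ballxx.
have clS1 p : closure D p -> S1 p by move=> cp; exists p => //; rewrite !subrr normr0 ltW.
(* The functions on Omega are replaced by continuous functions on the whole plane
   that agree with them on S2. *)
have [U cU UE] := tietze_compact cS2 (fun p Sp => potential_cont (S2O _ Sp)).
have [CC cCC CE] := tietze_compact cS2 (fun p Sp => calabi_cont delta_gt0 Omega_open Omega_star
  delta_cont tau_cont (S2O _ Sp)).
have [ff cff fE] := tietze_compact cS2 (fun p Sp => flux_density_cont (S2O _ Sp)).
have [ww cww wE] : exists2 G : R * R -> R, continuous G & forall p, S2 p -> G p = (delta p)^-1.
  apply: tietze_compact => // p /S2O Op; apply: cvgV; last exact: delta_cont.
  by rewrite gt_eqF//; exact: delta_gt0.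
have [a a0 Sa] : exists2 a : R, 0 < a & forall p, S2 p -> `|p.1| < a /\ `|p.2| < a.
  have [M1 M10 M1P] := compact_bound cS2 (fun p _ => @cont_fst R p).
  have [M2 M20 M2P] := compact_bound cS2 (fun p _ => @cont_snd R p).
  exists (M1 + M2 + 1); first by rewrite ltr_wpDl ?addr_ge0.
  by move=> p Sp; have := M1P p Sp; have := M2P p Sp; split; lra.
pose Q : set (R * R) := `[- a, a] `*` `[- a, a].
have S2Q p : S2 p -> Q p.
  by move=> /Sa[p1 p2]; split; rewrite /= in_itv/= -ler_norml ltW.
have clQ p : closure D p -> Q p by move=> /clS1/S1S2/S2Q.
have mQ : measurable Q by exact: rect_measurable.
(* [regular_domain] allows an empty family of curves; boundedness excludes it, as the segment from a
   point of [D] to (a, 0), which is outside [D], crosses [B]. *)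
have B0 : B !=set0.
  have [d Dd] := D0; pose q : R * R := (a, 0).
  have nq : ~ D q.
    move=> Dq; have [] := Sa q; first by apply/S1S2/clS1/subset_closure.
    by rewrite /q/= gtr0_norm// ltxx.
  have [b Bb _] := @segment_crossing R D B oD (fun p h => h) d q Dd nq.
  by exists b.
have BS b : B b -> closure D b by case.
have DB : closure D `\` D `<=` B by [].
have onB i t : B (c i t) by rewrite bd; exists i => //; exists t.
have tubeK i := @curve_tube R (c i) ww.
have {tubeK} /choice[K KP] i : exists K : R, 0 <= K /\ forall lam : R, 0 < lam <= 1 -> \forall N \near \oo,
    exists (B : 'I_N.+1 -> set (R * R)) (b a : 'I_N.+1 -> R),
    [/\ forall k, measurable (B k) /\ (mu2 (B k) <= (b k)%:E)%E, forall k, 0 <= a k,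
      forall p t, 0 <= t < 1 -> enorm (p - c i t) < (lam + lam ^+ 2) / N.+1%:R ->
        exists2 k, B k p & ww p + lam <= a k,
      \sum_k (N.+1%:R / (2 * lam) * a k) * b k <=
        curve_length delta (c i) + lam * K &
      \sum_k b k <= lam * K].
  have [sc per c'0 _] := cc i.
  have wci t : ww (c i t) = (delta (c i t))^-1 by apply/wE/S1S2/clS1/BS.
  have dci t : 0 < delta (c i t) by apply/delta_gt0/DO/BS.
  have [|K K0 KP] := tubeK i sc c'0 cww.
    by move=> t; rewrite wci invr_ge0 ltW.
  exists K; split => // lam /KP; apply: filterS => N [B' [b [a' [h1 h2 h3 h4 h5]]]].
  exists B', b, a'; split => //; apply: le_trans h4 _; rewrite lerD2r /curve_length.
  rewrite le_eqVlt; apply/orP; left; apply/eqP; apply: eq_Rintegral => t _.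
  by rewrite normM_enorm// wci.
have [F F0 FP] := compact_bound (@rect_compact R (- a) a (- a) a) (fun p _ => cff p).
have KK0 : 0 <= \sum_i K i by apply: sumr_ge0 => i _; have [] := KP i.
(* The 1 comes from the Stokes integrand; the 2 F bounds, on a tube of area at most lam times the
   sum of the K i, the change made by the cutoff. *)
exists ((1 + 2 * F) * \sum_i K i); first by rewrite mulr_ge0// addr_ge0// mulr_ge0.
move=> lam lam01; have /andP[lam0 lam1] := lam01.
have [rp rp0 rpP] := close cS1 (fun p Sp => S2O _ (S1S2 _ Sp)) lam0.
have nearN : \forall N \near \oo, 2 * N.+1%:R^-1 < rho.
  have := @near_natSinv_lt R (rho / 2); rewrite divr_gt0// => /(_ isT); apply: filterS => N h.
  by rewrite mulrC -ltr_pdivlMr.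
have nearT := @filter_forall _ _ (fun i N => exists (B : 'I_N.+1 -> set (R * R)) (b a : 'I_N.+1 -> R),
    [/\ forall k, measurable (B k) /\ (mu2 (B k) <= (b k)%:E)%E, forall k, 0 <= a k,
      forall p t, 0 <= t < 1 -> enorm (p - c i t) < (lam + lam ^+ 2) / N.+1%:R ->
        exists2 k, B k p & ww p + lam <= a k,
      \sum_k (N.+1%:R / (2 * lam) * a k) * b k <=
        curve_length delta (c i) + lam * K i &
      \sum_k b k <= lam * K i]) _ _ (fun i => (KP i).2 lam lam01).
have [N [Nrho]] := filter_ex (filterI nearN (nearT _)).
move=> /choice[A] /choice[b] /choice[al] HT.
have n0 : 0 < N.+1%:R :> R by rewrite ltr0n.
move: (N.+1%:R : R) n0 Nrho HT => nn n0 Nrho HT.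
have nV0 : 0 < nn^-1 by rewrite invr_gt0.
pose e := lam / nn; pose eT := (lam + lam ^+ 2) / nn.
have e0 : 0 < e by rewrite divr_gt0.
have l20 : 0 < lam ^+ 2 by rewrite exprn_gt0.
have l21 : lam ^+ 2 <= 1 by rewrite exprn_ile1// ltW.
have eTrho : eT < rho.
  apply: le_lt_trans Nrho; rewrite /eT ler_pM2r//; lra.
(* The first bound fits e + 12 m into the tube radius eT; the second keeps the averaging square
   where [potential_close] holds and [U] agrees with u. *)
pose m := Num.min (lam ^+ 2 / nn / 12) (Num.min rp rho / 2).
have m0 : 0 < m by rewrite lt_min !divr_gt0// lt_min rp0.
have m12 : e + 12 * m <= eT.
  have -> : eT = e + lam ^+ 2 / nn by rewrite /eT /e mulrDl.
  by rewrite lerD2l mulrC -ler_pdivlMr// ge_min lexx.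
have mr : m < Num.min rp rho.
  apply: (@le_lt_trans _ _ (Num.min rp rho / 2)); first by rewrite ge_min lexx orbT.
  by rewrite ltr_pdivrMr// ltr_pMr ?ltr1n// lt_min rp0.
pose ph := cutoff D B e.
have cph : continuous ph by exact: cutoff_cont.
(* Outside this set the averaged cutoff vanishes together with its gradient. *)
pose St p := D p \/ bdist B p < eT.
have tubeS1 p : bdist B p < eT -> S1 p.
  move=> /(bdist_lt B0)[b' Bb pb]; exists b'; first exact: BS.
  by split; apply: le_trans (ltW (lt_trans pb eTrho)); [exact: (enorm1 (p - b'))|exact: (enorm2 (p - b'))].
have StS1 p : St p -> S1 p by move=> [/subset_closure/clS1//|]; exact: tubeS1.
have grad0 p : eT <= bdist B p -> mollify_x m ph p = 0 /\ mollify_y m ph p = 0.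
  by move=> far; apply: cutoff_grad_far => //; exact: le_trans far.
have val0 p : eT <= bdist B p -> mollify m ph p = if `[< D p >] then 1 else 0.
  by move=> far; apply: cutoff_mollify_far => //; exact: le_trans far.
have WS : \int[mu2]_(p in Q) (ff p * mollify m ph p) = \int[mu2]_(p in Q) stokes_integrand m ph U CC p.
  apply: (@weak_stokes R a a0 m m0 ph U ff CC St) => //.
  - by move=> p /StS1/S1S2/Sa.
  - move=> p nSt; have far : eT <= bdist B p by rewrite leNgt; apply/negP => h; apply: nSt; right.
    have [gx gy] := grad0 p far; split => //.
    by rewrite val0//; case: asboolP => // Dp; exfalso; apply: nSt; left.
  - move=> p s /andP[s1 s2] /StS1 Ssp; have s0 : 0 < s by exact: lt_le_trans s1.
    have Osp := S2O _ (S1S2 _ Ssp).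
    have dC := calabi_radial delta_gt0 Omega_open Omega_star delta_cont tau_cont s0 Osp.
    rewrite (fE _ (S1S2 _ Ssp)); apply: near_eq_is_derive dC.
    (* The derivative at [s] needs [CC] and [C] to agree around [s *: p], which the margin between
       [S1] and [S2] provides. *)
    have near_s : \forall x \near s, ball (s *: p) rho (x *: p).
      by apply: (@ray_cont R p s); exact: (@nbhsx_ballx _ (R * R)%type).
    apply: filterS near_s => x xb.
    by rewrite CE//; exact: S12 xb.
have al0 i k : 0 <= al i k by have [_ + _ _ _] := HT i; apply.
have inTube p : bdist B p < eT -> exists x : 'I_n * 'I_N.+1, A x.1 x.2 p /\ ww p + lam <= al x.1 x.2.
  move=> /(bdist_lt B0)[b']; rewrite bd => -[i _ [t _ <-]] pt.
  have [_ per _ _] := cc i; have [s s01 sE] := periodic_unit t per.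
  have [_ _ H _ _] := HT i; rewrite -sE in pt; have [k Ak alk] := H p s s01 pt.
  by exists (i, k).
have indic0 (al' : 'I_n -> 'I_N.+1 -> R) (p : R * R) : (forall i k, 0 <= al' i k) ->
    0 <= \sum_(x : 'I_n * 'I_N.+1) al' x.1 x.2 * \1_(A x.1 x.2) p.
  by move=> h; apply: sumr_ge0 => x _; rewrite mulr_ge0.
have indic1 (al' : 'I_n -> 'I_N.+1 -> R) (p : R * R) (x : 'I_n * 'I_N.+1) : (forall i k, 0 <= al' i k) ->
    A x.1 x.2 p -> al' x.1 x.2 <= \sum_(x : 'I_n * 'I_N.+1) al' x.1 x.2 * \1_(A x.1 x.2) p.
  move=> h Ap; rewrite (bigD1 x)//= indicE mem_set// mulr1 lerDl.
  by apply: sumr_ge0 => y _; rewrite mulr_ge0.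
pose cf i k := nn / (2 * lam) * al i k.
have cf0 i k : 0 <= cf i k by rewrite mulr_ge0// divr_ge0 ?mulr_ge0// ltW.
have gradle p : enorm (mollify_x m ph p, mollify_y m ph p) <= nn / (2 * lam).
  have -> : nn / (2 * lam) = (2 * e)^-1 by rewrite /e; field; rewrite !gt_eqF.
  exact: cutoff_grad.
have ptw p : Q p -> `|stokes_integrand m ph U CC p| <= \sum_(x :
  'I_n * 'I_N.+1) cf x.1 x.2 * \1_(A x.1 x.2) p.
  move=> Qp; have [far|near_] := leP eT (bdist B p).
    have [gx gy] := grad0 p far.
    by rewrite /stokes_integrand gx gy !mulr0 subrr addr0 mulr0 subr0 normr0; exact: indic0.
  have S1p := tubeS1 p near_; have S2p := S1S2 p S1p.
  have [x [Ax alx]] := inTube p near_.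
  apply: le_trans (indic1 cf p x cf0 Ax).
  (* The linear form is omega at [p], and the test vector is the gradient of the cutoff turned by a
     right angle. *)
  have := @mollify_grad R m m0 U p (C p * p.2,
    - (C p * p.1)) ((delta p)^-1 + lam) (Num.min rp rho) cU _ mr _
    (mollify_y m ph p, - mollify_x m ph p).
  rewrite -/(enorm (mollify_y m ph p, - mollify_x m ph p)) => /(_ _ _)H.
  have wp : (delta p)^-1 = ww p by rewrite wE.
  have dp : 0 <= (delta p)^-1 by rewrite invr_ge0 ltW// delta_gt0//; exact: S2O.
  rewrite /stokes_integrand.
  have -> : mollify_x m U p * mollify_y m ph p - mollify_y m U p * mollify_x m ph p - CC p * (p.1 *
    mollify_x m ph p + p.2 * mollify_y m ph p) =
    mollify_x m U p * (mollify_y m ph p, - mollify_x m ph p).1 + mollify_y m U p * (mollify_y m ph p,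
      - mollify_x m ph p).2 -
     ((C p * p.2, - (C p * p.1)).1 * (mollify_y m ph p, - mollify_x m ph p).1 + (C p * p.2,
       - (C p * p.1)).2 * (mollify_y m ph p, - mollify_x m ph p).2).
    by rewrite (CE p S2p)/=; ring.
  apply: le_trans (H _ _) _.
  - by rewrite addr_ge0// ltW.
  - move=> q q' pq pq'.
    have pqr : ball p rp q by apply: le_ball pq; rewrite ge_min lexx.
    have pqr' : ball p rp q' by apply: le_ball pq'; rewrite ge_min lexx.
    have pqo : ball p rho q by apply: le_ball pq; rewrite ge_min lexx orbT.
    have pqo' : ball p rho q' by apply: le_ball pq'; rewrite ge_min lexx orbT.
    rewrite (UE q (S12 _ _ S1p pqo)) (UE q' (S12 _ _ S1p pqo')).
    have := rpP p q q' S1p pqr pqr'.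
    have -> : omega delta tau p (q' - q) = C p * p.2 * (q'.1 - q.1) + - (C p * p.1) * (q'.2 - q.2).
      by rewrite /omega/=; ring.
    by [].
  - rewrite enorm_rot wp /cf mulrC ler_pM ?enorm_ge0//; first by rewrite -wp addr_ge0// ltW.
have i1 : `|\int[mu2]_(p in Q) stokes_integrand m ph U CC p| <= \sum_i curve_length delta (c i) +
  lam * \sum_i K i.
  apply: (@le_trans _ _ (\sum_(x : 'I_n * 'I_N.+1) cf x.1 x.2 * b x.1 x.2)).
    apply: (@cover_integral_bound R _ Q (fun x => A x.1 x.2) (fun x => cf x.1 x.2)) => //.
    - by apply: rect_integrable; exact: stokes_integrand_cont.
    - by move=> x; have [+ _ _ _ _] := HT x.1 => /(_ x.2)[].
    - by move=> x; have [+ _ _ _ _] := HT x.1 => /(_ x.2)[].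
  rewrite -(pair_bigA _ (fun i k => cf i k * b i k))/= mulr_sumr -big_split/=.
  by apply: ler_sum => i _; have [_ _ _ + _] := HT i.
have mD : measurable D by exact: open_measurable2.
have DQ : D = Q `&` D.
  by apply/seteqP; split => [p Dp|p []//]; split => //; apply: clQ; exact: subset_closure.
have If : mu2.-integrable Q (EFin \o (ff \_ D)).
  by apply: integrable_patch => //; exact: rect_integrable.
have Ifp : mu2.-integrable Q (EFin \o (fun p => ff p * mollify m ph p)).
  apply: rect_integrable => p; apply: cvgM; [exact: cff|exact: (mollify_cont m0 cph)].
(* Off the tube the averaged cutoff is the indicator of [D]; on the tube each of the two terms is at
   most F. *)
have i2 : `|\int[mu2]_(p in Q) ((ff \_ D) p - ff p * mollify m ph p)| <= 2 * F * (lam * \sum_i K i).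
  apply: (@le_trans _ _ (\sum_(x : 'I_n * 'I_N.+1) (2 * F) * b x.1 x.2)).
    apply: (@cover_integral_bound R _ Q (fun x => A x.1 x.2) (fun x => 2 * F)) => //.
    - exact: integrableB_fin.
    - by move=> x; have [+ _ _ _ _] := HT x.1 => /(_ x.2)[].
    - by move=> _; rewrite mulr_ge0.
    - by move=> x; have [+ _ _ _ _] := HT x.1 => /(_ x.2)[].
    move=> p Qp; have F20 (i : 'I_n) (k : 'I_N.+1) : 0 <= 2 * F by rewrite mulr_ge0.
    have [far|near_] := leP eT (bdist B p).
      rewrite val0// patchE; case: asboolP => Dp.
        rewrite mem_set// mulr1 subrr normr0; exact: (indic0 (fun _ _ => 2 * F)).
      rewrite memNset// mulr0 subrr normr0; exact: (indic0 (fun _ _ => 2 * F)).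
    have [x [Ax _]] := inTube p near_.
    apply: le_trans (indic1 (fun _ _ => 2 * F) p x F20 Ax).
    apply: le_trans (ler_normB _ _) _; rewrite mulr_natl mulr2n lerD//.
      by rewrite patchE; case: ifP => _; [exact: FP|rewrite normr0].
    rewrite normrM -[leRHS]mulr1 ler_pM//; first exact: FP.
    exact: cutoff_mollify_bound.
  rewrite -(pair_bigA _ (fun i k => 2 * F * b i k))/= mulr_sumr mulr_sumr.
  apply: ler_sum => i _; rewrite -mulr_sumr ler_wpM2l ?mulr_ge0//.
  by have [_ _ _ _] := HT i.
have -> : \int[mu2]_(p in D) f p = \int[mu2]_(p in Q) (ff \_ D) p.
  rewrite -Rintegral_mkcondr -DQ; apply: eq_Rintegral => p; rewrite inE => Dp.
  by rewrite fE//; apply/S1S2/clS1/subset_closure.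
have -> : \int[mu2]_(p in Q) (ff \_ D) p = \int[mu2]_(p in Q) ((ff \_ D) p - ff p * mollify m ph p) +
    \int[mu2]_(p in Q) stokes_integrand m ph U CC p.
  by rewrite RintegralB// WS subrK.
apply: le_trans (ler_normD _ _) _.
move: i1 i2; lra.
Qed.

Lemma flux_le : `|\int[mu2]_(p in D) f p| <= \sum_(i < n) curve_length delta (c i).
Proof.
have [K K0 KP] := flux_perturbed.
have K1 : 0 < K + 1 by rewrite ltr_wpDl.
apply/ler_addgt0Pr => e e0.
have l0 : 0 < Num.min 1 (e / (K + 1)) by rewrite lt_min ltr01 divr_gt0.
apply: le_trans (KP (Num.min 1 (e / (K + 1))) _) _; first by rewrite l0 ge_min lexx.
rewrite lerD2l; apply: (@le_trans _ _ (e / (K + 1) * (K + 1))); last by rewrite divfK// gt_eqF.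
by rewrite ler_pM// ?(ltW l0)// ?lerDl// ge_min lexx orbT.
Qed.

Let Dsub : exists a : R, D `<=` `[- a, a] `*` `[- a, a].
Proof.
have [_ _ [cD _] _ _] := regD.
have [M1 M10 M1P] := compact_bound cD (fun p _ => @cont_fst R p).
have [M2 M20 M2P] := compact_bound cD (fun p _ => @cont_snd R p).
exists (M1 + M2) => p /subset_closure Dp; have := M1P p Dp; have := M2P p Dp.
by move=> h2 h1; split; rewrite /= in_itv/= -ler_norml; lra.
Qed.

Let mD : measurable D. Proof. by apply: open_measurable2; have [] := regD. Qed.

Lemma domain_integrable (g : R * R -> R) : (forall p, Omega p -> {for p, continuous g}) ->
  mu2.-integrable D (EFin \o g).
Proof.
move=> cg; have [_ _ [cD DO] _ _] := regD.
have [G cG GE] := tietze_compact cD (fun p Dp => cg p (DO p Dp)).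
have [a Da] := Dsub.
have IG : mu2.-integrable D (EFin \o G).
  by apply: integrableS (rect_integrable (- a) a (- a) a cG) => //; exact: rect_measurable.
move: IG; apply: eq_integrable => // p; rewrite inE => Dp /=.
by rewrite GE//; exact: subset_closure.
Qed.

Lemma density_inv_cont p : Omega p -> {for p, continuous (fun p => delta p ^- 2)}.
Proof.
move=> Op; have d0 := delta_gt0 Op.
apply: cvgV; first by rewrite sqrf_eq0 gt_eqF.
by rewrite expr2; apply: cvgM; exact: delta_cont.
Qed.

Lemma domain_measure_gt0 : 0 < fine (mu2 D).
Proof.
have [oD [p Dp] _ _ _] := regD.
have : nbhs p D by exact: open_nbhs_nbhs.
rewrite -nbhs_ballE => -[e /= e0 eD].
have [a Da] := Dsub.
pose box : set (R * R) := `[p.1 - e / 2, p.1 + e / 2] `*` `[p.2 - e / 2, p.2 + e / 2].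
have boxD : box `<=` D.
  move=> q [/=]; rewrite !in_itv/= => q1 q2; apply: eD; apply/ball2P.
  by rewrite !ltr_norml; split; apply/andP; split; lra.
have b1 : (mu2 box <= mu2 D)%E by apply: le_measure => //; rewrite inE//; exact: rect_measurable.
have b2 : (mu2 D < +oo)%E.
  apply: le_lt_trans (rect_finite (- a) a (- a) a).
  by apply: le_measure => //; rewrite inE//; exact: rect_measurable.
rewrite -lte_fin fineK; last by rewrite ge0_fin_numE// measure_ge0.
apply: lt_le_trans b1; rewrite /box product_measure1E; [|exact: measurable_itv..].
have pos (x : R) : (0 < mu `[(x - e / 2)%R, (x + e / 2)%R])%E.
  rewrite lebesgue_measure_itv/= lte_fin ifT; last lra.
  by rewrite -EFinD lte_fin; lra.
by apply: mule_gt0; exact: pos.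
Qed.

(** delta is bounded on the compact closure, so the density is bounded below. Positivity lets the
    quotient be cleared, since division by zero would return 0. *)
Lemma area_gt0 : 0 < area delta D.
Proof.
have [oD D0 [cD DO] _ _] := regD.
have [M M0 MP] := compact_bound cD (fun p Dp => delta_cont (DO p Dp)).
have M1 : 0 < M + 1 by rewrite ltr_wpDl.
apply: (@lt_le_trans _ _ ((M + 1) ^- 2 * fine (mu2 D))).
  by rewrite mulr_gt0 ?domain_measure_gt0// invr_gt0 exprn_gt0.
rewrite -Rintegral_cst//; apply: le_Rintegral => //.
- by apply: domain_integrable => p _; exact: cvg_cst.
- exact: domain_integrable density_inv_cont.
move=> p Dp; have Op := DO _ (subset_closure Dp); have d0 := delta_gt0 Op.
rewrite lef_pV2 ?posrE ?exprn_gt0// ler_pXn2r ?nnegrE ?(ltW d0) ?(ltW M1)//.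
have := MP p (subset_closure Dp); rewrite gtr0_norm// => /le_trans; apply.
by rewrite lerDl.
Qed.

(** [s] is the constant sign of tau: multiplied by it, the density no longer cancels and the
    pointwise bound integrates. *)
Lemma flux_ge (s t : R) : `|s| = 1 -> (forall p, Omega p -> t <= s * tau p) ->
  2 * t * area delta D <= `|\int[mu2]_(p in D) f p|.
Proof.
move=> s1 st; have [oD D0 [cD DO] _ _] := regD.
have If : mu2.-integrable D (EFin \o f) by apply: domain_integrable; exact: flux_density_cont.
have Id := domain_integrable density_inv_cont.
have E1 := Rintegral_scalel s mD If; have E2 := Rintegral_scalel (2 * t) mD Id.
suff : \int[mu2]_(p in D) (2 * t * delta p ^- 2) <= `|\int[mu2]_(p in D) (s * f p)|.
  by rewrite E1 E2 normrM s1 mul1r.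
apply: le_trans (ler_norm _); apply: le_Rintegral => //.
- apply: domain_integrable => p Op; apply: cvgM; [exact: cvg_cst|exact: density_inv_cont].
- apply: domain_integrable => p Op; apply: cvgM; [exact: cvg_cst|exact: flux_density_cont].
move=> p Dp; have Op := DO _ (subset_closure Dp); have d0 := delta_gt0 Op.
have -> : s * (2 * (tau p / delta p ^+ 2)) = 2 * (s * tau p) * delta p ^- 2 by ring.
by rewrite ler_wpM2r ?invr_ge0 ?exprn_ge0 ?(ltW d0)// ler_pM2l// st.
Qed.

End Main.

(** If tau changed sign between the origin and [p], the intermediate value theorem on the ray would
    produce a zero. *)
Lemma constant_sign (R : realType) (Omega : set (R * R)) (tau : R * R -> R) (t : R) :
  star_shaped Omega -> (forall p, Omega p -> {for p, continuous tau}) ->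
  0 < t -> (forall p, Omega p -> t <= `|tau p|) ->
  exists2 s : R, `|s| = 1 & forall p, Omega p -> t <= s * tau p.
Proof.
move=> Ostar ct t0 tt.
have nz p : Omega p -> tau p != 0 by move=> /tt; rewrite -normr_gt0; exact: lt_le_trans.
have ray p : Omega p -> ~ (Num.min (tau 0) (tau p) <= 0 <= Num.max (tau 0) (tau p)).
  move=> Op h; have Or (r : R) : 0 <= r <= 1 -> Omega (r *: p) by exact: Ostar.2.
  have cr : {within `[0, 1], continuous (fun r : R => tau (r *: p))}.
    apply: continuous_in_subspaceT => r; rewrite inE/= in_itv/= => r01.
    by apply: (@continuous_comp _ _ _ (fun r : R => r *: p) tau); [exact: ray_cont|apply: ct; exact: Or].
  have [|r] := @IVT R (fun r => tau (r *: p)) 0 1 0 ler01 cr.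
    by rewrite scale0r scale1r.
  by rewrite in_itv/= => /Or/nz/eqP.
have [s0|s0] := ltP 0 (tau 0).
  exists 1 => [|p Op]; first by rewrite normr1.
  have := tt p Op; rewrite mul1r; case: (ltP 0 (tau p)) => pp; first by rewrite gtr0_norm.
  by exfalso; apply: (ray p Op); rewrite ge_min pp orbT le_max ltW.
exists (-1) => [|p Op]; first by rewrite normrN1.
have := tt p Op; rewrite mulN1r; case: (leP 0 (tau p)) => pp; last by rewrite ltr0_norm.
by exfalso; apply: (ray p Op); rewrite ge_min s0 le_max pp orbT.
Qed.

Theorem corollary18 (R : realType) (Omega : set (R * R)%type)
    (delta tau : (R * R)%type -> R)
    (Omega_open : open Omega) (Omega_star : star_shaped Omega)
    (delta_smooth : smooth Omega (delta : (R * R)%type -> R^o))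
    (delta_gt0 : forall p, Omega p -> 0 < delta p)
    (tau_smooth : smooth Omega (tau : (R * R)%type -> R^o))
    (inf_tau : cheeger Omega delta / 2 < inf [set `|tau p| | p in Omega]) :
  ~ distinguishing Omega delta tau.
Proof.
move=> dist.
have delta_cont p : Omega p -> {for p, continuous delta}.
  by move=> Op; have [+ _] := delta_smooth 0%N; apply; rewrite inE.
have tau_cont p : Omega p -> {for p, continuous tau}.
  by move=> Op; have [+ _] := tau_smooth 0%N; apply; rewrite inE.
set t := inf _ in inf_tau.
have [r [D [n [c [regD ->]]]] rt] : exists2 r, [set r | exists (D : set (R * R)) (n : nat) (c :
  'I_n -> R -> R * R),
    regular_domain Omega D c /\ r = (\sum_(i < n) curve_length delta (c i)) / area delta D] r & r < 2 * t.
  apply: inf_lt; last by move: inf_tau; rewrite ltr_pdivrMr// mulrC.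
  have [D [n [c regD]]] := disk_regular Omega_open Omega_star.1.
  by exists ((\sum_(i < n) curve_length delta (c i)) / area delta D), D, n, c.
have A0 := area_gt0 delta_gt0 delta_cont regD.
have L0 : 0 <= \sum_(i < n) curve_length delta (c i).
  by apply: sumr_ge0 => i _; apply: Rintegral_ge0 => s _; exact: sqrtr_ge0.
(* [constant_sign] needs a positive bound; it comes from a nonnegative quotient lying strictly below
   [2 * t]. *)
have t0 : 0 < t.
  have : 0 < 2 * t by apply: le_lt_trans rt; rewrite divr_ge0// ltW.
  by rewrite pmulr_rgt0.
have tle p : Omega p -> t <= `|tau p|.
  by move=> Op; apply: ge_inf; [exists 0 => _ [q _ <-]|exists p].
have [s s1 st] := constant_sign Omega_star tau_cont t0 tle.
have := flux_ge delta_gt0 delta_cont tau_cont regD s1 st.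
have := flux_le Omega_open Omega_star delta_gt0 delta_cont tau_cont dist regD.
move: rt; rewrite ltr_pdivrMr// => rt h1 h2.
by have := le_lt_trans (le_trans h2 h1) rt; rewrite ltxx.
Qed.
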